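(* Let $A$ be an $(n-2)\times n$ integer matrix of rank $n-2$ whose row space over $\mathbb{Q}$ contains $(1,\dots,1)$, so that $X_A\subset\mathbb{P}^{n-1}$ is a projective toric variety of codimension $2$, let $B$ be a Gale dual of $A$ with rows $b_1,\dots,b_n$, all nonzero, and let $P=\mathrm{Conv}(A)$. Let $\beta$ be a proper face of $P$ such that not all rows of $B_\beta$ are contained in the same relevant line. Let $r=|\mathfrak{I}_\beta|$ be the number of rows of $B_\beta$, let $w_\beta=-\sum_{i\in\mathfrak{I}_\beta}b_i$, and let $B'_\beta$ be the $(r+1)\times 2$ matrix obtained by adding $w_\beta$ as an extra row to $B_\beta$. Then $$\mu(P,\beta)=\frac{\deg(I_{B'_\beta})}{|T(\mathbb{Z}^{r+1}/\mathbb{Z}B'_\beta)|}-\frac{\sum_{j\in\mathfrak{I}_\beta,\ \det(w_\beta,b_j)>0}\det(w_\beta,b_j)}{|T(\mathbb{Z}^{r+1}/\mathbb{Z}B'_\beta)|}$$ and $$i(P,\beta)=|T(\mathbb{Z}^{r+1}/\mathbb{Z}B'_\beta)|=\gcd([i,j])_{i,j\in\mathfrak{I}_\beta}.$$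
   Context: Notation. The columns of $A$ are $a_1,\dots,a_n\in\mathbb{Z}^{d}$, $d=n-2$; $P=\mathrm{Conv}(A)$ is the convex hull of the columns. $X_A\subset\mathbb{P}^{n-1}$ is the closure of the image of the monomial map $t\mapsto(t^{a_1}:\cdots:t^{a_n})$, $t\in(\mathbb{C}^* )^d$. A Gale dual of $A$ is an $n\times 2$ integer matrix $B$ whose columns form a $\mathbb{Z}$-basis of the kernel of $A:\mathbb{Z}^n\to\mathbb{Z}^{d}$ (image of $B$ equals kernel of $A$). Its rows are $b_1,\dots,b_n\in\mathbb{Z}^2$, and $[i,j]:=\det(b_i,b_j)$. Faces are understood to be nonempty. For a face $\alpha$ of $P$: $A_\alpha$ is the collection of columns $a_i$ of $A$ lying on $\alpha$; $\mathfrak{I}_\alpha=\{i: a_i\notin\alpha\}$; $B_\alpha$ is the collection (or matrix) of rows $b_i$ with $i\in\mathfrak{I}_\alpha$. $\mathbb{Z}\alpha$ is the subgroup of $\mathbb{Z}^d$ generated by $A_\alpha$, and $\mathbb{R}\alpha$ is the linear subspace of $\mathbb{R}^d$ spanned by $\alpha$. A line through $0$ in $\mathbb{R}^2$ is a relevant line if it contains two of the rows $b_r,b_s$ of $B$ pointing in opposite directions. For faces $\beta\subset\alpha$ of $P$: $i(\alpha,\beta)$ is the index $[\mathbb{Z}\alpha\cap\mathbb{R}\beta:\mathbb{Z}\beta]$. The relative normalized subdiagram volume is $$\mu(\alpha,\beta)=\mathrm{Vol}(\mathrm{Conv}(A_\alpha/\beta))-\mathrm{Vol}(\mathrm{Conv}((A_\alpha/\beta)\setminus\{0\})),$$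 where $A_\alpha/\beta$ is the image of $A_\alpha$ in the quotient lattice $\mathbb{Z}\alpha/(\mathbb{Z}\alpha\cap\mathbb{R}\beta)$, which has rank $\dim\alpha-\dim\beta$, and $\mathrm{Vol}$ is the $(\dim\alpha-\dim\beta)$-dimensional volume normalized with respect to this quotient lattice (a unimodular simplex has volume $1$; the volume of a lower-dimensional or empty polytope is $0$, while a point in rank $0$ has volume $1$). For an $m\times 2$ integer matrix $C$, $\mathbb{Z}C\subset\mathbb{Z}^m$ is the lattice spanned by its columns, and its lattice ideal is $I_C=(x^{l^+}-x^{l^-} : l\in\mathbb{Z}C)\subset\mathbb{C}[x_1,\dots,x_m]$, where $l^+_i=\max(l_i,0)$ and $l^-_i=\max(-l_i,0)$. If the rows of $C$ sum to zero then $I_C$ is homogeneous, and $\deg(I_C)$ is its degree (the degree of the standard graded ring $\mathbb{C}[x_1,\dots,x_m]/I_C$, from its Hilbert polynomial). For an inclusion $L\subset M$ of abelian groups, $T(M/L)$ is the torsion subgroup of $M/L$ and $|T(M/L)|$ its order. *)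

(* Defs.v *)
From HB Require Import structures.
From mathcomp Require Import all_boot all_order all_algebra finmap complex.
From mathcomp Require Import all_classical all_reals all_analysis.
(* The notations of mpoly clash with those of mathcomp-analysis;
   [mpoly m F] is the polynomial ring F[x_1, ..., x_m]. *)
From mathcomp Require Import -(notations) mpoly.

Set Implicit Arguments.
Unset Strict Implicit.
Unset Printing Implicit Defensive.

Import Order.TTheory GRing.Theory Num.Theory.

Local Open Scope classical_set_scope.
Local Open Scope ring_scope.

Section Lattices.
Variable V : zmodType.

Definition lattice_coset (L : set V) (v : V) : set V := [set v + l | l in L].

(* [M : L], with value 0 when the index is infinite. *)
Definition group_index (M L : set V) : nat :=
  #|` fset_set [set lattice_coset L v | v in M]|%fset.

(* |T(V / L)| *)
Definition torsion_order (L : set V) : nat :=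
  group_index [set v | exists2 k, (0 < k)%N & L (v *+ k)] L.

End Lattices.

Definition column_lattice m p (C : 'M[int]_(m, p)) : set 'cV[int]_m :=
  [set C *m z | z in [set: 'cV[int]_p]].

Definition gale_dual d n p (A : 'M[int]_(d, n)) (B : 'M[int]_(n, p)) : Prop :=
  column_lattice B = [set v | A *m v = 0] /\
  injective (fun z : 'cV[int]_p => B *m z).

Definition det2 (u v : 'rV[int]_2) : int := \det (col_mx u v : 'M[int]_2).

Section DegreeOfIdeals.
Variables (F : fieldType) (m : nat).

Definition ideal_gen (G : set (mpoly m F)) : set (mpoly m F) :=
  [set f | exists N (g h : 'I_N -> mpoly m F),
     (forall i, G (h i)) /\ f = \sum_i g i * h i].

Definition pos_part (l : 'cV[int]_m) : multinom m :=
  Multinom [tuple absz (Num.max (l i 0) 0) | i < m].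

Definition neg_part (l : 'cV[int]_m) : multinom m :=
  Multinom [tuple absz (Num.max (- l i 0) 0) | i < m].

Definition lattice_ideal (L : set 'cV[int]_m) : set (mpoly m F) :=
  ideal_gen [set mpolyX F (pos_part l) - mpolyX F (neg_part l) | l in L].

(* [ishomog1 k mdeg] is mpoly's [k.-homog]. N is the dimension of the degree-k
   part of F[x]/I : there are N forms of degree k whose classes are a basis of
   F[x]_k / I_k. *)
Definition hilbert_function_value (I : set (mpoly m F)) (k N : nat) : Prop :=
  exists s : 'I_N -> mpoly m F,
    (forall i, s i \is ishomog1 k mdeg) /\
    (forall p, p \is ishomog1 k mdeg ->
       exists! c : 'rV[F]_N, I (p - \sum_i c 0 i *: s i)).

Definition is_hilbert_polynomial (I : set (mpoly m F)) (H : {poly rat}) :=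
  exists k0, forall k, (k0 <= k)%N ->
    exists2 N, hilbert_function_value I k N & H.[k%:R] = N%:R.

(* If the Hilbert polynomial has degree D, the degree of F[x]/I is D! times
   its leading coefficient. *)
Definition ideal_degree (I : set (mpoly m F)) : rat :=
  let H := xget 0 [set H | is_hilbert_polynomial I H] in
  (size H).-1`!%:R * lead_coef H.

End DegreeOfIdeals.

Arguments lattice_ideal F {m} L _.

Section Polytopes.
Variable R : realType.

Definition embedR m n (M : 'M[int]_(m, n)) : 'M[R]_(m, n) := map_mx intr M.

Definition conv_hull (V : lmodType R) (S : set V) : set V :=
  smallest (@convex_set R V) S.

Definition linear_span (V : lmodType R) (S : set V) : set V :=
  [set x | exists N (p : 'I_N -> V) (c : 'I_N -> R),
     (forall i, S (p i)) /\ x = \sum_i c i *: p i].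

(* k-dimensional Lebesgue measure, as the iterated product of the measure on
   R; on R^0 it is the Dirac mass at the unique point. It is only meaningful
   on Borel sets, and is only applied to polytopes. *)
Fixpoint lebesgue_cV (k : nat) : set 'cV[R]_k -> \bar R :=
  match k return set 'cV[R]_k -> \bar R with
  | 0 => fun S => (\1_S 0)%:E
  | k'.+1 => fun S =>
      (\int[lebesgue_measure]_(x in [set: R])
         @lebesgue_cV k' [set y | S (col_mx (x%:M : 'cV[R]_1) y)])%E
  end.

(* Volume of Conv(S), a unimodular simplex of Z^k having volume 1. *)
Definition normalized_volume (k : nat) (S : set 'cV[R]_k) : R :=
  k`!%:R * fine (lebesgue_cV (conv_hull S)).

Definition is_face d (P F : set 'cV[R]_d) : Prop :=
  F !=set0 /\
  exists (u : 'rV[R]_d) (c : R),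
    (forall x, P x -> (u *m x) 0 0 <= c) /\
    F = [set x | P x /\ (u *m x) 0 0 = c].

Definition is_proper_face d (P F : set 'cV[R]_d) : Prop :=
  is_face P F /\ F <> P.

Section Configuration.
Variables (d n : nat) (A : 'M[int]_(d, n)).
Implicit Types alpha beta : set 'cV[R]_d.

Definition polytope : set 'cV[R]_d :=
  conv_hull (range (fun i => embedR (col i A))).

Definition outside beta : {set 'I_n} :=
  finset (fun i => embedR (col i A) \notin beta).

Definition Zspan alpha : set 'cV[int]_d :=
  [set x | exists z : 'I_n -> int,
     x = \sum_(i | i \notin outside alpha) z i *: col i A].

Definition face_index alpha beta : nat :=
  group_index [set x | Zspan alpha x /\ linear_span beta (embedR x)]
              (Zspan beta).

(* f identifies the quotient lattice Zspan alpha / (Zspan alpha cap R beta)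
   with Z^k; its values outside Zspan alpha are irrelevant. *)
Definition quotient_coordinates alpha beta k
    (f : 'cV[int]_d -> 'cV[int]_k) : Prop :=
  [/\ forall x y, Zspan alpha x -> Zspan alpha y -> f (x + y) = f x + f y,
      f @` Zspan alpha = setT &
      forall x, Zspan alpha x -> (f x = 0 <-> linear_span beta (embedR x))].

Definition quotient_configuration alpha k (f : 'cV[int]_d -> 'cV[int]_k) :
    set 'cV[R]_k :=
  [set embedR (f (col i A)) | i in [set i | i \notin outside alpha]].

(* The value does not depend on the choice of coordinates f, since two choices
   differ by a unimodular transformation. *)
Definition subdiagram_volume alpha beta : R :=
  xget 0 [set v | exists k (f : 'cV[int]_d -> 'cV[int]_k),
    quotient_coordinates alpha beta f /\
    v = normalized_volume (quotient_configuration alpha f)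
        - normalized_volume (quotient_configuration alpha f `\ 0)].

End Configuration.

Definition relevant_line n (B : 'M[int]_(n, 2)) (l : set 'rV[R]_2) : Prop :=
  (exists2 v : 'rV[R]_2, v != 0 & l = [set t *: v | t in [set: R]]) /\
  exists r s,
    [/\ l (embedR (row r B)), l (embedR (row s B)), row r B != 0 &
        exists2 c : R, c < 0 & embedR (row s B) = c *: embedR (row r B)].

End Polytopes.

Arguments embedR R {m n} M.
Arguments polytope R {d n} A _.

Definition rows_in n (B : 'M[int]_(n, 2)) (I : {set 'I_n}) : 'M[int]_(#|I|, 2) :=
  rowsub enum_val B.

Definition balancing_row n (B : 'M[int]_(n, 2)) (I : {set 'I_n}) : 'rV[int]_2 :=
  - \sum_(i in I) row i B.

Definition balanced_rows n (B : 'M[int]_(n, 2)) (I : {set 'I_n}) :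
    'M[int]_(#|I| + 1, 2) :=
  col_mx (rows_in B I) (balancing_row B I).

(* Main.v *)
Require Import Defs.
From mathcomp Require Import all_boot all_order all_algebra finmap complex.
From mathcomp Require Import zify ring lra.
From mathcomp Require Import all_classical all_reals all_analysis measurable_realfun.
From mathcomp Require Import -(notations) mpoly.
From mathcomp Require polyrcf.

(** Let [I] be the set of points off the face and [C] the matrix of the rows of the
    Gale dual indexed by [I]. The functional defining the face is a relation with
    positive coefficients among the rows of [C]; if these rows were on one line, some
    two of them would point in opposite directions and the line would be relevant.
    So [C] has rank 2 ([outside_rows_injective]), the points of the face are linearly
    independent, and in any coordinates of the quotient lattice, say of rank [k],
    the points off the face become the columns of a matrix [V] that is onto over the integers and whose
    kernel is the saturation of the column lattice of [C]
    ([outside_coordinates_surj], [outside_coordinates_ker]). Everything then depends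
    on [V] and [C] only, and the points of the face contribute the origin.

    The index of the face is that of the column lattice of [C] in its saturation,
    which the Smith normal form identifies with the gcd of the maximal minors
    ([saturation_reps], [gcd_minors], [face_index_minors]).

    Both volumes are computed by counting, without triangulations. The volume of a
    polytope is squeezed between the numbers of grid cells inside it and meeting it
    ([lebesgue_cV_grid]). If [L] is a lattice of relations between the homogenized
    points, of index [tau] in the lattice of all relations, a cell at scale [t]
    corresponds to [tau] classes modulo [L] of monomials of degree [t], up to a
    bounded shift of [t] ([transversal_le_volume], [volume_le_transversal]). Hence
    the number of classes grows like [tau] times the volume times [t ^ k].

    For the points together with the origin, the relations are the columns of [C]
    balanced by the row [w]. The number of classes of monomials is the Hilbert function
    of the lattice ideal ([hilbert_function_transversal]), it is eventually a
    polynomial because the lexicographically least representatives form the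
    complement of a monomial ideal ([lattice_hilbert_polynomial]), and the squeeze
    identifies its leading coefficient: the degree is [tau] times the normalized
    volume ([volume_with_origin]).

    For the points without the origin, if [w = 0] they lie on a hyperplane and both
    the volume and the sum of determinants vanish ([flat_volume]). Otherwise the
    affine relations are the multiples of one vector [ell], whose entries are the
    determinants of [w] and the rows of [C] divided by the gcd [g] of [w]. The
    monomials that do not involve the origin more than [g - 1] times and are not
    divisible by the monomial of the positive part of [ell] represent each class
    once, and their number is a difference of binomials that grows like [g] times the
    sum of the positive entries of [ell], divided by [k`!], times [t ^ k]
    ([normal_forms_transversal], [normal_forms_size], [volume_of_points]). *)

Set Implicit Arguments.
Unset Strict Implicit.
Unset Printing Implicit Defensive.

Import Order.TTheory GRing.Theory Num.Theory.

Local Open Scope classical_set_scope.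
Local Open Scope ring_scope.

(** * Lebesgue measure of unions of grid cells *)

Section LebesgueMeasure.
Variable R : realType.
Implicit Types k : nat.
Local Open Scope ereal_scope.

(** Read off from the integral as a supremum over simple functions, so that it
    applies to the volume of the slices of an arbitrary set. *)
Lemma ge0_integral_mono (f g : R -> \bar R) :
  (forall x, 0 <= f x) -> (forall x, f x <= g x) ->
  \int[lebesgue_measure]_(x in [set: R]) f x <=
  \int[lebesgue_measure]_(x in [set: R]) g x.
Proof.
move=> f0 fg.
have g0 x : 0 <= g x by exact: le_trans (f0 x) (fg x).
rewrite !ge0_integralTE//; apply: le_ereal_sup => _ /= [h hf <-].
by exists h => //= x; exact: le_trans (hf x) (fg x).
Qed.

Lemma lebesgue_cV_ge0 k (S : set 'cV[R]_k) : 0 <= lebesgue_cV S.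
Proof.
elim: k S => [|k IH] S /=; first by rewrite lee_fin.
by apply: integral_ge0 => x _; exact: IH.
Qed.

Lemma lebesgue_cV_mono k (S T : set 'cV[R]_k) :
  S `<=` T -> lebesgue_cV S <= lebesgue_cV T.
Proof.
elim: k S T => [|k IH] S T ST /=.
  rewrite lee_fin !indicE; case: (boolP (0%R \in S)) => [/set_mem/ST/mem_set->//|_].
  by rewrite ler0n.
apply: ge0_integral_mono => x; first exact: lebesgue_cV_ge0.
by apply: IH => y; exact: ST.
Qed.

Lemma lebesgue_cV0 k : lebesgue_cV (set0 : set 'cV[R]_k) = 0.
Proof.
elim: k => [|k IH] /=; first by rewrite indicE in_set0.
by apply: integral0_eq => x _; rewrite -[RHS]IH; congr lebesgue_cV.
Qed.

(** Slicing along the first coordinate: the slices of a hyperplane are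
    hyperplanes, unless its normal is the first axis, when all slices but one
    are empty. *)
Lemma lebesgue_cV_hyperplane k (h : 'rV[R]_k) (c : R) : h != 0%R ->
  lebesgue_cV [set x | (h *m x)%R 0%R 0%R = c] = 0.
Proof.
elim: k h c => [|k IH] h c h0; first by rewrite (thinmx0 h) eqxx in h0.
rewrite /=.
pose a : R := (lsubmx (h : 'rV_(1 + k))) 0%R 0%R.
pose h' : 'rV_k := rsubmx (h : 'rV_(1 + k)).
have hE x (y : 'cV[R]_k) :
    ((h : 'rV_(1 + k)) *m col_mx (x%:M : 'cV[R]_1) y)%R 0%R 0%R =
    (a * x + (h' *m y) 0 0)%R.
  rewrite -[in LHS](hsubmxK (h : 'rV_(1 + k))) mul_row_col mxE; congr (_ + _)%R.
  by rewrite mxE big_ord1 [(x%:M)%R _ _]mxE eqxx mulr1n.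
under eq_integral => x _.
  rewrite (_ : [set y | _] = [set y | (h' *m y)%R 0%R 0%R = (c - a * x)%R]); last first.
    by apply/seteqP; split => y /=; rewrite hE => ?; lra.
  over.
have [h'0|h'N0] := eqVneq h' 0%R; last first.
  by apply: integral0_eq => x _; exact: IH.
have aN0 : a != 0%R.
  apply: contraNneq h0 => a0.
  rewrite -[h](hsubmxK (h : 'rV_(1 + k))) -/h' h'0.
  suff -> : lsubmx (h : 'rV_(1 + k)) = 0%R by rewrite row_mx0.
  by apply/matrixP => i j; rewrite !ord1 [RHS]mxE.
pose M := lebesgue_cV ([set: 'cV[R]_k]).
rewrite -(_ : \int[lebesgue_measure]_(x in [set: R])
   (M * (\1_[set (c / a)%R] x)%:E) = 0) //.
  apply: eq_integral => x _; rewrite indicE.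
  have [->|xca] := eqVneq x (c / a)%R.
    rewrite mem_set// mule1 /M; congr lebesgue_cV; apply/seteqP; split => // y _ /=.
    by rewrite h'0 mul0mx mxE mulrC mulfVK// subrr.
  rewrite memNset ?mule0; last by move/eqP: xca.
  rewrite -[RHS](@lebesgue_cV0 k); congr lebesgue_cV; apply/seteqP; split => // y /=.
  rewrite h'0 mul0mx mxE => /esym cax; move/eqP: xca; apply.
  by rewrite (_ : c = x * a)%R ?mulfK//; lra.
rewrite ge0_integralZl//=.
- by rewrite integral_indic//= setIT lebesgue_measure_set1 mule0.
- exact/measurable_EFinP/measurable_indic.
- exact: lebesgue_cV_ge0.
Qed.

(** The grid has mesh [t^-1]; a cell is named by its lower corner times [t]. *)
Definition grid_cell k (t : R) (x : 'cV[R]_k) : 'cV[int]_k :=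
  map_mx (fun y => Num.floor (t * y)%R) x.

Lemma lebesgue_floor_fiber (t : R) (a : int) : (0 < t)%R ->
  lebesgue_measure [set x : R | Num.floor (t * x)%R = a] = (t^-1)%:E.
Proof.
move=> t0.
rewrite (_ : [set x | _] = `[(a%:~R / t)%R, ((a + 1)%:~R / t)%R[%classic).
  rewrite lebesgue_measure_itv /= lte_fin ltr_pM2r ?invr_gt0// ltr_int ltrDl ltr01.
  by rewrite -EFinD -mulrBl -intrB addrAC subrr add0r mul1r.
apply/seteqP; split => x /=; rewrite in_itv/= ler_pdivrMr// ltr_pdivlMr// [(x * t)%R]mulrC.
  by move=> <-; exact: floor_itv.
by move=> /floor_def.
Qed.

Lemma measurable_floor_fiber (t : R) (a : int) : (0 < t)%R ->
  measurable [set x : R | Num.floor (t * x)%R = a].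
Proof.
move=> t0.
rewrite (_ : [set x | _] = `[(a%:~R / t)%R, ((a + 1)%:~R / t)%R[%classic) //.
apply/seteqP; split => x /=; rewrite in_itv/= ler_pdivrMr// ltr_pdivlMr// [(x * t)%R]mulrC.
  by move=> <-; exact: floor_itv.
by move=> /floor_def.
Qed.

(** The slices of a union of cells are again unions of cells, and depend only on
    the cell of the first coordinate: the iterated integrand is a finite sum of
    indicator functions of intervals of length [t^-1]. *)
Lemma lebesgue_cV_grid k (t : R) (s : seq 'cV[int]_k) : (0 < t)%R -> uniq s ->
  lebesgue_cV [set x | grid_cell t x \in s] = ((size s)%:R / t ^+ k)%:E.
Proof.
move=> t0; elim: k s => [|k IH] s us.
  rewrite /= expr0 divr1 indicE; congr (_%:E).
  have s0 (x : 'cV[int]_0) : x \in s -> s = [:: x].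
    case: s us => [//|y [|z s]] /=; first by rewrite (flatmx0 x) (flatmx0 y).
    by rewrite !inE (flatmx0 y) (flatmx0 z) eqxx.
  case: (boolP (grid_cell t 0%R \in s)) => [H|H].
    by rewrite mem_set//= (s0 _ H).
  rewrite memNset/=; last by apply/negP.
  case: s us H s0 => [//|y s] us H _.
  by rewrite inE (flatmx0 y) (flatmx0 (grid_cell _ _)) eqxx in H.
rewrite /=.
pose hd (x : 'cV[int]_k.+1) : int := (usubmx (x : 'cV_(1 + k))) 0%R 0%R.
pose tl (x : 'cV[int]_k.+1) : 'cV[int]_k := dsubmx (x : 'cV_(1 + k)).
have hdtl x y : hd x = hd y -> tl x = tl y -> x = y.
  move=> xy1 xy2.
  rewrite -[x](vsubmxK (x : 'cV_(1 + k))) -[y](vsubmxK (y : 'cV_(1 + k))).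
  have e1 : usubmx (x : 'cV_(1 + k)) = usubmx (y : 'cV_(1 + k)).
    by apply/matrixP => i j; rewrite !ord1; exact: xy1.
  by rewrite e1 [dsubmx (x : 'cV_(1 + k))]xy2.
pose cells (a : int) := [seq tl x | x <- s & hd x == a].
have ucells a : uniq (cells a).
  rewrite map_inj_in_uniq ?filter_uniq// => x y.
  by rewrite !mem_filter => /andP[/eqP + _] /andP[/eqP + _] => <- /esym; exact: hdtl.
under eq_integral => x _.
  rewrite (_ : [set y | _] = [set y | grid_cell t y \in cells (Num.floor (t * x)%R)]); last first.
    apply/seteqP; split => y /=.
      move=> xys; apply/mapP; exists (grid_cell t (col_mx (x%:M : 'cV[R]_1) y)).
        by rewrite mem_filter xys andbT /hd mxE mxE col_mxEu [(x%:M)%R _ _]mxE eqxx.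
      by apply/matrixP => i j; rewrite /tl [LHS]mxE [RHS]mxE [RHS]mxE col_mxEd.
    move=> /mapP[z]; rewrite mem_filter => /andP[/eqP hz zs] yz.
    suff -> : grid_cell t (col_mx (x%:M : 'cV[R]_1) y) = z by [].
    apply: hdtl; first by rewrite hz /hd mxE mxE col_mxEu [(x%:M)%R _ _]mxE eqxx.
    by rewrite -yz; apply/matrixP => i j; rewrite /tl [LHS]mxE [LHS]mxE col_mxEd [RHS]mxE.
  rewrite IH//; last first.
  rewrite (_ : (_ / _)%R%:E = \sum_(z <- s)
     ((t ^- k)%:E * (\1_[set x | Num.floor (t * x)%R = hd z] x)%:E)); last first.
    rewrite size_map size_filter -sum1_count natr_sum mulr_suml -sumEFin big_mkcond /=.
    apply: eq_bigr => z _; rewrite indicE.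
    have [zx|zx] := eqVneq (hd z).
      by rewrite mem_set//= mul1r mule1.
    by rewrite memNset ?mule0//= => xz; rewrite xz eqxx in zx.
  over.
rewrite ge0_integral_sum//; last 2 first.
- move=> z; apply: measurable_funeM.
  apply/measurable_EFinP; apply: measurable_indic; exact: measurable_floor_fiber.
- by move=> z x _; rewrite mule_ge0// lee_fin// invr_ge0 exprn_ge0// ltW.
rewrite (_ : (size s)%:R = \sum_(z <- s) 1)%R; last first.
  by rewrite -sum1_size natr_sum.
rewrite mulr_suml -sumEFin; apply: eq_bigr => z _.
rewrite ge0_integralZl//=; last 2 first.
- apply/measurable_EFinP; apply: measurable_indic; exact: measurable_floor_fiber.
- by rewrite lee_fin// invr_ge0 exprn_ge0// ltW.
rewrite integral_indic//=; last exact: measurable_floor_fiber.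
by rewrite setIT lebesgue_floor_fiber// -EFinM mul1r exprS invfM mulrC.
Qed.

End LebesgueMeasure.

(** * Convex hulls of finite families *)

Section ConvexHull.
Variables (R : realType) (V : lmodType R).

Lemma convex_combination (C : set V) (I : eqType) (s : seq I) (p : I -> V) (lam : I -> R) :
  @convex_set R V C -> (forall i, i \in s -> C (p i)) -> (forall i, 0 <= lam i) ->
  \sum_(i <- s) lam i = 1 -> C (\sum_(i <- s) lam i *: p i).
Proof.
move=> cC; elim: s lam => [|i s IH] lam Cp l0.
  by rewrite big_nil => /esym/eqP; rewrite oner_eq0.
rewrite !big_cons => l1.
have s0 : 0 <= \sum_(j <- s) lam j by apply: sumr_ge0.
have Ci : C (p i) by apply: Cp; rewrite mem_head.
have [li1|li1] := eqVneq (lam i) 1.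
  have z : \sum_(j <- s) lam j = 0 by move: l1; rewrite li1; lra.
  rewrite li1 scale1r (_ : \sum_(j <- s) _ = 0) ?addr0//.
  rewrite big_seq big1// => j js.
  move/eqP: z; rewrite psumr_eq0// => /allP/(_ j js)/eqP ->.
  by rewrite scale0r.
have li_lt1 : 0 < 1 - lam i.
  by rewrite subr_gt0 lt_neqAle li1 -l1 lerDl.
pose mu j := lam j / (1 - lam i).
have mu0 j : 0 <= mu j by rewrite divr_ge0// ltW.
have mu1 : \sum_(j <- s) mu j = 1.
  rewrite -mulr_suml (_ : \sum_(j <- s) lam j = 1 - lam i) ?divff ?gt_eqF//; lra.
have Cs : C (\sum_(j <- s) mu j *: p j).
  by apply: IH => // j js; apply: Cp; rewrite inE js orbT.
have lam01 : 0 <= lam i <= 1 by rewrite l0/= -subr_ge0 ltW.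
have [h0 h1] := andP lam01.
pose l : {i01 R} := Itv01 h0 h1.
have := cC (p i) (\sum_(j <- s) mu j *: p j) l (mem_set Ci) (mem_set Cs).
rewrite inE /conv /=; congr C; congr (_ + _).
rewrite scaler_sumr; apply: eq_bigr => j _; rewrite scalerA /mu; congr (_ *: _).
by rewrite -[X in X * _]/(1 - lam i) mulrC mulfVK ?gt_eqF.
Qed.

Lemma conv_hullP m (p : 'I_m -> V) (E : pred 'I_m) (x : V) :
  conv_hull [set p i | i in [set i | E i]] x <->
  exists lam : 'I_m -> R, [/\ forall i, 0 <= lam i, forall i, ~~ E i -> lam i = 0,
     \sum_i lam i = 1 & x = \sum_i lam i *: p i].
Proof.
pose K : set V := [set x | exists lam : 'I_m -> R, [/\ forall i, 0 <= lam i,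
  forall i, ~~ E i -> lam i = 0, \sum_i lam i = 1 & x = \sum_i lam i *: p i]].
split.
  move=> xP; apply: (xP K); split; last first.
    move=> _ [i /= Ei <-]; exists (fun j => (j == i)%:R); split.
    - by move=> j; rewrite ler0n.
    - by move=> j; case: eqVneq => // ->; rewrite Ei.
    - by rewrite (bigD1 i)//= eqxx big1 ?addr0// => j /negbTE ->.
    - rewrite (bigD1 i)//= eqxx big1 ?addr0 ?scale1r// => j /negbTE ->.
      by rewrite scale0r.
  move=> y z l /set_mem[a [a0 aE a1 ->]] /set_mem[b [b0 bE b1 ->]].
  have l0 : 0 <= l%:num by [].
  have l1 : l%:num <= 1 by [].
  apply/mem_set; exists (fun i => l%:num * a i + (1 - l%:num) * b i); split.
  - by move=> i; rewrite addr_ge0// mulr_ge0// subr_ge0.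
  - by move=> i Ei; rewrite aE// bE// !mulr0 addr0.
  - by rewrite big_split/= -!mulr_sumr a1 b1; lra.
  - rewrite /conv/= !scaler_sumr -big_split/=; apply: eq_bigr => i _.
    by rewrite !scalerA scalerDl.
move=> [lam [l0 lE l1 ->]] C [cC EC].
have sE : forall (T : zmodType) (F : 'I_m -> T), (forall i, ~~ E i -> F i = 0) ->
    \sum_i F i = \sum_(i <- enum E) F i.
  move=> T F F0; rewrite [RHS]big_filter [RHS]big_mkcond/= -[LHS]big_enum/=.
  by rewrite enumT; apply: eq_bigr => i _; case: ifP => // /negbT/F0.
rewrite sE; last by move=> i /lE ->; rewrite scale0r.
apply: convex_combination => //; last by rewrite -sE.
by move=> i; rewrite mem_enum => Ei; apply: EC; exists i.
Qed.

End ConvexHull.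

(** * Volume of a lattice polytope by counting classes of monomials *)

Section NormBound.
Variable R : realType.

Definition entry_norm a b (G : 'M[R]_(a, b)) : R := \sum_i \sum_j `|G i j|.

Lemma entry_norm_ge0 a b (G : 'M[R]_(a, b)) : 0 <= entry_norm G.
Proof. by apply: sumr_ge0 => i _; apply: sumr_ge0. Qed.

Lemma mulmx_bound a b (G : 'M[R]_(a, b)) (z : 'cV_b) (M : R) :
  (forall j, `|z j 0| <= M) -> 0 <= M -> forall i, `|(G *m z) i 0| <= entry_norm G * M.
Proof.
move=> zM M0 i; rewrite mxE (le_trans (ler_norm_sum _ _ _))//.
rewrite /entry_norm (bigD1 i)//= mulrDl -[leLHS]addr0; apply: lerD.
  rewrite mulr_suml; apply: ler_sum => j _; rewrite normrM.
  by rewrite ler_wpM2l.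
by apply: mulr_ge0 => //; apply: sumr_ge0 => j _; apply: sumr_ge0.
Qed.

End NormBound.

(** The columns of [V] are the points of the configuration, [E] selects those
    spanning the polytope, and [L] is a lattice of relations of finite index [tau]
    in all of them, with coset representatives [rho]. The columns of [BE] lie
    in [L] and span the real relations supported on [E], and [Gam] writes every
    vector as a combination of the homogenized points of [E]. *)
Section Counting.
Variables (R : realType) (m k q tau g : nat).
Variables (V : 'M[int]_(k, m)) (L : set 'cV[int]_m) (E : pred 'I_m).
Variables (lift : 'cV[int]_(1 + k) -> 'cV[int]_m).
Variables (rho : 'I_tau -> 'cV[int]_m) (cls : 'cV[int]_m -> 'I_tau).
Variables (BE : 'M[int]_(m, q)) (Gam : 'M[R]_(m, 1 + k)).

Definition homogenized : 'M[int]_(1 + k, m) := col_mx (const_mx 1) V.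
Notation Phi := homogenized.

Hypothesis LB : forall x y, L x -> L y -> L (x - y).
Hypothesis L_ker : forall x, L x -> Phi *m x = 0.
Hypothesis liftK : forall y, Phi *m lift y = y.
Hypothesis rho_ker : forall j, Phi *m rho j = 0.
Hypothesis rho_inj : forall i j, L (rho i - rho j) -> i = j.
Hypothesis clsP : forall x, Phi *m x = 0 -> L (x - rho (cls x)).
Hypothesis BE_L : forall z, L (BE *m z).
Hypothesis BE_supp : forall i j, ~~ E i -> BE i j = 0.
Hypothesis BE_ker : forall x : 'cV[R]_m, embedR R Phi *m x = 0 ->
  (forall i, ~~ E i -> x i 0 = 0) -> exists s, x = embedR R BE *m s.
Hypothesis box : forall x, exists2 l, L l &
  forall i, ~~ E i -> 0 <= (x - l) i 0 < g%:Z.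
Hypothesis Gam_inv : embedR R Phi *m Gam = 1%:M.
Hypothesis Gam_supp : forall i j, ~~ E i -> Gam i j = 0.

Let P : set 'cV[R]_k := conv_hull [set embedR R (col i V) | i in [set i | E i]].

(** For full [E] these are the exponents of the monomials of degree [t]. The
    bounded exponents off [E] make up for the index of the lattice spanned by the
    homogenized points of [E], so that every class is represented. *)
Definition bounded_monomials (t : nat) (u : 'cV[int]_m) : Prop :=
  [/\ forall i, 0 <= u i 0, forall i, ~~ E i -> u i 0 < g%:Z & \sum_i u i 0 = t%:Z].

Notation U := bounded_monomials.

Lemma hull_coords x : P x <-> exists lam : 'cV[R]_m,
  [/\ forall i, 0 <= lam i 0, forall i, ~~ E i -> lam i 0 = 0 &
      embedR R Phi *m lam = col_mx 1%:M x].
Proof.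
have combE (lam : 'cV[R]_m) : embedR R Phi *m lam =
    col_mx (\sum_i lam i 0)%:M (\sum_i lam i 0 *: embedR R (col i V)).
  rewrite /embedR map_col_mx mul_col_mx; congr col_mx.
    apply/matrixP => i j; rewrite !ord1 !mxE eqxx mulr1n.
    by apply: eq_bigr => l _; rewrite !mxE mul1r.
  apply/matrixP => i j; rewrite ord1 !mxE summxE.
  by apply: eq_bigr => l _; rewrite !mxE mulrC.
split.
  move=> /conv_hullP[lam [l0 lE l1 ->]]; exists (\col_i lam i); split.
  - by move=> i; rewrite mxE.
  - by move=> i /lE; rewrite mxE.
  - rewrite combE; congr col_mx.
      by under eq_bigr do rewrite mxE; rewrite l1.
    by apply: eq_bigr => i _; rewrite mxE.
move=> [lam [l0 lE]]; rewrite combE => /eq_col_mx[/matrixP/(_ 0 0)].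
rewrite !mxE eqxx !mulr1n => l1 <-.
by apply/conv_hullP; exists (fun i => lam i 0); split.
Qed.

Lemma sublattice0 : L 0. Proof. by rewrite -(mulmx0 _ BE); apply: BE_L. Qed.
Lemma sublatticeN x : L x -> L (- x).
Proof. by move=> Lx; rewrite -sub0r; apply: LB => //; exact: sublattice0. Qed.
Lemma sublatticeD x y : L x -> L y -> L (x + y).
Proof. by move=> Lx /sublatticeN Ly; rewrite -[y]opprK; apply: LB. Qed.

Definition shift_vec (c : nat) : 'cV[int]_m := \col_i (if E i then c%:Z else 0).
Definition shift_deg (c : nat) : nat := (#|E| * c)%N.

Lemma sum_shift c : \sum_i shift_vec c i 0 = (shift_deg c)%:Z.
Proof.
under eq_bigr do rewrite mxE.
by rewrite -big_mkcond/= sumr_const /shift_deg PoszM -mulr_natl natz.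
Qed.

Lemma ones_mulmx (u : 'cV[int]_m) : (const_mx 1 : 'rV_m) *m u = (\sum_i u i 0)%:M.
Proof.
apply/matrixP => i j; rewrite !ord1 !mxE eqxx mulr1n.
by apply: eq_bigr => l _; rewrite mxE mul1r.
Qed.

Lemma homogenized_mulmx (u : 'cV[int]_m) : Phi *m u = col_mx (\sum_i u i 0)%:M (V *m u).
Proof. by rewrite mul_col_mx ones_mulmx. Qed.

Let off (x : 'cV[R]_m) : 'cV[R]_m := \col_i (if E i then 0 else x i 0).

Lemma embedRM a b c (X : 'M[int]_(a, b)) (Y : 'M[int]_(b, c)) :
  embedR R (X *m Y) = embedR R X *m embedR R Y.
Proof. exact: map_mxM. Qed.

(** A lift [X] of the cell of [x], once reduced off [E] by [box], differs from the
    barycentric coordinates of [t x] by a bounded vector plus a real relation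
    supported on [E]. Rounding that relation to the lattice keeps the error bounded,
    and a constant shift makes all entries nonnegative. *)
Lemma class_reaches_bounded : exists c : nat, forall (t : nat) (x : 'cV[R]_k) X,
  P x -> Phi *m X = col_mx t%:Z%:M (grid_cell t%:R x) ->
  exists2 u, U (t + shift_deg c) u & L (X + shift_vec c - u).
Proof.
pose NP := entry_norm (embedR R Phi).
pose NG := entry_norm Gam.
pose NB := entry_norm (embedR R BE).
have NP0 : 0 <= NP := entry_norm_ge0 _.
have NG0 : 0 <= NG := entry_norm_ge0 _.
have NB0 : 0 <= NB := entry_norm_ge0 _.
pose M : R := 1 + NP * g%:R.
have M0 : 0 <= M by rewrite addr_ge0// mulr_ge0.
(* NG * M bounds the correction bet, and NB the rounding error of the relation. *)
exists (Num.bound (NG * M + NB)) => t x X Px PhiX.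
set c := Num.bound _.
have cP : NG * M + NB <= c%:R.
  by apply/ltW/archi_boundP; rewrite addr_ge0// mulr_ge0.
have [l Ll bl] := box X.
set X' := X - l.
have PhiX' : Phi *m X' = col_mx t%:Z%:M (grid_cell t%:R x).
  by rewrite mulmxBr (L_ker Ll) subr0.
rewrite -/X' in bl; have XE : X = X' + l by rewrite subrK.
clearbody X'.
have [lam [lam0 lamE lam1]] := (hull_coords x).1 Px.
pose eta := embedR R X' - t%:R *: lam.
have Phieta i : `|(embedR R Phi *m eta) i 0| <= 1.
  rewrite mulmxBr -embedRM PhiX' -scalemxAr lam1 /embedR map_col_mx.
  rewrite scale_col_mx opp_col_mx add_col_mx.
  case: (splitP i) => j ij.
    have -> : i = lshift k j by apply: val_inj.
    by rewrite col_mxEu !mxE !ord1 eqxx !mulr1n mulr1 -pmulrn subrr normr0 ler01.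
  have -> : i = rshift 1 j by apply: val_inj.
  rewrite col_mxEd !mxE.
  have /andP[h1 h2] := floor_itv (t%:R * x j 0).
  by rewrite distrC ger0_norm; move: h1 h2; rewrite intrD; lra.
have offeta i : `|off eta i 0| <= g%:R.
  rewrite !mxE; case: ifPn => Ei; first by rewrite normr0.
  rewrite lamE// mulr0 subr0 ger0_norm ?ler0z; last by case/andP: (bl _ Ei).
  by have /andP[_ /ltW] := bl _ Ei; rewrite -(ler_int R).
pose z := embedR R Phi *m (eta - off eta).
have zM i : `|z i 0| <= M.
  rewrite /z mulmxBr mxE (le_trans (ler_normD _ _))// lerD// mxE normrN.
  exact: mulmx_bound.
pose bet := Gam *m z.
have betM i : `|bet i 0| <= NG * M by apply: mulmx_bound.
have betE i : ~~ E i -> bet i 0 = 0.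
  by move=> Ei; rewrite mxE big1// => j _; rewrite Gam_supp// mul0r.
have Pbet : embedR R Phi *m bet = z by rewrite mulmxA Gam_inv mul1mx.
clearbody bet.
have [|i Ei|s sE] := BE_ker (x := eta - off eta - bet).
- by rewrite mulmxBr Pbet subrr.
- by rewrite !mxE betE//= (negPf Ei) subrr subr0.
pose fs : 'cV[int]_q := map_mx Num.floor s.
pose u := X' - BE *m fs + shift_vec c.
exists u; last first.
  rewrite /u XE (_ : _ - _ = l + BE *m fs); first exact: sublatticeD.
  by apply/matrixP => i j; rewrite !mxE; ring.
have uE i : E i -> (u i 0)%:~R = t%:R * lam i 0 + bet i 0 +
     (embedR R BE *m (s - embedR R fs)) i 0 + c%:R.
  move=> Ei.
  have sEi : (embedR R BE *m s) i 0 = (X' i 0)%:~R - t%:R * lam i 0 - bet i 0.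
    by rewrite -sE /eta !mxE Ei; ring.
  have uEi : u i 0 = X' i 0 - (BE *m fs) i 0 + c%:Z by rewrite !mxE Ei.
  have fE : (embedR R BE *m (s - embedR R fs)) i 0 =
      (embedR R BE *m s) i 0 - ((BE *m fs) i 0)%:~R.
    by rewrite mulmxBr -embedRM !mxE.
  by rewrite uEi fE sEi intrD intrB -pmulrn; ring.
split.
- move=> i; case: (boolP (E i)) => Ei.
    rewrite -(ler_int R) uE//.
    have h1 : 0 <= t%:R * lam i 0 by rewrite mulr_ge0.
    have h2 : `|(embedR R BE *m (s - embedR R fs)) i 0| <= NB * 1.
      apply: mulmx_bound => // j; rewrite !mxE.
      have /andP[h1' h2'] := floor_itv (s j 0).
      by rewrite ger0_norm; move: h1' h2'; rewrite intrD; lra.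
    have := betM i; rewrite !ler_norml in h2 *; lra.
  rewrite !mxE (negPf Ei) addr0 big1 ?subr0; last by move=> j _; rewrite BE_supp// mul0r.
  by have /andP[] := bl _ Ei.
- move=> i Ei; rewrite !mxE (negPf Ei) addr0 big1 ?subr0; last by move=> j _; rewrite BE_supp// mul0r.
  by have /andP[] := bl _ Ei.
- have : Phi *m u = Phi *m X' + Phi *m shift_vec c.
    by rewrite mulmxDr mulmxBr (L_ker (BE_L _)) subr0.
  rewrite PhiX' !homogenized_mulmx add_col_mx => /eq_col_mx[/matrixP/(_ 0 0) + _].
  by rewrite !mxE eqxx !mulr1n sum_shift => ->.
Qed.

(** The shift moves the point deep enough into the cone over the polytope for its
    whole cell, corrected by the entries off [E], to remain inside. *)
Lemma bounded_cell_inside : exists c : nat, forall (t : nat) (x : 'cV[R]_k) u,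
  (0 < t)%N -> U t u ->
  grid_cell (t + shift_deg c)%:R x = V *m (u + shift_vec c) -> P x.
Proof.
pose NP := entry_norm (embedR R Phi).
pose NG := entry_norm Gam.
have NP0 : 0 <= NP := entry_norm_ge0 _.
have NG0 : 0 <= NG := entry_norm_ge0 _.
pose M : R := NP * g%:R + 1.
have M0 : 0 <= M by rewrite addr_ge0// mulr_ge0.
exists (Num.bound (NG * M)) => t x u t0 [u0 ug ut] xu.
set c := Num.bound _ in xu *.
have cP : NG * M <= c%:R by apply/ltW/archi_boundP; rewrite mulr_ge0.
set T := (t + shift_deg c)%N in xu *.
have T0 : 0 < T%:R :> R by rewrite ltr0n addn_gt0 t0.
pose y : 'cV[R]_k := T%:R *: x - embedR R (V *m (u + shift_vec c)).
have y1 i : `|y i 0| <= 1.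
  rewrite /y -xu !mxE.
  have /andP[h1 h2] := floor_itv (T%:R * x i 0).
  by rewrite ger0_norm; move: h1 h2; rewrite intrD; lra.
pose z := embedR R Phi *m off (embedR R u) + col_mx 0 y.
have zM i : `|z i 0| <= M.
  rewrite mxE (le_trans (ler_normD _ _))// lerD//.
    apply: mulmx_bound => // j; rewrite !mxE; case: ifPn => Ej; first by rewrite normr0.
    by rewrite ger0_norm ?ler0z// -[leRHS]/(g%:Z%:~R) ler_int ltW// ug.
  case: (splitP i) => j ij.
    have -> : i = lshift k j by apply: val_inj.
    by rewrite col_mxEu mxE normr0.
  have -> : i = rshift 1 j by apply: val_inj.
  by rewrite col_mxEd.
pose bet := Gam *m z.
have betM i : `|bet i 0| <= NG * M by apply: mulmx_bound.
have betE i : ~~ E i -> bet i 0 = 0.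
  by move=> Ei; rewrite mxE big1// => j _; rewrite Gam_supp// mul0r.
have Pbet : embedR R Phi *m bet = z by rewrite mulmxA Gam_inv mul1mx.
clearbody bet.
pose v := embedR R u - off (embedR R u) + embedR R (shift_vec c) + bet.
apply/hull_coords; exists (T%:R^-1 *: v); split.
- move=> i; rewrite mxE; apply: mulr_ge0; first by rewrite invr_ge0 ltW.
  rewrite /v !mxE; case: ifPn => Ei; last by rewrite subrr add0r betE// addr0.
  have := betM i; have : 0 <= (u i 0)%:~R :> R by rewrite ler0z.
  rewrite ler_norml -pmulrn; lra.
- by move=> i Ei; rewrite !mxE betE// (negPf Ei) subrr !addr0 mulr0.
- rewrite -scalemxAr /v !mulmxDr mulmxN Pbet /z.
  rewrite [X in _ *: X](_ : _ = embedR R (Phi *m (u + shift_vec c)) + col_mx 0 y); last first.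
    by rewrite mulmxDr [in RHS]/embedR raddfD /= -!/(embedR R _) !embedRM
               [X in X + _]addrAC addrA subrK.
  rewrite homogenized_mulmx.
  rewrite /embedR map_col_mx add_col_mx addr0 scale_col_mx; congr col_mx.
    apply/matrixP => i j; rewrite !ord1 !mxE eqxx !mulr1n.
    under eq_bigr do rewrite mxE.
    by rewrite big_split/= ut sum_shift -PoszD -/T -pmulrn mulVf// gt_eqF.
  by rewrite /y /embedR addrC subrK scalerA mulVf ?gt_eqF// scale1r.
Qed.

Definition transversal (X : set 'cV[int]_m) (s : seq 'cV[int]_m) : Prop :=
  [/\ uniq s, forall u, u \in s -> X u,
      forall u v, u \in s -> v \in s -> L (u - v) -> u = v &
      forall u, X u -> exists2 v, v \in s & L (u - v)].

(** Representatives in one cell differ by torsion, so at most [tau] of them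
    share a cell, and these cells lie inside the polytope. *)
Lemma transversal_le_volume : exists c : nat, forall t s, (0 < t)%N ->
  transversal (U t) s ->
  (((size s)%:R / (tau%:R * (t + c)%:R ^+ k))%:E <= lebesgue_cV P)%E.
Proof.
have [c cP] := bounded_cell_inside.
exists (shift_deg c) => t s t0 [us sU sinj _].
set T := (t + shift_deg c)%N.
have T0 : 0 < T%:R :> R by rewrite ltr0n addn_gt0 t0.
pose cell u := V *m (u + shift_vec c).
pose X := undup [seq cell u | u <- s].
pose base a := lift (col_mx T%:Z%:M a).
pose F u := (cell u, cls (u + shift_vec c - base (cell u))).
have tau0 : (0 < tau)%N by case: (tau) (cls 0) => // -[].
have sub : (size s <= tau * size X)%N.
  rewrite mulnC -[tau in X in (_ <= X)%N]card_ord cardT -(size_allpairs pair).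
  rewrite -(size_map F); apply: uniq_leq_size.
    rewrite map_inj_in_uniq// => u v us' vs' [uv1 uv2]; apply: sinj => //.
    have kerF w : w \in s -> Phi *m (w + shift_vec c - base (cell w)) = 0.
      move=> ws; rewrite mulmxBr liftK homogenized_mulmx.
      suff -> : \sum_i (w + shift_vec c) i 0 = T%:Z by rewrite subrr.
      under eq_bigr do rewrite mxE.
      by rewrite big_split/= sum_shift; have [_ _ ->] := sU _ ws.
    have := LB (clsP (kerF _ us')) (clsP (kerF _ vs')).
    rewrite uv2 uv1; congr L; apply/matrixP => i j; rewrite !mxE; ring.
  move=> _ /mapP[u us' ->]; apply/allpairsP; exists (F u); split => //=.
    by rewrite mem_undup map_f.
  by rewrite mem_enum.
have XP : [set x | grid_cell T%:R x \in X] `<=` P.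
  move=> x /=; rewrite mem_undup => /mapP[u us' xu].
  exact: (cP t x u t0 (sU _ us') xu).
apply: le_trans (lebesgue_cV_mono XP).
rewrite lebesgue_cV_grid ?undup_uniq// lee_fin ler_pdivrMr ?mulr_gt0 ?exprn_gt0 ?ltr0n//.
rewrite mulrCA divfK ?gt_eqF ?exprn_gt0//.
- by rewrite -natrM ler_nat.
- by rewrite addn_gt0 t0.
Qed.

(** Each cell meeting the polytope has [tau] lifts modulo [L], one for every
    torsion class, and all of them are reached by bounded monomials. *)
Lemma volume_le_transversal : exists c : nat, forall t s, (0 < t)%N ->
  transversal (U (t + c)) s ->
  (lebesgue_cV P <= ((size s)%:R / (tau%:R * t%:R ^+ k))%:E)%E.
Proof.
have [c cP] := class_reaches_bounded.
exists (shift_deg c) => t s t0 [us sU sinj scomp].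
have T0 : 0 < t%:R :> R by rewrite ltr0n.
pose X := [seq a <- undup [seq V *m u - V *m shift_vec c | u <- s] |
   `[< exists2 x, P x & grid_cell t%:R x = a >]].
have uX : uniq X by rewrite filter_uniq// undup_uniq.
pose base a := lift (col_mx t%:Z%:M a).
have tau0 : (0 < tau)%N by case: (tau) (cls 0) => // -[].
have reach a j : (exists2 x, P x & grid_cell t%:R x = a) ->
    exists2 v, v \in s & L (base a + rho j + shift_vec c - v).
  move=> [x Px xa].
  have [|u Uu Lu] := cP t x (base a + rho j) Px.
    by rewrite mulmxDr liftK rho_ker addr0 xa.
  have [v vs Lv] := scomp _ Uu; exists v => //.
  by have := sublatticeD Lu Lv; congr L; apply/matrixP => i i'; rewrite !mxE; ring.
have V_L l : L l -> V *m l = 0.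
  by move=> /L_ker; rewrite homogenized_mulmx -col_mx0 => /eq_col_mx[].
have XP : P `<=` [set x | grid_cell t%:R x \in X].
  move=> x Px /=; rewrite mem_filter; apply/andP; split; first by apply/asboolP; exists x.
  rewrite mem_undup.
  have [|v vs Lv] := reach (grid_cell t%:R x) (cls 0); first by exists x.
  apply/mapP; exists v => //.
  have := V_L _ Lv; rewrite mulmxBr !mulmxDr.
  have := rho_ker (cls 0); rewrite homogenized_mulmx -col_mx0 => /eq_col_mx[_ ->].
  have := liftK (col_mx t%:Z%:M (grid_cell t%:R x)); rewrite homogenized_mulmx => /eq_col_mx[_ ->].
  by rewrite addr0 => /eqP; rewrite subr_eq0 => /eqP <-; rewrite addrK.
apply: le_trans (lebesgue_cV_mono XP) _.
rewrite lebesgue_cV_grid// lee_fin ler_pdivrMr ?exprn_gt0//.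
rewrite invfM mulrA divfK ?gt_eqF ?exprn_gt0//.
rewrite ler_pdivlMr ?ltr0n// -natrM ler_nat.
pose F (aj : 'cV[int]_k * 'I_tau) : 'cV[int]_m :=
  xget 0 [set v | v \in s /\ L (base aj.1 + rho aj.2 + shift_vec c - v)].
have FP aj : aj.1 \in X -> F aj \in s /\ L (base aj.1 + rho aj.2 + shift_vec c - F aj).
  rewrite mem_filter => /andP[/asboolP aX _].
  have [v vs Lv] := reach _ aj.2 aX.
  exact: (@xgetPex _ 0 [set v | v \in s /\ L (base aj.1 + rho aj.2 + shift_vec c - v)]
    (ex_intro _ v (conj vs Lv))).
rewrite -[tau]card_ord cardT -(size_allpairs pair) -(size_map F); apply: uniq_leq_size; last first.
  by move=> _ /mapP[_ /allpairsP[[a j] [/= aX _ ->] ->]]; case: (FP (a, j) aX).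
rewrite map_inj_in_uniq; first by rewrite allpairs_uniq ?enum_uniq// => -[? ?] [? ?].
move=> _ _ /allpairsP[[a j] [/= aX _ ->]] /allpairsP[[b i] [/= bX _ ->]] Fab.
have [_ L1] := FP (a, j) aX; have [_ L2] := FP (b, i) bX.
rewrite Fab in L1; have /= L3 := LB L1 L2.
have L4 : L ((base a - base b) + (rho j - rho i)).
  by move: L3; congr L; apply/matrixP => i1 i2; rewrite !mxE; ring.
have ab : a = b.
  have := L_ker L4; rewrite mulmxDr !mulmxBr !liftK !rho_ker subrr addr0.
  by move=> /eqP; rewrite subr_eq0 => /eqP/eq_col_mx[].
rewrite ab in L4 *; congr (_, _); apply: rho_inj.
by rewrite subrr add0r in L4.
Qed.

End Counting.

(** * The Hilbert function of a lattice ideal *)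

Section IdealMembership.
Variables (F : fieldType) (m : nat).
Implicit Types (G : set (mpoly m F)) (p q : mpoly m F).

Lemma ideal_gen_incl G p : G p -> ideal_gen G p.
Proof. by move=> Gp; exists 1%N, (fun=> 1), (fun=> p); rewrite big_ord1 mul1r. Qed.

Lemma ideal_gen0 G : ideal_gen G 0.
Proof.
by exists 0%N, (fun=> 0), (fun=> 0); rewrite big_ord0; split => // -[].
Qed.

Lemma ideal_genD G p q : ideal_gen G p -> ideal_gen G q -> ideal_gen G (p + q).
Proof.
move=> [n1 [g1 [h1 [Gh1 ->]]]] [n2 [g2 [h2 [Gh2 ->]]]].
exists (n1 + n2)%N.
exists (fun i : 'I_(n1 + n2) => match fintype.split i with inl j => g1 j | inr j => g2 j end).
exists (fun i : 'I_(n1 + n2) => match fintype.split i with inl j => h1 j | inr j => h2 j end).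
split; first by move=> i; case: (fintype.split i).
rewrite big_split_ord/=; congr (_ + _); apply: eq_bigr => i _.
  by rewrite -[lshift _ _]/(unsplit (inl i)) unsplitK.
by rewrite -[rshift _ _]/(unsplit (inr i)) unsplitK.
Qed.

Lemma ideal_genM G q p : ideal_gen G p -> ideal_gen G (q * p).
Proof.
move=> [n [g [h [Gh ->]]]]; exists n, (fun i => q * g i), h; split => //.
by rewrite mulr_sumr; apply: eq_bigr => i _; rewrite mulrA.
Qed.

Lemma ideal_genZ G (c : F) p : ideal_gen G p -> ideal_gen G (c *: p).
Proof. by rewrite -mul_mpolyC; exact: ideal_genM. Qed.

Lemma ideal_gen_sum G (I : Type) (s : seq I) (P : pred I) (f : I -> mpoly m F) :
  (forall i, P i -> ideal_gen G (f i)) -> ideal_gen G (\sum_(i <- s | P i) f i).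
Proof.
move=> Gf; elim/big_ind: _ => //; [exact: ideal_gen0|by move=> *; exact: ideal_genD].
Qed.

End IdealMembership.

Section HilbertFunction.
Variables (F : fieldType) (m : nat) (L : set 'cV[int]_m).
Hypothesis L0 : L 0.
Hypothesis LB : forall x y, L x -> L y -> L (x - y).
Hypothesis L_deg : forall l, L l -> \sum_i l i 0 = 0.

Definition exponent_vec (a : multinom m) : 'cV[int]_m := \col_i (a i)%:Z.
Definition vec_exponent (u : 'cV[int]_m) : multinom m :=
  Multinom [tuple absz (u i 0%R) | i < m].
Notation vec := exponent_vec.
Notation mnm := vec_exponent.

Lemma vec_exponentK (u : 'cV[int]_m) : (forall i, 0 <= u i 0) -> vec (mnm u) = u.
Proof.
move=> u0; apply/matrixP => i j; rewrite !ord1 mxE mnmE.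
by have := u0 i; lia.
Qed.

Lemma mnm_mdeg (u : 'cV[int]_m) t : (forall i, 0 <= u i 0) -> \sum_i u i 0 = t%:Z -> mdeg (mnm u) = t.
Proof.
move=> u0 ut; apply/eqP; rewrite -eqz_nat mdegE (big_morph Posz PoszD (erefl _)) -ut.
by apply/eqP/eq_bigr => i _; rewrite mnmE gez0_abs.
Qed.

(** These linear forms cut out the degree [t] part of the lattice ideal. *)
Definition class_coef t v (p : mpoly m F) : F :=
  \sum_(a : bmultinom m t.+1 | (mdeg a == t) && `[< L (vec a - v) >]) mcoeff a p.

Lemma class_coefD t v p q : class_coef t v (p + q) = class_coef t v p + class_coef t v q.
Proof. by rewrite -big_split; apply: eq_bigr => a _; rewrite mcoeffD. Qed.
Lemma class_coefB t v p q : class_coef t v (p - q) = class_coef t v p - class_coef t v q.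
Proof. by rewrite -sumrB; apply: eq_bigr => a _; rewrite mcoeffB. Qed.
Lemma class_coefZ t v c p : class_coef t v (c *: p) = c * class_coef t v p.
Proof. by rewrite mulr_sumr; apply: eq_bigr => a _; rewrite mcoeffZ. Qed.
Lemma class_coef0 t v : class_coef t v 0 = 0.
Proof. by rewrite /class_coef big1// => a _; rewrite mcoeff0. Qed.
Lemma class_coef_sum t v (I : Type) (s : seq I) (P : pred I) (f : I -> mpoly m F) :
  class_coef t v (\sum_(i <- s | P i) f i) = \sum_(i <- s | P i) class_coef t v (f i).
Proof.
by elim/big_rec2: _ => [|i y p _ <-]; [exact: class_coef0|exact: class_coefD].
Qed.

Lemma class_coefX t v (a : multinom m) :
  class_coef t v (mpolyX F a) = ((mdeg a == t) && `[< L (vec a - v) >])%:R.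
Proof.
rewrite /class_coef; case: (boolP (_ && _)) => /=.
  move=> /andP[/eqP at_ La].
  have ha : (mdeg a < t.+1)%N by rewrite at_.
  rewrite (bigD1 (BMultinom ha)) /=; last by rewrite at_ eqxx.
  rewrite mcoeffX eqxx big1 ?addr0// => b /andP[_ ba].
  by rewrite mcoeffX eq_sym; move: ba; rewrite bmeqP /= => /negbTE ->.
move=> h; rewrite big1// => b hb; rewrite mcoeffX; case: (eqVneq a (b : multinom m)) => // ab.
by rewrite ab hb in h.
Qed.

Notation I_L := (lattice_ideal F L).

Lemma vecD a b : vec (mnm_add a b) = vec a + vec b.
Proof. by apply/matrixP => i j; rewrite !mxE mnmDE PoszD. Qed.

Lemma pos_neg_part l : vec (pos_part l) - vec (neg_part l) = l.
Proof.
apply/matrixP => i j; rewrite !ord1 !mxE !mnmE.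
by move: (l i 0) => x; rewrite /Num.max; case: (ltrP x 0); case: (ltrP (- x) 0); lia.
Qed.

Lemma mdeg_pos_neg l : L l -> mdeg (pos_part l) = mdeg (neg_part l).
Proof.
move=> Ll; apply/eqP; rewrite -eqz_nat !mdegE !(big_morph Posz PoszD (erefl _)).
rewrite -subr_eq0 -sumrB -[X in _ == X](L_deg Ll); apply/eqP/eq_bigr => i _.
by have := congr1 (fun w : 'cV[int]_m => w i 0) (pos_neg_part l); rewrite !mxE.
Qed.

Lemma class_coef_ideal t v p : I_L p -> class_coef t v p = 0.
Proof.
move=> [N [g [h [Gh ->]]]]; rewrite class_coef_sum big1// => i _.
have [l Ll <-] := Gh i.
rewrite [g i]mpolyE mulr_suml class_coef_sum big1// => a _.
rewrite -scalerAl class_coefZ mulrBr class_coefB -!mpolyXD !class_coefX.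
rewrite !mdegD (mdeg_pos_neg Ll).
suff -> : `[< L (vec (mnm_add a (pos_part l)) - v) >] = `[< L (vec (mnm_add a (neg_part l)) - v) >].
  by rewrite subrr mulr0.
have e : vec (mnm_add a (pos_part l)) - v = vec (mnm_add a (neg_part l)) - v + l.
  by rewrite !vecD -[X in _ = _ + X]pos_neg_part; apply/matrixP => ? ?; rewrite !mxE; ring.
apply: asbool_equiv_eq; rewrite e; split => [L1|L1].
  by have := LB L1 Ll; rewrite addrK.
by have := LB L1 (LB L0 Ll); rewrite sub0r opprK.
Qed.

Lemma congruent_monomials a b : L (vec a - vec b) -> I_L (mpolyX F a - mpolyX F b).
Proof.
move=> Lab; set l := vec a - vec b.
have lE i : l i 0 = (a i)%:Z - (b i)%:Z by rewrite !mxE.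
pose c : multinom m := Multinom [tuple minn (a i) (b i) | i < m].
have ea : a = mnm_add c (pos_part l).
  apply/mnmP => i; rewrite mnmDE !mnmE lE.
  by move: (a i) (b i) => x y; rewrite /Num.max; case: ltrP; lia.
have eb : b = mnm_add c (neg_part l).
  apply/mnmP => i; rewrite mnmDE !mnmE lE.
  by move: (a i) (b i) => x y; rewrite /Num.max; case: ltrP; lia.
rewrite [in mpolyX F a]ea [in mpolyX F b]eb !mpolyXD -mulrBr.
by apply: ideal_genM; apply: ideal_gen_incl; exists l.
Qed.

Notation U t := (bounded_monomials 0 (@predT 'I_m) t).

Lemma homog_class_decomp t s p : transversal L (U t) s -> p \is ishomog1 t mdeg ->
  I_L (p - \sum_(v <- s) class_coef t v p *: mpolyX F (mnm v)).
Proof.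
move=> [us sU sinj scomp] hp.
have -> : \sum_(v <- s) class_coef t v p *: mpolyX F (mnm v) =
   \sum_(a <- msupp p) mcoeff a p *:
     (\sum_(v <- s) class_coef t v (mpolyX F a) *: mpolyX F (mnm v)).
  rewrite [in LHS](mpolyE p); under eq_bigr do rewrite class_coef_sum scaler_suml.
  rewrite exchange_big/=; apply: eq_bigr => a _; rewrite scaler_sumr.
  by apply: eq_bigr => v _; rewrite class_coefZ scalerA.
rewrite [X in I_L (X - _)]mpolyE -sumrB big_seq; apply: ideal_gen_sum => a ap.
rewrite -scalerBr; apply: ideal_genZ.
have at_ : mdeg a = t by apply: (dhomog_mf hp).
have Ua : U t (vec a).
  split=> // [i|]; first by rewrite mxE.
  under eq_bigr do rewrite mxE.
  by rewrite -at_ mdegE (big_morph Posz PoszD (erefl _)).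
have [v vs Lv] := scomp _ Ua.
rewrite (bigD1_seq v)//= class_coefX at_ eqxx asboolT//= scale1r big_seq_cond big1 ?addr0.
  by apply: congruent_monomials; rewrite vec_exponentK//; case: (sU _ vs).
move=> w /andP[ws wv]; rewrite class_coefX at_ eqxx asboolF ?scale0r// => Lw.
move/eqP: wv; apply; apply: sinj => //.
by have := LB Lv Lw; congr L; apply/matrixP => i j; rewrite !mxE; ring.
Qed.

(** In degree [t] the ideal is spanned by the differences of two monomials of one
    class, hence is the common kernel of the class sums: one monomial in each class
    gives a basis of the quotient, and all bases have the same cardinal. *)
Theorem hilbert_function_transversal t s N : transversal L (U t) s ->
  hilbert_function_value I_L t N <-> N = size s.
Proof.
move=> tr; have [us sU sinj scomp] := tr.
pose v (i : 'I_(size s)) := nth 0 s i.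
have vs i : v i \in s by rewrite mem_nth.
have hX i : mpolyX F (mnm (v i)) \is ishomog1 t mdeg.
  rewrite dhomogX; apply/eqP.
  by have [u0 _ ut] := sU _ (vs i); exact: mnm_mdeg.
have coefX i j : class_coef t (v j) (mpolyX F (mnm (v i))) = (i == j)%:R.
  have [u0 _ ut] := sU _ (vs i).
  rewrite class_coefX (mnm_mdeg u0 ut) eqxx vec_exponentK//=.
  have [->|ij] := eqVneq i j; first by rewrite subrr asboolT.
  rewrite asboolF// => /(sinj _ _ (vs i) (vs j)) h; move/eqP: ij; apply; apply: val_inj; apply/eqP.
  by rewrite -(nth_uniq 0 _ _ us); [apply/eqP; exact: h | exact: ltn_ord | exact: ltn_ord].
have decomp p : p \is ishomog1 t mdeg ->
    I_L (p - \sum_i class_coef t (v i) p *: mpolyX F (mnm (v i))).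
  move=> hp; have := homog_class_decomp tr hp.
  by rewrite (big_nth 0) big_mkord.
have idealP p : p \is ishomog1 t mdeg -> (forall j, class_coef t (v j) p = 0) -> I_L p.
  move=> hp p0; have := decomp _ hp; rewrite big1 ?subr0// => i _.
  by rewrite p0 scale0r.
split=> [[sg [hsg sgP]]|->].
  pose S : 'M[F]_(N, size s) := \matrix_(i, j) class_coef t (v j) (sg i).
  have SP p : p \is ishomog1 t mdeg -> forall c : 'rV[F]_N,
      I_L (p - \sum_i c 0 i *: sg i) <-> \row_j class_coef t (v j) p = c *m S.
    move=> hp c.
    have e j : class_coef t (v j) (p - \sum_i c 0 i *: sg i) =
        class_coef t (v j) p - (c *m S) 0 j.
      rewrite class_coefB class_coef_sum mxE; congr (_ - _).
      by apply: eq_bigr => i _; rewrite class_coefZ mxE.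
    split=> [Ip|/matrixP pc].
      apply/matrixP => i j; rewrite ord1 mxE; apply/eqP; rewrite -subr_eq0 -e.
      by rewrite class_coef_ideal.
    apply: idealP; last by move=> j; rewrite e -pc mxE subrr.
    apply: rpredB => //; apply: rpred_sum => i _; apply: rpredZ; exact: hsg.
  pose P (y : 'rV[F]_(size s)) := \sum_i y 0 i *: mpolyX F (mnm (v i)).
  have hP y : P y \is ishomog1 t mdeg.
    apply: rpred_sum => i _; apply: rpredZ; exact: hX.
  have coefP y : \row_j class_coef t (v j) (P y) = y.
    apply/matrixP => i j; rewrite ord1 mxE class_coef_sum (bigD1 j)//=.
    rewrite class_coefZ coefX eqxx mulr1 big1 ?addr0// => l lj.
    by rewrite class_coefZ coefX (negbTE lj) mulr0.
  have /eqP <- : row_free S.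
    apply: inj_row_free => c cS.
    have [c' [_ c'u]] := sgP _ (hP 0).
    have e z : z *m S = 0 -> c' = z.
      by move=> zS; apply: c'u; apply/SP => //; rewrite coefP zS.
    by rewrite -(e c)// (e 0)// mul0mx.
  apply/eqP; change (row_full S); rewrite -sub1mx; apply/row_subP => i.
  have [c [/SP cS _]] := sgP _ (hP (row i 1%:M)).
  by rewrite -[row i _]coefP cS ?submxMl.
exists (fun i => mpolyX F (mnm (v i))); split=> // p hp.
exists (\row_i class_coef t (v i) p); split.
  by have := decomp _ hp; congr I_L; congr (_ - _); apply: eq_bigr => i _; rewrite mxE.
move=> c Ic; apply/matrixP => i j; rewrite ord1 mxE.
have := class_coef_ideal t (v j) Ic.
rewrite class_coefB class_coef_sum (bigD1 j)//= class_coefZ coefX eqxx mulr1 big1.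
  by rewrite addr0 => /eqP; rewrite subr_eq0 => /eqP.
by move=> l lj; rewrite class_coefZ coefX (negbTE lj) mulr0.
Qed.

End HilbertFunction.

(** * Eventual polynomiality *)

Section DownsetHilbertFunctions.

Fixpoint compositions (m t : nat) : seq (seq nat) :=
  if m is m'.+1 then flatten [seq [seq j :: u | u <- compositions m' (t - j)] | j <- iota 0 t.+1]
  else if t == 0%N then [:: [::]] else [::].

Lemma compositionsS m t : compositions m.+1 t =
  flatten [seq [seq j :: u | u <- compositions m (t - j)] | j <- iota 0 t.+1].
Proof. by []. Qed.

Lemma mem_compositions m t u :
  (u \in compositions m t) = (size u == m) && (sumn u == t).
Proof.
elim: m t u => [|m IH] t u.
  rewrite [compositions _ _]/=; case: u => [|a u]; case: t => //=.
rewrite compositionsS; apply/flatten_mapP/idP => [[j]|].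
  rewrite mem_iota add0n ltnS => /= jt /mapP[v]; rewrite IH => /andP[/eqP sv /eqP vt] ->.
  by rewrite /= sv vt eqxx/= subnKC.
case: u => [|a u] //; rewrite [size _]/= [sumn _]/= eqSS => /andP[su /eqP ut]; exists a.
  by rewrite mem_iota add0n ltnS -ut leq_addr.
by apply: map_f; rewrite IH su -ut addKn eqxx.
Qed.

Lemma uniq_compositions m t : uniq (compositions m t).
Proof.
elim: m t => [|m IH] t; first by rewrite /=; case: ifP.
rewrite compositionsS; elim: (iota 0 t.+1) (iota_uniq 0 t.+1) => //= j s IHs /andP[js us].
rewrite cat_uniq IHs// andbT map_inj_uniq ?IH//=; last by move=> ? ? [].
apply/hasPn => _ /flatten_mapP[i is_ /mapP[u _ ->]]; apply/mapP => -[v _ [ij _]].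
by rewrite -ij is_ in js.
Qed.

Lemma count_compositionsS (D : pred (seq nat)) m t :
  count D (compositions m.+1 t) =
  (\sum_(j < t.+1) count (fun u => D (val j :: u)) (compositions m (t - j)))%N.
Proof.
rewrite compositionsS count_flatten -map_comp sumnE big_map.
rewrite -[iota _ _]/(index_iota 0 t.+1) big_mkord; apply: eq_bigr => j _ /=.
by rewrite count_map.
Qed.

Definition downset m (D : pred (seq nat)) :=
  forall u v, size v = m -> all2 leq u v -> D v -> D u.

Lemma all2_leq_refl u : all2 leq u u.
Proof. by elim: u => //= a u ->; rewrite leqnn. Qed.

(** Noetherianity: on the diagonal of the double sequence of slices the
    induction hypothesis applies, and beyond the diagonal nothing changes. *)
Lemma downset_acc m (D : nat -> pred (seq nat)) :
  (forall j, downset m (D j)) ->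
  (forall j u, size u = m -> D j.+1 u -> D j u) ->
  exists j0, forall j u, (j0 <= j)%N -> size u = m -> D j u = D j0 u.
Proof.
elim: m D => [|m IH] D dD decD.
  have [h|/existsNP[j0 h]] := pselect (forall j, D j [::]).
    by exists 0%N => j u _ /size0nil ->; rewrite !h.
  exists j0 => j u + /size0nil ->; move=> /subnKC <-.
  have -> : D j0 [::] = false by apply/negP.
  elim: (j - j0)%N => [|i IHi]; first by rewrite addn0; apply/negP.
  by apply/negP => /=; rewrite addnS => /decD; rewrite IHi => /(_ erefl).
have dec i j u : (i <= j)%N -> size u = m.+1 -> D j u -> D i u.
  move=> /subnKC <- su; elim: (j - i)%N => [|l IHl]; first by rewrite addn0.
  by rewrite addnS => /decD/IHl; exact.
have slice i a b u : (a <= b)%N -> size u = m -> D i (b :: u) -> D i (a :: u).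
  move=> ab su; apply: dD; first by rewrite /= su.
  by rewrite /= ab all2_leq_refl.
have slice_down i a : downset m (fun u => D i (a :: u)).
  by move=> u v sv uv; apply: dD; rewrite /= ?sv// leqnn.
have [|j u su|i0 hi0] := IH (fun i u => D i (i :: u)); first by move=> j; exact: slice_down.
  by move=> h; apply: (slice _ _ j.+1); rewrite ?leqnSn//; apply: (dec _ j.+1) => //=; rewrite su.
have far i j u : (i0 <= i)%N -> (i0 <= j)%N -> size u = m -> D i (j :: u) = D i0 (i0 :: u).
  move=> ii jj su; apply/idP/idP => h.
    by apply: (slice _ _ j) => //; apply: (dec _ i) => //=; rewrite su.
  apply: (dec _ (maxn i j)); rewrite ?leq_maxl//= ?su//.
  apply: (slice _ _ (maxn i j)); rewrite ?leq_maxr//.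
  by rewrite (hi0 (maxn i j))// leq_max ii.
have [n hn] : {n : nat -> nat & forall a j u, (n a <= j)%N -> size u = m ->
    D j (a :: u) = D (n a) (a :: u)}.
  apply: (@choice _ _ (fun a na => forall j u, (na <= j)%N -> size u = m ->
    D j (a :: u) = D na (a :: u))) => a; apply: IH; first by move=> j; exact: slice_down.
  by move=> j u su; apply: decD; rewrite /= su.
exists (maxn i0 (\max_(a < i0) n a)) => j u; rewrite geq_max => /andP[ij nj].
set M := maxn _ _; case: u => [|a u] // [su].
have [ai|ai] := leqP i0 a; first by rewrite !far// leq_maxl.
have na : (n a <= \max_(a < i0) n a)%N := @leq_bigmax _ (fun a : 'I_i0 => n a) (Ordinal ai).
by rewrite !(hn a)//; [rewrite /M leq_max na orbT | exact: leq_trans na nj].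
Qed.

(** The difference of [X ^+ n.+1] has leading term [n.+1 X ^+ n], a multiple of
    which cancels the leading term of [p]; then induction on the degree. *)
Lemma poly_antidifference (p : {poly rat}) : exists q : {poly rat}, q \Po ('X + 1) - q = p.
Proof.
have [n] := ubnPleq (size p); elim: n p => [|n IH] p sp.
  by exists 0; rewrite comp_poly0 subr0; apply/eqP; rewrite eq_sym -size_poly_leq0.
pose c := p`_n / n.+1%:R.
have [|q hq] := IH (p - c *: (('X + 1) ^+ n.+1 - 'X ^+ n.+1)).
  apply/leq_sizeP => j nj; rewrite coefB coefZ coefB coefXn exprD1n coef_sum.
  have [jn|jn] := ltnP n.+1 j.
    rewrite (_ : p`_j = 0); last by rewrite nth_default// (leq_trans sp)// ltnW.
    rewrite big1 ?gtn_eqF// ?subrr ?mulr0 ?subr0// => i _.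
    by rewrite coefMn coefXn gtn_eqF ?mul0rn// (leq_trans (ltn_ord i)).
  rewrite (bigD1 (Ordinal (jn : j < n.+2)%N))//= coefMn coefXn eqxx big1; last first.
    by move=> i /eqP ij; rewrite coefMn coefXn; case: eqP => [ji|]; rewrite ?mul0rn//; case: ij; apply: val_inj.
  rewrite addr0; move: nj; rewrite leq_eqVlt => /predU1P[<-|nj].
    by rewrite ltn_eqF// subr0 binSn /c divfK ?subrr// pnatr_eq0.
  have -> : j = n.+1 by apply/eqP; rewrite eqn_leq jn nj.
  rewrite eqxx binn subrr mulr0 subr0 nth_default//.
exists (q + c *: 'X ^+ n.+1); rewrite comp_polyD comp_polyZ comp_Xn_poly.
rewrite -[RHS](subrK (c *: (('X + 1) ^+ n.+1 - 'X ^+ n.+1))) -hq scalerBr.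
rewrite opprD !addrA; congr (_ - _); rewrite -!addrA; congr (_ + _).
by rewrite addrC.
Qed.

Lemma poly_sum (p : {poly rat}) : exists q : {poly rat}, forall t : nat,
  q.[t%:R] = \sum_(i < t) p.[i%:R].
Proof.
have [q hq] := poly_antidifference p.
exists (q - q.[0]%:P); elim=> [|t IH]; first by rewrite big_ord0 hornerD hornerN hornerC subrr.
rewrite big_ord_recr/= -IH -hq !hornerE horner_comp !hornerE.
rewrite -natr1 /=; ring.
Qed.

(** Slices by the first entry are all equal from some level [j0] on. The count is
    thus a finite sum of shifted counts and of one indefinite sum, and both
    operations preserve eventual polynomiality. *)
Lemma downset_hilbert_polynomial m D : downset m D ->
  exists (H : {poly rat}) (t0 : nat), forall t, (t0 <= t)%N ->
    H.[t%:R] = (count D (compositions m t))%:R.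
Proof.
elim: m D => [|m IH] D dD.
  by exists 0, 1%N => -[|t] //= _; rewrite horner0.
pose DD j u := D (j :: u).
have dDD j : downset m (DD j).
  by move=> u v sv uv; apply: dD; rewrite /= ?sv// leqnn.
have [|j u su|j0 hj0] := @downset_acc m DD => //.
  by apply: dD; rewrite /= ?su// leqnSn all2_leq_refl.
pose c j t := count (DD j) (compositions m t).
have [H hH] : {H : nat -> {poly rat} & forall j, exists t0, forall t, (t0 <= t)%N ->
     (H j).[t%:R] = (c j t)%:R}.
  by apply: (@choice _ _ (fun j H => exists t0, forall t, (t0 <= t)%N ->
     H.[t%:R] = (c j t)%:R)) => j; exact: IH.
have [T hT] := choice hH.
have [Q hQ] := poly_sum (H j0).
pose K : rat := \sum_(i < T j0) (c j0 i)%:R - Q.[(T j0)%:R].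
exists (\sum_(j < j0) (H j \Po ('X - (val j)%:R%:P)) + (Q \Po ('X - (j0%:R - 1)%:P)) + K%:P).
exists (j0 + T j0 + \max_(j < j0) T j)%N => t ht.
have jt : (j0 <= t.+1)%N by apply: leqW; apply: leq_trans ht; rewrite -addnA leq_addr.
rewrite count_compositionsS natr_sum -(big_mkord xpredT
  (fun j => (count (fun u => D (j :: u)) (compositions m (t - j)))%:R)).
rewrite (@big_cat_nat _ _ _ j0)//= -addrA hornerD; congr (_ + _).
  rewrite big_mkord horner_sum; apply: eq_bigr => j _.
  rewrite horner_comp !hornerE -natrB; last first.
    by rewrite -ltnS; apply: leq_trans jt.
  apply: hT; have := @leq_bigmax _ (fun a : 'I_j0 => T a) j.
  move: ht (ltn_ord j); set MM := \max_(_ < _) _; lia.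
have -> : \sum_(j0 <= j < t.+1) (count (fun u => D (j :: u)) (compositions m (t - j)))%:R =
    \sum_(i < t.+1 - j0) (c j0 i)%:R :> rat.
  rewrite -{1}[j0]add0n big_addn big_mkord (reindex_inj rev_ord_inj)/=; apply: eq_bigr => i _.
  congr (_%:R); rewrite /c; apply/esym.
  have -> : (t - (t.+1 - j0 - i.+1 + j0))%N = i by move: (ltn_ord i) jt; lia.
  apply: eq_in_count => u; rewrite mem_compositions => /andP[/eqP su _].
  by rewrite -[RHS]/(DD _ u) hj0// leq_addl.
rewrite hornerD horner_comp !hornerE.
have -> : t%:R - (j0%:R - 1) = (t.+1 - j0)%:R :> rat by rewrite natrB// -natr1; ring.
rewrite hQ /K hQ.
have Tt : (T j0 <= t.+1 - j0)%N by move: ht jt; set MM := \max_(_ < _) _; lia.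
rewrite -(big_mkord xpredT (fun i => (c j0 i)%:R)) -(big_mkord xpredT (fun i => (H j0).[i%:R])).
rewrite -(big_mkord xpredT (fun i => (c j0 i)%:R)) -(big_mkord xpredT (fun i => (H j0).[i%:R])).
rewrite (@big_cat_nat _ _ _ (T j0))//= [in RHS](@big_cat_nat _ _ _ (T j0))//=.
rewrite [LHS]addrAC [X in X + _]addrAC subrr add0r [LHS]addrC; congr (_ + _).
by apply: eq_big_nat => i /andP[hi _]; apply: hT.
Qed.

End DownsetHilbertFunctions.

Section StandardMonomials.
Variables (m : nat) (L : set 'cV[int]_m).
Hypothesis L0 : L 0.
Hypothesis LB : forall x y, L x -> L y -> L (x - y).
Hypothesis L_deg : forall l, L l -> \sum_i l i 0 = 0.

Definition seq_vec (u : seq nat) : 'cV[int]_m := \col_i (nth 0%N u i)%:Z.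

Fixpoint lexle (u v : seq nat) : bool :=
  match u, v with
  | a :: u', b :: v' => (a < b)%N || (a == b) && lexle u' v'
  | _, _ => true
  end.

Definition add_seq (u v : seq nat) := [seq (x.1 + x.2)%N | x <- zip u v].

Lemma lexle_anti u v : size u = size v -> lexle u v -> lexle v u -> u = v.
Proof.
elim: u v => [|a u IH] [|b v] //= [suv]; case: ltngtP => //= <- uv vu.
by rewrite (IH v).
Qed.

Lemma lexle_add e u v : size u = size e -> size v = size e ->
  lexle (add_seq e u) (add_seq e v) = lexle u v.
Proof.
elim: e u v => [|x e IH] [|a u] [|b v] //= [su] [sv].
by rewrite ltn_add2l eqn_add2l [lexle [seq _ | _ <- _] _]IH.
Qed.

Lemma lexle_min k (Q : set (seq nat)) : (exists2 u, size u = k & Q u) ->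
  exists u, [/\ size u = k, Q u & forall v, size v = k -> Q v -> lexle u v].
Proof.
elim: k Q => [|k IH] Q [u su Qu].
  by exists u; split => // v sv _; rewrite (size0nil su).
have ex : exists a, `[< exists2 v, size v = k & Q (a :: v) >].
  by case: u su Qu => // a u [su] Qu; exists a; apply/asboolP; exists u.
have [a /asboolP[v sv Qv] amin] := ex_minnP ex.
have [|w [sw Qw wmin]] := IH (fun v => Q (a :: v)); first by exists v.
exists (a :: w); split => //= [|[|b x] //= [sx] Qx]; first by rewrite sw.
have : (a <= b)%N by apply: amin; apply/asboolP; exists x.
by rewrite leq_eqVlt => /predU1P[ab|->//]; rewrite -ab in Qx *; rewrite eqxx wmin// orbT.
Qed.

Lemma seq_vec_add u v : size u = m -> size v = m -> seq_vec (add_seq u v) = seq_vec u + seq_vec v.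
Proof.
move=> su sv; apply/matrixP => i j; rewrite !mxE.
rewrite (nth_map (0%N, 0%N)); last by rewrite size_zip su sv minnn.
by rewrite nth_zip ?su ?sv//= PoszD.
Qed.

Lemma seq_vec_inj u v : size u = m -> size v = m -> seq_vec u = seq_vec v -> u = v.
Proof.
move=> su sv uv; apply: (@eq_from_nth _ 0%N); rewrite ?su ?sv// => i im.
by have := congr1 (fun w : 'cV[int]_m => w (Ordinal im) 0) uv; rewrite !mxE => -[].
Qed.

Lemma sum_seq_vec u : size u = m -> \sum_i seq_vec u i 0 = (sumn u)%:Z.
Proof.
move=> su; under eq_bigr do rewrite mxE.
by rewrite -(big_morph Posz PoszD (erefl _)) sumnE (big_nth 0%N) big_mkord su.
Qed.

Definition vec_seq (u : 'cV[int]_m) : seq nat := [seq absz (u i 0) | i : 'I_m].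

Lemma size_vec_seq u : size (vec_seq u) = m.
Proof. by rewrite size_map -cardE card_ord. Qed.

Lemma vec_seqK (u : 'cV[int]_m) : (forall i, 0 <= u i 0) -> seq_vec (vec_seq u) = u.
Proof.
move=> u0; apply/matrixP => i j; rewrite ord1 mxE (nth_map i).
  by rewrite nth_ord_enum gez0_abs.
by rewrite -cardE card_ord.
Qed.

Definition standard (u : seq nat) : bool :=
  `[< forall v, size v = m -> L (seq_vec v - seq_vec u) -> lexle u v >].

(** The lexicographic order is compatible with addition, so a smaller vector
    congruent to [u] would give one congruent to any [w] above [u] and smaller
    than it. *)
Lemma standard_downset : downset m standard.
Proof.
move=> u w sw uw /asboolP std; apply/asboolP => v sv Lv.
have su : size u = m by move: uw; rewrite all2E => /andP[/eqP ->].
pose e := [seq (x.1 - x.2)%N | x <- zip w u].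
have se : size e = m by rewrite size_map size_zip sw su minnn.
have weu : add_seq e u = w.
  move: uw; rewrite /e; clear; elim: u w => [|a u IH] [|b w] //= /andP[ab uw].
  by rewrite /add_seq/= subnK//; congr cons; apply: IH.
rewrite -(@lexle_add e) ?su ?sv ?se// weu; apply: std.
  by rewrite size_map size_zip sv se minnn.
by rewrite -weu !seq_vec_add// opprD addrACA subrr add0r.
Qed.

Notation U t := (bounded_monomials 0 (@predT 'I_m) t).

Lemma standard_transversal t :
  transversal L (U t) [seq seq_vec u | u <- compositions m t & standard u].
Proof.
have memP u : u \in [seq u <- compositions m t | standard u] =
    [&& standard u, size u == m & sumn u == t].
  by rewrite mem_filter mem_compositions.
split.
- rewrite map_inj_in_uniq ?filter_uniq ?uniq_compositions// => u v.
  by rewrite !memP => /and3P[_ /eqP su _] /and3P[_ /eqP sv _]; exact: seq_vec_inj.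
- move=> x /mapP[u]; rewrite memP => /and3P[_ /eqP su /eqP ut] ->; split => //.
    by move=> i; rewrite mxE.
  by rewrite sum_seq_vec// ut.
- move=> x y /mapP[u uP ->] /mapP[v vP ->]; move: uP vP; rewrite !memP.
  move=> /and3P[/asboolP stu /eqP su _] /and3P[/asboolP stv /eqP sv _] Luv.
  congr seq_vec; apply: lexle_anti; rewrite ?su ?sv//; last exact: stv.
  by apply: stu => //; have := LB L0 Luv; rewrite sub0r opprB.
move=> u [u0 _ ut].
have [|v [sv Lv vmin]] := @lexle_min m (fun v => L (u - seq_vec v)).
  by exists (vec_seq u); rewrite ?size_vec_seq// vec_seqK// subrr.
exists (seq_vec v) => //; apply: map_f; rewrite memP; apply/and3P; split.
- apply/asboolP => w sw Lw; apply: vmin => //.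
  by have := LB Lv Lw; congr L; apply/matrixP => i j; rewrite !mxE; ring.
- by rewrite sv.
- have := L_deg Lv; under eq_bigr do rewrite mxE.
  rewrite big_split/= ut => /eqP; rewrite -[X in _ + X]opprK.
  under eq_bigr do rewrite mxE.
  by rewrite sumrN opprK sum_seq_vec// subr_eq0 eqz_nat eq_sym.
Qed.

Theorem lattice_hilbert_polynomial : exists (H : {poly rat}) (t0 : nat),
  forall t, (t0 <= t)%N -> exists2 s, transversal L (U t) s & H.[t%:R] = (size s)%:R.
Proof.
have [H [t0 hH]] := downset_hilbert_polynomial standard_downset.
exists H, t0 => t tt; exists [seq seq_vec u | u <- compositions m t & standard u].
  exact: standard_transversal.
by rewrite hH// size_map size_filter.
Qed.

End StandardMonomials.

(** * Index of a lattice in its saturation *)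

Section GroupIndex.
Variables (V : zmodType).

Lemma group_index_reps (M L : set V) N (rho : 'I_N -> V) :
  (forall x y, L x -> L y -> L (x - y)) -> L 0 ->
  (forall j, M (rho j)) -> (forall v, M v -> exists j, L (v - rho j)) ->
  (forall i j, L (rho i - rho j) -> i = j) -> group_index M L = N.
Proof.
move=> LB L0 Mrho cover inj.
have cosetE u v : L (u - v) -> lattice_coset L u = lattice_coset L v.
  move=> Luv; apply/seteqP; split => x [l Ll <-].
    exists (u - v + l); last by rewrite addrA subrKC.
    by have := LB _ _ Luv (LB _ _ L0 Ll); rewrite sub0r opprK.
  exists (l - (u - v)); first exact: LB.
  by rewrite opprB addrA [u + l]addrC -addrA [u + _]addrC subrK addrC.
have cosetN u v : lattice_coset L u = lattice_coset L v -> L (u - v).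
  move=> uv; have : lattice_coset L u u by exists 0; rewrite ?addr0.
  by rewrite uv => -[l Ll <-]; rewrite addrAC subrr add0r.
rewrite /group_index (_ : [set lattice_coset L v | v in M] =
   [set` [fset lattice_coset L (rho j) | j in 'I_N]%fset]).
  rewrite set_fsetK card_imfset; last by move=> i j /cosetN/inj.
  by rewrite -cardE card_ord.
apply/seteqP; split => x.
  move=> [v Mv <-] /=; have [j Lj] := cover v Mv.
  by rewrite (cosetE _ _ Lj); apply/imfsetP; exists j.
by move=> /= /imfsetP[j _ ->]; exists (rho j).
Qed.

End GroupIndex.

Lemma det2E (u v : 'rV[int]_2) : det2 u v = u 0 0 * v 0 1 - u 0 1 * v 0 0.
Proof.
rewrite /det2 (expand_det_row _ 0) !big_ord_recl big_ord0 addr0 /cofactor !det_mx11.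
have l0 : lift 0 0 = 1 :> 'I_2 by apply: val_inj.
have l1 : lift 1 0 = 0 :> 'I_2 by apply: val_inj.
have e0 (i : 'I_2) j : val i = 0%N -> col_mx u v i j = u 0 j.
  by move=> h; have -> : i = lshift 1 (ord0 : 'I_1) by [apply: val_inj]; rewrite col_mxEu.
have e1 (i : 'I_2) j : val i = 1%N -> col_mx u v i j = v 0 j.
  by move=> h; have -> : i = rshift 1 (ord0 : 'I_1) by [apply: val_inj]; rewrite col_mxEd.
move: (col_mx u v) e0 e1 => C e0 e1.
rewrite !mxE l0 l1 !(e0 0)// !(e1 1)//=.
by rewrite addn0 expr0 expr1; ring.
Qed.

Lemma det2_mulmx (u v : 'rV[int]_2) (M : 'M[int]_2) : det2 (u *m M) (v *m M) = det2 u v * \det M.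
Proof. by rewrite /det2 -mul_col_mx det_mulmx. Qed.

(** Each minor is a multiple of the determinant of [M]. Conversely the expansion
    of the determinant of [S' *m S] along its rows writes 1 as an integral
    combination of the minors of [S]. *)
Lemma gcd_minors r (S : 'M[int]_(r, 2)) (S' : 'M[int]_(2, r)) (M : 'M[int]_2) :
  S' *m S = 1%:M ->
  \big[gcdn/0%N]_(i < r) \big[gcdn/0%N]_(j < r)
     `|det2 (row i (S *m M)) (row j (S *m M))|%N = `|\det M|%N.
Proof.
move=> SS; set G := bigop _ _ _.
have rowE i : row i (S *m M) = row i S *m M by rewrite row_mul.
apply/eqP; rewrite eqn_dvd; apply/andP; split; last first.
  apply/dvdn_biggcdP => i _; apply/dvdn_biggcdP => j _.
  by rewrite !rowE det2_mulmx abszM dvdn_mull.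
have dG i j : (G%:Z %| det2 (row i S) (row j S) * \det M)%Z.
  rewrite -det2_mulmx -!rowE dvdzE /=.
  apply: (@dvdn_trans (\big[gcdn/0%N]_(j < r) `|det2 (row i (S *m M)) (row j (S *m M))|%N)).
    exact: (@biggcdn_inf _ i).
  exact: (@biggcdn_inf _ j).
have S1 : 1 = \sum_i \sum_j S' 0 i * S' 1 j * det2 (row i S) (row j S).
  have d1 : det2 (row 0 (S' *m S)) (row 1 (S' *m S)) = 1.
    by rewrite SS det2E !mxE.
  rewrite -[LHS]d1 det2E !mxE !big_distrlr/= -sumrB; apply: eq_bigr => i _.
  by rewrite -sumrB; apply: eq_bigr => j _; rewrite det2E !mxE; ring.
change ((G%:Z %| \det M)%Z).
rewrite -[\det M]mul1r S1 mulr_suml; apply: rpred_sum => i _.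
rewrite mulr_suml; apply: rpred_sum => j _.
by rewrite -!mulrA; do 2 apply: dvdz_mull; exact: dG.
Qed.

Definition saturation r p (C : 'M[int]_(r, p)) : set 'cV[int]_r :=
  [set x | exists2 N, (0 < N)%N & column_lattice C (x *+ N)].

(** In coordinates given by the Smith normal form the quotient of the
    saturation by the lattice is a product of two cyclic groups. *)
Lemma saturation_reps r (C : 'M[int]_(r, 2)) :
  injective (fun z : 'cV[int]_2 => C *m z) ->
  exists (D : nat) (rho : 'I_D -> 'cV[int]_r),
  [/\ forall j, saturation C (rho j),
      forall x, saturation C x -> exists j, column_lattice C (x - rho j),
      forall i j, column_lattice C (rho i - rho j) -> i = j &
      D = \big[gcdn/0%N]_(i < r) \big[gcdn/0%N]_(j < r) `|det2 (row i C) (row j C)|%N].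
Proof.
move=> Cinj.
have [U Uu [W Wu [d _ CE]]] := int_Smith_normal_form C.
set D0 := \matrix_(i, j) _ in CE.
have D0_inj (z : 'cV[int]_2) : D0 *m z = 0 -> z = 0.
  move=> Dz; have : C *m (invmx W *m z) = C *m 0.
    by rewrite CE -!mulmxA mulKVmx// Dz !mulmx0.
  by move=> /Cinj/(congr1 (mulmx W)); rewrite mulKVmx// mulmx0.
have dP (j : 'I_2) : d`_j != 0 /\ (j < r)%N.
  have [H|H] := pselect (d`_j != 0 /\ (j < r)%N) => //.
  have : D0 *m (delta_mx j 0 : 'cV[int]_2) = 0.
    rewrite -colE; apply/matrixP => i l; rewrite !mxE.
    case: eqVneq => [ij|]; rewrite ?mulr0n// mulr1n; apply/eqP/negP => dj.
    by apply: H; rewrite ?ij -ij ltn_ord; split => //; apply/negP.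
  by move/D0_inj/matrixP/(_ j 0); rewrite !mxE !eqxx.
have [d0N0 r0] := dP 0; have [d1N0 r1] := dP 1.
pose a0 : int := d`_0; pose a1 : int := d`_1.
pose i0 : 'I_r := Ordinal r0; pose i1 : 'I_r := Ordinal r1.
pose n0 := absz (a0); pose n1 := absz (a1).
have n0_gt0 : (0 < n0)%N by rewrite absz_gt0.
have n1_gt0 : (0 < n1)%N by rewrite absz_gt0.
have latP x : column_lattice C x <->
  [/\ (a0 %| (invmx U *m x)%R i0 0%R)%Z, (a1 %| (invmx U *m x)%R i1 0%R)%Z &
      forall i : 'I_r, (1 < i)%N -> (invmx U *m x) i 0 = 0].
  have D0E (z : 'cV[int]_2) i : (D0 *m z) i 0 =
      a0 * z 0 0 *+ (i == 0 :> nat) + a1 * z 1 0 *+ (i == 1 :> nat).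
    rewrite mxE !big_ord_recl big_ord0 addr0 !mxE.
    have -> : lift 0 0 = 1 :> 'I_2 by apply: val_inj.
    have swap (c : nat) (t : int) : d`_i * t *+ (i == c :> nat) = d`_c * t *+ (i == c :> nat).
      by case: eqP => [->|].
    by rewrite !mulrnAl !swap.
  have := mulKVmx Uu x; move: (invmx U *m x) => v xE.
  split=> [[z _ zx]|[/dvdzP[a ha] /dvdzP[b hb] h]].
    have -> : v = D0 *m (W *m z) by rewrite -(mulKmx Uu v) xE -zx CE -!mulmxA mulKmx.
    rewrite !D0E/=; split.
    - by rewrite mulr1n mulr0n addr0 dvdz_mulr.
    - by rewrite mulr1n mulr0n add0r dvdz_mulr.
    - by move=> i i_gt1; rewrite D0E !gtn_eqF ?mulr0n ?addr0// ltnW.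
  pose z : 'cV[int]_2 := \col_i (if i == 0 then a else b).
  exists (invmx W *m z) => //; rewrite -xE CE -!mulmxA mulKVmx//.
  congr (_ *m _); apply/matrixP => i j; rewrite !ord1 D0E ![z _ _]mxE/=.
  have [ii|] := ltnP 1 i; first by rewrite h// !gtn_eqF ?mulr0n ?addr0// ltnW.
  case: (eqVneq (i : nat) 0%N) => [iz _|iz].
    have -> : i = i0 by apply: val_inj.
    by rewrite ha/= mulr0n addr0 mulr1n mulrC.
  move=> ile; have -> : i = i1.
    by apply: val_inj; move: iz ile; rewrite /=; case: (nat_of_ord i) => [|[]].
  by rewrite hb/= mulr0n add0r mulr1n mulrC.
have satP x : saturation C x <->
    forall i : 'I_r, (1 < i)%N -> (invmx U *m x) i 0 = 0.
  split=> [[N N0 /latP[_ _ h]] i i_gt1|h].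
    have /eqP := h i i_gt1; rewrite -scaler_nat -scalemxAr mxE mulf_eq0.
    by rewrite pnatr_eq0 gtn_eqF//= => /eqP.
  exists (n0 * n1)%N; first by rewrite muln_gt0 n0_gt0.
  apply/latP; rewrite -scaler_nat -scalemxAr; split.
  - by rewrite mxE natz PoszM -mulrA dvdz_mulr// dvdzE.
  - by rewrite mxE natz PoszM mulrAC dvdz_mull// dvdzE.
  - by move=> i /h hi; rewrite mxE hi mulr0.
pose y (j : nat) : 'cV[int]_r := \col_i (if i == i0 then (j %/ n1)%N%:Z
   else if i == i1 then (j %% n1)%N%:Z else 0).
exists (n0 * n1)%N, (fun j => U *m y j); split.
- move=> j; apply/satP => i i_gt1; rewrite mulKmx// mxE.
  by rewrite -!val_eqE/= !gtn_eqF// ltnW.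
- move=> x /satP; have [v vE] : {v | v = invmx U *m x} by exists (invmx U *m x).
  rewrite -vE => hx.
  pose q0 := absz (v i0 0%R %% a0)%Z; pose q1 := absz (v i1 0%R %% a1)%Z.
  have q0E : (v i0 0%R %% a0)%Z = q0 by rewrite gez0_abs ?modz_ge0.
  have q1E : (v i1 0%R %% a1)%Z = q1 by rewrite gez0_abs ?modz_ge0.
  have q0n : (q0 < n0)%N by rewrite -ltz_nat -q0E ltz_mod.
  have q1n : (q1 < n1)%N by rewrite -ltz_nat -q1E ltz_mod.
  have jD : (q0 * n1 + q1 < n0 * n1)%N.
    by apply: leq_trans (_ : (q0.+1 * n1 <= _)%N); rewrite ?leq_mul2r ?q0n ?orbT// mulSn addnC ltn_add2r.
  exists (Ordinal jD); apply/latP; rewrite mulmxBr mulKmx// -vE /=.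
  split.
  - rewrite !mxE eqxx divnMDl// (divn_small q1n) addn0 -q0E.
    by rewrite {1}(divz_eq (v i0 0) a0) addrK dvdz_mull.
  - rewrite !mxE eqxx/= modnMDl (modn_small q1n) -q1E.
    by rewrite {1}(divz_eq (v i1 0) a1) addrK dvdz_mull.
  - move=> i i_gt1; rewrite mxE hx// !mxE -!val_eqE/= !gtn_eqF ?subrr//; exact: ltnW.
- move=> i j /latP; rewrite -mulmxBr mulKmx// !mxE eqxx/= => -[h0 h1 _].
  have small (a b n : nat) (e : int) : absz e = n -> (a < n)%N -> (b < n)%N ->
      (e %| a%:Z - b%:Z)%Z -> a = b.
    move=> en an bn; rewrite dvdzE en => /dvdnP[[|c] hc].
      by rewrite mul0n in hc; clear -hc; lia.
    have {hc} : (n <= `|a%:Z - b%:Z|)%N by rewrite hc leq_pmull.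
    by clear -an bn; lia.
  apply: val_inj; rewrite /= (divn_eq i n1) (divn_eq j n1); congr (_ * _ + _)%N.
    by apply: (small _ _ n0 a0) => //; rewrite ltn_divLR.
  by apply: (small _ _ n1 a1) => //; rewrite ltn_mod.
pose e (j : 'I_2) : 'I_r := if j == 0 then i0 else i1.
pose S : 'M[int]_(r, 2) := \matrix_(i, j) U i (e j).
pose S' : 'M[int]_(2, r) := \matrix_(i, j) invmx U (e i) j.
pose M : 'M[int]_2 := diag_mx (\row_j d`_j) *m W.
have eE j : e j = j :> nat by case: j => [[|[|?]] ?].
have CSM : C = S *m M.
  rewrite CE /M !mulmxA; congr (_ *m _); apply/matrixP => i j.
  rewrite mul_mx_diag !mxE (bigD1 (e j))//= big1 ?addr0 => [|l lj].
    by rewrite mxE eE eqxx mulr1n.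
  by rewrite mxE -eE val_eqE (negbTE lj) mulr0n mulr0.
rewrite [in RHS]CSM (@gcd_minors _ S S').
  rewrite /M det_mulmx det_diag !big_ord_recl big_ord0 mulr1 !mxE !abszM.
  have : (`|\det W| * `|\det (invmx W)| = 1)%N.
    by rewrite -abszM -det_mulmx mulmxV// det1.
  by move/eqP; rewrite muln_eq1 => /andP[/eqP -> _]; rewrite muln1.
apply/matrixP => i j; rewrite mxE.
transitivity ((invmx U *m U) (e i) (e j)).
  by rewrite mxE; apply: eq_bigr => l _; rewrite !mxE.
by rewrite mulVmx// !mxE -!val_eqE/= !eE.
Qed.

(** * Growth of polynomials and kernels of integer matrices *)

Section Asymptotics.
Variable R : realType.

Lemma coef_ge0_of_eventually_ge0 (p : {poly R}) n t0 :
  (size p <= n.+1)%N -> (forall t : nat, (t0 <= t)%N -> 0 <= p.[t%:R]) -> 0 <= p`_n.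
Proof.
move=> sp p0; rewrite leNgt; apply/negP => pn0.
have spn : size p = n.+1.
  apply/eqP; rewrite eqn_leq sp /= ltnNge; apply/negP => sp'.
  by move: pn0; rewrite nth_default ?ltxx.
have lp : 0 < lead_coef (- p) by rewrite lead_coefN lead_coefE spn oppr_gt0.
have [x hx] := polyrcf.poly_pinfty_gt_lc lp.
pose t := maxn t0 (Num.bound x).
have xt : x <= t%:R.
  have [x0|x0] := leP 0 x; last by rewrite (le_trans (ltW x0)).
  by rewrite (le_trans (ltW (archi_boundP x0)))// ler_nat leq_maxr.
have := hx _ xt; have := p0 t (leq_maxl _ _); rewrite hornerN; lra.
Qed.

Lemma power_comparison (a b : R) (c k t0 : nat) :
  (forall t : nat, (t0 <= t)%N -> b * t%:R ^+ k <= a * (t + c)%:R ^+ k) -> b <= a.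
Proof.
move=> h.
have sXc : size (('X + c%:R%:P) ^+ k : {poly R}) = k.+1.
  by rewrite -[c%:R%:P]opprK -polyCN size_exp_XsubC.
have lXc : (('X + c%:R%:P) ^+ k : {poly R})`_k = 1.
  have := monic_exp k (monicXaddC (c%:R : R)).
  by move/monicP; rewrite lead_coefE sXc.
have : 0 <= (a *: ('X + c%:R%:P) ^+ k - b *: 'X ^+ k : {poly R})`_k.
  apply: (@coef_ge0_of_eventually_ge0 _ _ t0) => [|t tt].
    rewrite (leq_trans (size_polyD _ _))// geq_max size_polyN.
    by rewrite !(leq_trans (size_scale_leq _ _))// ?sXc ?size_polyXn.
  by rewrite !hornerE subr_ge0 -natrD; exact: h.
by rewrite coefB !coefZ lXc coefXn eqxx !mulr1 subr_ge0.
Qed.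

(** Shifting the argument does not change the coefficient of index [n] when the
    degree is at most [n]. For [n] the larger of [k] and the degree of [H], both
    differences have a nonnegative coefficient there, which pins it down. *)
Lemma squeezed_polynomial (H : {poly R}) (a : R) (k c c' t0 : nat) : 0 < a ->
  (forall t : nat, (t0 <= t)%N -> H.[t%:R] <= a * (t + c)%:R ^+ k) ->
  (forall t : nat, (t0 <= t)%N -> a * t%:R ^+ k <= H.[(t + c')%:R]) ->
  size H = k.+1 /\ lead_coef H = a.
Proof.
move=> a0 hub hlb.
have sXc d : size (('X + d%:R%:P) ^+ k : {poly R}) = k.+1.
  by rewrite -[d%:R%:P]opprK -polyCN size_exp_XsubC.
have lXc d : lead_coef (('X + d%:R%:P) ^+ k : {poly R}) = 1.
  by apply/monicP/monic_exp/monicXaddC.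
pose n := maxn k (size H).-1.
have kn : (k <= n)%N by exact: leq_maxl.
have Hn : (size H <= n.+1)%N by rewrite (leq_trans (leqSpred _))// ltnS leq_maxr.
have coefXc d : (('X + d%:R%:P) ^+ k : {poly R})`_n = (n == k)%:R.
  have [->|nk] := eqVneq n k; first by rewrite -[RHS](lXc d) lead_coefE sXc.
  by rewrite nth_default// sXc ltn_neqAle eq_sym nk kn.
have ub : H`_n <= a * (n == k)%:R.
  have : 0 <= (a *: ('X + c%:R%:P) ^+ k - H : {poly R})`_n.
    apply: (@coef_ge0_of_eventually_ge0 _ _ t0) => [|t tt].
      rewrite (leq_trans (size_polyD _ _))// geq_max size_polyN Hn andbT.
      by rewrite (leq_trans (size_scale_leq _ _))// sXc.
    by rewrite !hornerE subr_ge0 -natrD; exact: hub.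
  by rewrite coefB coefZ coefXc subr_ge0.
pose Hc := H \Po ('X + c'%:R%:P).
have sHc : size Hc = size H by rewrite size_comp_poly2// size_XaddC.
have cHc : Hc`_n = H`_n.
  move: Hn; rewrite leq_eqVlt => /predU1P[sH|sH]; last first.
    by rewrite !nth_default// sHc -ltnS.
  have -> : n = (size H).-1 by rewrite sH.
  rewrite -[RHS]lead_coefE -{1}sHc -lead_coefE lead_coef_comp ?size_XaddC//.
  by rewrite lead_coefDl ?size_polyX ?size_polyC ?lead_coefX ?expr1n ?mulr1//; case: eqP.
have lb : a * (n == k)%:R <= H`_n.
  have : 0 <= (Hc - a *: 'X ^+ k : {poly R})`_n.
    apply: (@coef_ge0_of_eventually_ge0 _ _ t0) => [|t tt].
      rewrite (leq_trans (size_polyD _ _))// geq_max size_polyN sHc Hn /=.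
      by rewrite (leq_trans (size_scale_leq _ _))// size_polyXn.
    by rewrite hornerD hornerN horner_comp !hornerE subr_ge0 -natrD; exact: hlb.
  by rewrite coefB coefZ coefXn cHc subr_ge0.
have HnE : H`_n = a * (n == k)%:R by apply/eqP; rewrite eq_le ub lb.
have nk : n = k.
  apply/eqP; apply/negPn/negP => nk; move: HnE; rewrite (negbTE nk) mulr0.
  have nE : n = (size H).-1.
    by move: nk; rewrite /n /maxn; case: ltnP => //; rewrite eqxx.
  rewrite nE -lead_coefE => /eqP; rewrite lead_coef_eq0 => /eqP H0.
  by move: nk kn; rewrite nE H0 size_poly0/= leqn0 eq_sym => /negbTE ->.
rewrite nk eqxx mulr1 in HnE.
have sH : size H = k.+1.
  apply/eqP; rewrite eqn_leq -{1}nk Hn/= ltnNge; apply/negP => sH.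
  by move: a0; rewrite -HnE nth_default ?ltxx.
by rewrite lead_coefE sH.
Qed.

End Asymptotics.

Lemma clear_denominators n (x : 'cV[rat]_n) : exists2 N : nat, (0 < N)%N &
  exists y : 'cV[int]_n, N%:R *: x = map_mx intr y.
Proof.
pose N := (\prod_i `|denq (x i 0%R)|)%N.
exists N; first by rewrite prodn_gt0// => i; rewrite absz_gt0 denq_eq0.
exists (\col_i (numq (x i 0) * (\prod_(j | j != i) `|denq (x j 0%R)|)%N%:Z)).
apply/matrixP => i j; rewrite ord1 !mxE /N (bigD1 i)//= natrM intrM -pmulrn mulrAC.
congr (_ * _).
have -> : `|denq (x i 0%R)|%N%:R = (denq (x i 0))%:~R :> rat.
  by rewrite pmulrn gez0_abs// ltW// denq_gt0.
by rewrite -{2}[x i 0]divq_num_den mulrC divfK// intr_eq0 denq_eq0.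
Qed.

Lemma intr_mx_inj a b (M N : 'M[int]_(a, b)) :
  map_mx intr M = map_mx intr N :> 'M[rat]_(a, b) -> M = N.
Proof.
move=> /matrixP MN; apply/matrixP => i j.
by have := MN i j; rewrite !mxE => /intr_inj.
Qed.

Section ColumnLattice.
Variables (m p : nat) (C : 'M[int]_(m, p)).

Lemma column_latticeB x y :
  column_lattice C x -> column_lattice C y -> column_lattice C (x - y).
Proof. by move=> [a _ <-] [b _ <-]; exists (a - b); rewrite // mulmxBr. Qed.

Lemma column_lattice0 : column_lattice C 0.
Proof. by exists 0; rewrite // mulmx0. Qed.

End ColumnLattice.

Section RationalKernel.
Variables (r k : nat) (V : 'M[int]_(k, r)) (C : 'M[int]_(r, 2)).
Hypothesis Cinj : injective (fun z : 'cV[int]_2 => C *m z).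
Hypothesis Vsurj : forall a : 'cV[int]_k, exists x, V *m x = a.
Hypothesis kerV : forall x, V *m x = 0 <-> saturation C x.

Let VQ := map_mx intr V : 'M[rat]_(k, r).
Let CQ := map_mx intr C : 'M[rat]_(r, 2).

Lemma mulVC : V *m C = 0.
Proof.
apply/matrixP => i j; have [_ h] := kerV (col j C).
have : V *m col j C = 0.
  by apply: h; exists 1%N => //; exists (delta_mx j 0); rewrite // -colE.
by rewrite colE mulmxA -colE => /matrixP/(_ i 0); rewrite [LHS]mxE => ->; rewrite !mxE.
Qed.

(** Clearing denominators turns a rational relation into an integral one, a
    multiple of which lies in the lattice of [C]. *)
Lemma rational_kernel_columns (x : 'cV[rat]_r) : VQ *m x = 0 -> exists s, x = CQ *m s.
Proof.
move=> Vx; have [N N0 [y Ny]] := clear_denominators x.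
have Vy : V *m y = 0.
  apply: intr_mx_inj.
  by rewrite map_mxM -Ny -scalemxAr Vx scaler0 map_mx0.
have [M M0 [z _ zy]] := (kerV y).1 Vy.
exists ((M * N)%:R^-1 *: map_mx intr z).
rewrite -scalemxAr -map_mxM zy raddfMn/= -Ny -scaler_nat !scalerA natrM.
by rewrite -mulrA mulVf ?scale1r// mulf_neq0// pnatr_eq0 gtn_eqF.
Qed.

Lemma rational_kernel : (kermx VQ^T <= CQ^T)%MS.
Proof.
apply/rV_subP => x /sub_kermxP xV.
have [|s sE] := @rational_kernel_columns x^T.
  by rewrite -[LHS]trmxK trmx_mul trmxK xV trmx0.
by rewrite -[x]trmxK sE trmx_mul submxMl.
Qed.

Lemma CQ_rank : \rank CQ^T = 2%N.
Proof.
apply/eqP; change (row_free CQ^T); apply: inj_row_free => v vC.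
have CQv : CQ *m v^T = 0 by rewrite -[LHS]trmxK trmx_mul trmxK vC trmx0.
have [N N0 [y Ny]] := clear_denominators v^T.
have : C *m y = C *m 0.
  rewrite mulmx0; apply: intr_mx_inj.
  by rewrite map_mxM -Ny -scalemxAr -/CQ CQv scaler0 map_mx0.
move/Cinj => y0; move: Ny; rewrite y0 map_mx0 => /eqP; rewrite scaler_eq0 pnatr_eq0 gtn_eqF//=.
by move=> /eqP v0; rewrite -[v]trmxK v0 trmx0.
Qed.

Lemma kernel_dimension : r = k.+2.
Proof.
have rV : \rank VQ^T = k.
  rewrite mxrank_tr; apply/eqP; change (row_free VQ); apply/row_freeP.
  have lft_ex (j : 'I_k) : exists x, V *m x = (delta_mx j 0 : 'cV[int]_k).
    exact: Vsurj.
  have [lft lftP] := choice lft_ex.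
  exists (map_mx intr (\matrix_(i, j) lft j i 0)); rewrite -map_mxM.
  rewrite (_ : _ *m _ = 1%:M) ?map_mx1//; apply/matrixP => i j.
  have := congr1 (fun w : 'cV[int]_k => w i 0) (lftP j).
  by rewrite !mxE andbT => <-; apply: eq_bigr => l _; rewrite !mxE.
have CV : (CQ^T <= kermx VQ^T)%MS.
  by apply/sub_kermxP; rewrite -trmx_mul -map_mxM mulVC map_mx0 trmx0.
have := mxrank_ker VQ^T; rewrite rV.
have /eqmx_rank -> : (kermx VQ^T == CQ^T)%MS by rewrite rational_kernel CV.
rewrite CQ_rank => /esym; have : (k <= r)%N by rewrite -{1}rV rank_leq_row.
by lia.
Qed.

Lemma real_kernel (R : realType) p (Y : 'M[R]_(r, p)) :
  embedR R V *m Y = 0 -> exists S, Y = embedR R C *m S.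
Proof.
have ratrE a b (M : 'M[int]_(a, b)) : embedR R M = map_mx ratr (map_mx intr M : 'M[rat]_(a, b)).
  by apply/matrixP => i j; rewrite !mxE ratr_int.
move=> VY.
have : (Y^T <= (embedR R C)^T)%MS.
  apply: submx_trans (_ : (kermx (embedR R V)^T <= _)%MS).
    by apply/sub_kermxP; rewrite -trmx_mul VY trmx0.
  rewrite !ratrE !(map_trmx (@ratr R)) -map_kermx map_submx; exact: rational_kernel.
by move=> /submxP[S YS]; exists S^T; rewrite -[Y]trmxK YS trmx_mul trmxK.
Qed.

End RationalKernel.

(** * Volume of the points together with the origin *)

Section HomogenizedConfiguration.
Variables (R : realType) (r k : nat) (V : 'M[int]_(k, r)) (C : 'M[int]_(r, 2)).
Hypothesis Cinj : injective (fun z : 'cV[int]_2 => C *m z).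
Hypothesis Vsurj : forall a : 'cV[int]_k, exists x, V *m x = a.
Hypothesis kerV : forall x, V *m x = 0 <-> saturation C x.

(** Multiplication by this matrix appends the entry that makes the sum zero. It
    turns linear relations between the points into affine relations between the
    points and the origin, which is the last point of [with_origin]. *)
Definition completion_mx : 'M[int]_(r + 1, r) := col_mx 1%:M (- const_mx 1).
Notation X := completion_mx.

Definition completed_gale : 'M[int]_(r + 1, 2) := X *m C.
Notation Cb := completed_gale.
Notation w := (dsubmx Cb).
Notation L := (column_lattice Cb).

Definition with_origin : 'M[int]_(k, r + 1) := row_mx V 0.
Notation Vb := with_origin.

Lemma ones_row (T : nzRingType) : const_mx 1 = row_mx (const_mx 1) 1%:M :> 'M[T]_(1, r + 1).
Proof.
rewrite -row_mx_const; congr row_mx.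
by apply/matrixP => i j; rewrite !ord1 !mxE.
Qed.

Lemma usub_completion p (u : 'M[int]_(r, p)) : usubmx (X *m u) = u.
Proof. by rewrite mul_col_mx mul1mx col_mxKu. Qed.

Lemma homogenized_completion : homogenized Vb *m X = col_mx 0 V.
Proof.
rewrite /homogenized mul_col_mx; congr col_mx.
  by rewrite ones_row mul_row_col mulmx1 mul1mx subrr.
by rewrite mul_row_col mulmx1 mul0mx addr0.
Qed.

Lemma kernel_completion (T : nzRingType) (V' : 'M[T]_(k, r)) (x : 'cV[T]_(r + 1)) :
  (col_mx (const_mx 1) (row_mx V' 0) : 'M[T]_(1 + k, r + 1)) *m x = 0 ->
  x = (col_mx 1%:M (- const_mx 1) : 'M[T]_(r + 1, r)) *m usubmx x /\ V' *m usubmx x = 0.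
Proof.
rewrite mul_col_mx -[0 in RHS]col_mx0 => /eq_col_mx[sx Vx]; split; last first.
  by move: Vx; rewrite -{1}[x]vsubmxK mul_row_col mul0mx addr0.
rewrite mul_col_mx mul1mx -{1}[x]vsubmxK; congr col_mx.
move: sx; rewrite ones_row -{1}[x]vsubmxK mul_row_col mul1mx => /eqP.
by rewrite addrC addr_eq0 mulNmx => /eqP.
Qed.

Lemma embed_homogenized : embedR R (homogenized Vb) =
  col_mx (const_mx 1) (row_mx (embedR R V) 0).
Proof.
rewrite /embedR /homogenized map_col_mx /with_origin map_row_mx map_mx0.
by congr col_mx; apply/matrixP => i j; rewrite !mxE.
Qed.

Lemma completed_ker l : L l -> homogenized Vb *m l = 0.
Proof.
move=> [z _ <-]; rewrite /completed_gale !mulmxA homogenized_completion.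
by rewrite mul_col_mx mul0mx (mulVC kerV) col_mx0 mul0mx.
Qed.

Lemma completed_deg l : L l -> \sum_i l i 0 = 0.
Proof.
move=> /completed_ker; rewrite homogenized_mulmx -col_mx0 => /eq_col_mx[/matrixP/(_ 0 0) + _].
by rewrite !mxE eqxx mulr1n.
Qed.

Lemma completed_lattice u : L (X *m u) <-> column_lattice C u.
Proof.
split=> [[z _ zu]|[z _ <-]]; exists z => //; last by rewrite mulmxA.
by rewrite -[RHS]usub_completion -zu -mulmxA usub_completion.
Qed.

Lemma homogenized_lift (y : 'cV[int]_(1 + k)) : exists x, homogenized Vb *m x = y.
Proof.
have [u uy] := Vsurj (dsubmx y).
exists (col_mx u (usubmx y - const_mx 1 *m u)).
rewrite /homogenized mul_col_mx -[RHS]vsubmxK; congr col_mx; last first.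
  by rewrite mul_row_col mul0mx addr0.
rewrite ones_row.
by rewrite mul_row_col mul1mx subrKC.
Qed.

(** Torsion representatives for the completed lattice come from
    those of the Gale dual, the extra entry being determined. *)
Lemma torsion_data : exists (D : nat) (rho : 'I_D -> 'cV[int]_(r + 1))
    (cls : 'cV[int]_(r + 1) -> 'I_D),
  [/\ forall j, homogenized Vb *m rho j = 0,
      forall i j, L (rho i - rho j) -> i = j,
      forall x, homogenized Vb *m x = 0 -> L (x - rho (cls x)) &
      D = torsion_order L /\
      D = \big[gcdn/0%N]_(i < r) \big[gcdn/0%N]_(j < r) `|det2 (row i C) (row j C)|%N].
Proof.
have [D [rho [rho_sat cover inj DE]]] := saturation_reps Cinj.
have coverX x : homogenized Vb *m x = 0 -> exists j, L (x - X *m rho j).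
  move=> /kernel_completion[xE Vx]; have [j Lj] := cover _ ((kerV _).1 Vx).
  by exists j; rewrite xE -mulmxBr; apply/completed_lattice.
have [j0 _] := coverX 0 (mulmx0 _ _).
have [cls clsP] : {cls : 'cV[int]_(r + 1) -> 'I_D &
    forall x, homogenized Vb *m x = 0 -> L (x - X *m rho (cls x))}.
  apply: (@choice _ _ (fun x j => homogenized Vb *m x = 0 -> L (x - X *m rho j))) => x.
  have [/coverX[j Lj]|?] := pselect (homogenized Vb *m x = 0); first by exists j.
  by exists j0.
have rho_ker j : homogenized Vb *m (X *m rho j) = 0.
  by rewrite mulmxA homogenized_completion mul_col_mx mul0mx (kerV _).2// col_mx0.
have rho_inj i j : L (X *m rho i - X *m rho j) -> i = j.
  by rewrite -mulmxBr => /completed_lattice/inj.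
exists D, (fun j => X *m rho j), cls; split => //; split => //.
rewrite /torsion_order; symmetry; apply: (group_index_reps (rho := fun j => X *m rho j)).
- exact: column_latticeB.
- exact: column_lattice0.
- move=> j /=; have [N N0 LN] := rho_sat j; exists N => //.
  by rewrite -scaler_nat scalemxAr scaler_nat; apply/completed_lattice.
- move=> x /= [N N0 LN]; apply: coverX.
  apply/eqP; have /eqP := completed_ker LN.
  rewrite -scaler_nat -scalemxAr; apply: contraLR => xN0.
  apply: contra xN0 => /eqP/matrixP h; apply/eqP/matrixP => i j.
  have := h i j; rewrite !mxE => /eqP; rewrite mulf_eq0 natz eqz_nat gtn_eqF//=.
  by move=> /eqP.
- exact: rho_inj.
Qed.

Lemma real_kernel_completed (x : 'cV[R]_(r + 1)) :
  embedR R (homogenized Vb) *m x = 0 -> exists s, x = embedR R Cb *m s.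
Proof.
rewrite embed_homogenized => /kernel_completion[xE /(real_kernel kerV)[s sE]].
exists s; rewrite xE sE /completed_gale mulmxA; congr (_ *m _).
rewrite /embedR map_mxM; congr (_ *m _).
by rewrite /completion_mx map_col_mx map_mx1 map_mxN map_const_mx.
Qed.

Section Degree.
Variable F : fieldType.

Lemma lattice_is_hilbert_polynomial :
  exists H, is_hilbert_polynomial (lattice_ideal F L) H.
Proof.
have [H [t0 hH]] := lattice_hilbert_polynomial (column_lattice0 Cb)
  (@column_latticeB _ _ Cb) completed_deg.
exists H; exists t0 => t tt; have [s tr Hs] := hH t tt; exists (size s) => //.
by apply/(hilbert_function_transversal F (column_lattice0 Cb)
  (@column_latticeB _ _ Cb) completed_deg _ tr).
Qed.

(** The Hilbert function and the number of cells meeting a dilate of the polytope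
    count the same classes of monomials, up to the order of the torsion and a bounded
    shift of the degree. The Hilbert polynomial is thus squeezed between two powers,
    which gives its degree and its leading coefficient. *)
Theorem volume_with_origin :
  (torsion_order L)%:R * normalized_volume [set embedR R (col i Vb) | i in setT] =
  ratr (ideal_degree (lattice_ideal F L)).
Proof.
have [D [rho [cls [rho_ker rho_inj clsP [DE _]]]]] := torsion_data.
have [lift liftK] := choice homogenized_lift.
have D0 : (0 < D)%N by case: (D) (cls 0) => // -[].
have LB := @column_latticeB _ _ Cb.
pose Gz : 'M[int]_(r + 1, 1 + k) := \matrix_(i, j) lift (delta_mx j 0) i 0.
have Gz1 : homogenized Vb *m Gz = 1%:M.
  apply/matrixP => i j; have := congr1 (fun a : 'cV[int]_(1 + k) => a i 0) (liftK (delta_mx j 0)).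
  by rewrite !mxE andbT => <-; apply: eq_bigr => l _; rewrite !mxE.
have Gr1 : embedR R (homogenized Vb) *m embedR R Gz = 1%:M.
  by rewrite -embedRM Gz1 /embedR map_mx1.
set S := [set embedR R (col i Vb) | i in setT].
have SE : S = [set embedR R (col i Vb) | i in [set i | predT i]].
  by congr (_ @` _); apply/seteqP.
have noE (i : 'I_(r + 1)) (Q : Prop) : ~~ predT i -> Q by [].
have [c1 low] := transversal_le_volume 0 LB liftK clsP Gr1 (fun i j => @noE i _).
have [||||c2 upp] := volume_le_transversal (R := R) (g := 0) (E := predT) (BE := Cb)
  cls LB completed_ker liftK rho_ker rho_inj _ _ _ _ Gr1 (fun i j => @noE i _).
- by move=> z; exists z.
- by [].
- by move=> x /real_kernel_completed.
- by move=> x; exists 0; first exact: column_lattice0.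
rewrite -SE in low upp.
have trs t : exists s, transversal L (bounded_monomials 0 predT t) s.
  by eexists; apply: (standard_transversal (column_lattice0 Cb) LB completed_deg).
have vfin : lebesgue_cV (conv_hull S) \is a fin_num.
  rewrite ge0_fin_numE; last exact: lebesgue_cV_ge0.
  have [s tr] := trs (1 + c2)%N.
  by apply: le_lt_trans (upp 1%N s _ tr) _; rewrite ?ltry.
pose v := fine (lebesgue_cV (conv_hull S)).
have vE : lebesgue_cV (conv_hull S) = v%:E by rewrite fineK.
rewrite vE in low upp.
have tpos (t c : nat) : (0 < t)%N -> 0 < (t + c)%:R ^+ k :> R.
  by move=> t0; rewrite exprn_gt0// ltr0n addn_gt0 t0.
have Dpos : 0 < D%:R :> R by rewrite ltr0n.
have low' t s : (0 < t)%N -> transversal L (bounded_monomials 0 predT t) s ->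
    (size s)%:R <= (D%:R * v) * (t + c1)%:R ^+ k.
  move=> t0 tr; have := low t s t0 tr; rewrite lee_fin ler_pdivrMr; first by rewrite mulrA [v * _]mulrC.
  by rewrite mulr_gt0// tpos.
have upp' t s : (0 < t)%N -> transversal L (bounded_monomials 0 predT (t + c2)) s ->
    (D%:R * v) * t%:R ^+ k <= (size s)%:R.
  move=> t0 tr; have := upp t s t0 tr; rewrite lee_fin ler_pdivlMr; first by rewrite mulrA [v * _]mulrC.
  by rewrite mulr_gt0// -[t]addn0 tpos.
have v0 : 0 < D%:R * v.
  have [s tr] := trs 1%N; have := low' _ _ (ltn0Sn 0) tr.
  have : (0 < size s)%N.
    have [_ _ _ cov] := tr.
    have [|u us _] := cov (delta_mx (rshift r 0) 0).
      split => // [i|]; first by rewrite mxE; case: (_ && _).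
      rewrite (bigD1 (rshift r 0))//= big1 ?addr0 ?mxE ?eqxx// => i /negbTE ir.
      by rewrite mxE ir.
    by case: (s) us.
  rewrite -(ltr_nat R) => s0 h; have := lt_le_trans s0 h.
  by rewrite pmulr_lgt0// tpos.
rewrite /ideal_degree; set HH := xget _ _.
have /= [t1 HP] : is_hilbert_polynomial (lattice_ideal F L) HH.
  have [H hH] := lattice_is_hilbert_polynomial.
  exact: (@xgetPex _ 0 [set H | is_hilbert_polynomial (lattice_ideal F L) H] (ex_intro _ H hH)).
have HHs t s : (t1 <= t)%N -> transversal L (bounded_monomials 0 predT t) s ->
    (map_poly ratr HH).[t%:R] = (size s)%:R :> R.
  move=> tt tr; have [N hN HN] := HP t tt.
  have /(hilbert_function_transversal F (column_lattice0 Cb) LB completed_deg _ tr) Ns := hN.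
  by rewrite -[t%:R](ratr_nat R) horner_map/= HN ratr_nat Ns.
have [sH lH] : size (map_poly ratr HH : {poly R}) = k.+1 /\ lead_coef (map_poly ratr HH : {poly R}) = D%:R * v.
  apply: (@squeezed_polynomial _ _ _ k c1 c2 t1.+1 v0) => t tt.
    have [s tr] := trs t; rewrite (HHs t s _ tr); last exact: ltnW.
    by apply: low' => //; apply: leq_trans tt.
  have [s tr] := trs (t + c2)%N; rewrite (HHs _ s _ tr); last by rewrite ltnW// ltn_addr.
  by apply: upp' => //; apply: leq_trans tt.
rewrite lead_coef_map in lH; rewrite size_map_poly in sH.
by rewrite sH /= rmorphM/= ratr_nat lH -DE /normalized_volume -/v; ring.
Qed.

End Degree.

End HomogenizedConfiguration.

(** * Counting exponent vectors *)

Section CountingCompositions.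

Lemma leq_pow2r k a b : (a <= b)%N -> (a ^ k <= b ^ k)%N.
Proof. by case: k => [|k] ab; rewrite ?expn0// leq_exp2r. Qed.

Lemma hockey_stick k s : (\sum_(j < s.+1) 'C(j + k, k) = 'C(s + k.+1, k.+1))%N.
Proof.
elim: s => [|s IH]; first by rewrite big_ord1 !add0n !binn.
by rewrite big_ord_recr/= IH [in RHS]addSn binS addSnnS.
Qed.

Lemma size_compositions k s : size (compositions k.+1 s) = 'C(s + k, k).
Proof.
elim: k s => [|k IH] s.
  rewrite -count_predT count_compositionsS bin0 big_ord_recr/= subnn big1 //= => j _.
  by rewrite subn_eq0 leqNgt ltn_ord.
rewrite -count_predT count_compositionsS -hockey_stick (reindex_inj rev_ord_inj).
apply: eq_bigr => j _; rewrite count_predT IH; congr 'C(_ + _, _)%N.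
by move: (ltn_ord j); rewrite /=; lia.
Qed.

Lemma sumn_add_seq u v : size u = size v -> sumn (add_seq u v) = (sumn u + sumn v)%N.
Proof.
by elim: u v => [|a u IH] [|b v] //= [suv]; rewrite [sumn _]IH//; lia.
Qed.

Lemma size_add_seq u v : size u = size v -> size (add_seq u v) = size u.
Proof. by move=> suv; rewrite size_map size_zip suv minnn. Qed.

Lemma add_seq_sub p a : all2 leq p a ->
  add_seq p [seq (x.1 - x.2)%N | x <- zip a p] = a.
Proof.
elim: p a => [|x p IH] [|y a] //= /andP[xy pa].
by rewrite /add_seq/= subnKC//; congr cons; apply: IH.
Qed.

Lemma all2_leq_add p b : size p = size b -> all2 leq p (add_seq p b).
Proof. by elim: p b => [|x p IH] [|y b] //= [spb]; rewrite leq_addr IH. Qed.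

Lemma add_seq_inj p : {in [pred b | size b == size p] &, injective (add_seq p)}.
Proof.
elim: p => [|x p IH] [|y b] [|y' b'] //=; rewrite !inE !eqSS => sb sb' [/addnI -> e].
by congr cons; apply: IH.
Qed.

Lemma count_above p s : (sumn p <= s)%N ->
  count (all2 leq p) (compositions (size p) s) = size (compositions (size p) (s - sumn p)).
Proof.
move=> ps; rewrite -size_filter -(size_map (add_seq p) (compositions _ (s - sumn p))); apply/perm_size/uniq_perm.
- by rewrite filter_uniq// uniq_compositions.
- rewrite map_inj_in_uniq ?uniq_compositions// => a b; rewrite !mem_compositions.
  by move=> /andP[sa _] /andP[sb _]; exact: add_seq_inj.
move=> a; rewrite mem_filter mem_compositions; apply/idP/mapP.
  move=> /and3P[pa /eqP sa /eqP ua]; exists [seq (x.1 - x.2)%N | x <- zip a p].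
    have sb : size [seq (x.1 - x.2)%N | x <- zip a p] = size p.
      by rewrite size_map size_zip sa minnn.
    rewrite mem_compositions sb eqxx/= -ua -{2}(add_seq_sub pa) sumn_add_seq ?sb//.
    by rewrite addKn.
  by rewrite add_seq_sub.
move=> [b]; rewrite mem_compositions => /andP[/eqP sb /eqP ub] ->.
by rewrite all2_leq_add//= size_add_seq// eqxx sumn_add_seq// ub subnKC/=.
Qed.

Lemma ffact_bounds k x : (x ^ k <= (x + k) ^_ k <= (x + k) ^ k)%N.
Proof.
elim: k => [|k /andP[lo hi]]; first by rewrite !expn0 ffactn0.
rewrite addnS ffactSS !expnS; apply/andP; split.
  by rewrite leq_mul// leqW// leq_addr.
by rewrite leq_mul2l/= (leq_trans hi)// leq_pow2r.
Qed.

(** The difference of the two binomials telescopes into [D] binomials of upper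
    index about [s], each a falling factorial of length [k] divided by [k`!]. *)
Lemma compositions_difference k D s : (D <= s)%N ->
  (D * (s - D) ^ k + k`! * 'C(s - D + k.+1, k.+1) <= k`! * 'C(s + k.+1, k.+1) <=
   D * (s + k) ^ k + k`! * 'C(s - D + k.+1, k.+1))%N.
Proof.
elim: D => [|D IH] Ds; first by rewrite !mul0n subn0 leqnn.
have /IH/andP[lo hi] : (D <= s)%N by exact: ltnW.
have sD : (s - D = (s - D.+1).+1)%N by lia.
set x := (s - D.+1)%N in sD *.
have step : (k`! * 'C(s - D + k.+1, k.+1) =
    k`! * 'C(x + k.+1, k.+1) + (x + k.+1) ^_ k)%N.
  by rewrite sD addSn binS mulnDr [in X in (_ + X)%N]mulnC bin_ffact.
rewrite step in lo hi.
have /andP[flo fhi] := ffact_bounds k (x.+1).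
rewrite addSnnS in flo fhi.
have e1 : (x ^ k <= (s - D) ^ k)%N by rewrite sD leq_pow2r.
have e2 : ((x + k.+1) ^ k <= (s + k) ^ k)%N by rewrite leq_pow2r//; lia.
rewrite sD in lo e1; rewrite !mulSn.
have e3 : (D * x ^ k <= D * x.+1 ^ k)%N by rewrite leq_mul2l e1 orbT.
by lia.
Qed.

End CountingCompositions.

(** * Volume of the points without the origin *)

Lemma mx_subE (U : zmodType) m n (M N : 'M[U]_(m, n)) i j : (M - N) i j = M i j - N i j.
Proof. by rewrite !mxE. Qed.

Lemma row2_mul (a : 'rV[int]_2) (y : 'cV[int]_2) :
  (a *m y) 0 0 = a 0 0 * y 0 0 + a 0 1 * y 1 0.
Proof.
rewrite mxE !big_ord_recl big_ord0 addr0.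
by have -> : lift 0 0 = 1 :> 'I_2 by apply: val_inj.
Qed.

Lemma cV2P (y y' : 'cV[int]_2) : y 0 0 = y' 0 0 -> y 1 0 = y' 1 0 -> y = y'.
Proof.
move=> e0 e1; apply/matrixP => i j; rewrite !ord1.
by case: i => [[|[|?]] ?] //; [move: e0 | move: e1]; congr (y _ _ = y' _ _); apply: val_inj.
Qed.

(** Write [w = g (a, b)] with [a] and [b] coprime; then [z = (- b, a)], and [y0]
    holds the Bezout coefficients. *)
Lemma primitive_orthogonal (w : 'rV[int]_2) : w != 0 -> exists (g : nat) (z y0 : 'cV[int]_2),
  [/\ (0 < g)%N, forall c : 'rV[int]_2, (c *m z) 0 0 *+ g = det2 w c,
      w *m z = 0, (w *m y0) 0 0 = g%:Z &
      forall y : 'cV[int]_2, w *m y = 0 -> exists c : int, y = c *: z].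
Proof.
move=> wN0; have [u [v uv]] := Bezoutz (w 0 0) (w 0 1).
set g := gcdz _ _ in uv.
have g0 : g != 0.
  apply: contra wN0; rewrite gcdz_eq0 => /andP[/eqP w00 /eqP w01].
  apply/eqP/matrixP => i j; rewrite ord1 [RHS]mxE.
  by case: j => [[|[|?]] ?] //; [rewrite -[RHS]w00 | rewrite -[RHS]w01]; congr (w _ _); apply: val_inj.
have [a aE] : exists a, w 0 0 = a * g by apply/dvdzP/dvdz_gcdl.
have [b bE] : exists b, w 0 1 = b * g by apply/dvdzP/dvdz_gcdr.
have g_ge0 : 0 <= g by [].
clearbody g.
have ab1 : u * a + v * b = 1.
  by apply: (mulIf g0); rewrite mul1r mulrDl -!mulrA -aE -bE.
have gE : g = `|g|%N by rewrite gez0_abs.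
exists `|g|%N, (\col_i (if i == 0 then - b else a)), (\col_i (if i == 0 then u else v)).
split.
- by rewrite absz_gt0.
- move=> c; rewrite row2_mul det2E !mxE/= aE bE -mulr_natr natz.
  by rewrite -gE; ring.
- by apply/matrixP => i j; rewrite !ord1 row2_mul !mxE/= aE bE; ring.
- by rewrite row2_mul !mxE/= -gE -uv; ring.
move=> y wy.
have h : a * y 0 0 + b * y 1 0 = 0.
  apply: (mulIf g0); have := row2_mul w y; rewrite wy mxE aE bE mul0r => ->; ring.
exists (u * y 1 0 - v * y 0 0); apply: cV2P; rewrite !mxE/=.
  transitivity ((u * a + v * b) * y 0 0 - u * (a * y 0 0 + b * y 1 0)); last ring.
  by rewrite ab1 h; ring.
transitivity ((u * a + v * b) * y 1 0 - v * (a * y 0 0 + b * y 1 0)); last ring.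
by rewrite ab1 h; ring.
Qed.

Section PolytopeVolume.
Variables (R : realType) (r k : nat) (V : 'M[int]_(k, r)) (C : 'M[int]_(r, 2)).
Hypothesis Cinj : injective (fun z : 'cV[int]_2 => C *m z).
Hypothesis Vsurj : forall a : 'cV[int]_k, exists x, V *m x = a.
Hypothesis kerV : forall x, V *m x = 0 <-> saturation C x.

Notation X := (completion_mx r).
Notation Cb := (completed_gale C).
Notation L := (column_lattice Cb).
Notation Vb := (with_origin V).
Let w : 'rV[int]_2 := dsubmx Cb.
Let base : pred 'I_(r + 1) := fun i => (i < r)%N.

Lemma off_base (i : 'I_(r + 1)) : ~~ base i -> i = rshift r 0.
Proof. by rewrite /base -leqNgt => ri; apply: val_inj => /=; have := ltn_ord i; lia. Qed.

Lemma balancing_rowE : w = - const_mx 1 *m C.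
Proof. by rewrite /w /completed_gale mul_col_mx col_mxKd. Qed.

Let S : set 'cV[R]_k := [set embedR R (col i V) | i in setT].

Lemma base_points : S = [set embedR R (col i Vb) | i in [set i | base i]].
Proof.
have colE (i : 'I_r) : col (lshift 1 i) Vb = col i V.
  by apply/matrixP => a b; rewrite !mxE (unsplitK (inl i)).
apply/seteqP; split => x [i /= Ei <-].
  by exists (lshift 1 i); rewrite /= ?colE// /base /= ltn_ord.
exists (Ordinal Ei) => //; rewrite -colE; congr (embedR R (col _ _)).
exact: val_inj.
Qed.

(** When the balancing row vanishes the points lie on an affine hyperplane: the
    all-one row is then orthogonal to the kernel of [V], hence in its row space. *)
Lemma flat_volume : w = 0 -> normalized_volume S = 0.
Proof.
move=> w0.
have [T TE] : exists T, cokermx (embedR R V) = embedR R C *m T.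
  by apply: (real_kernel kerV); exact: mulmx_coker.
have : (const_mx 1 : 'rV[R]_r) *m cokermx (embedR R V) = 0.
  rewrite TE mulmxA; have := balancing_rowE; rewrite w0 mulNmx => /esym/eqP.
  rewrite oppr_eq0 => /eqP/(congr1 (embedR R)); rewrite embedRM.
  have -> : embedR R (const_mx 1 : 'rV[int]_r) = const_mx 1.
    by apply/matrixP => i j; rewrite !mxE.
  by move=> ->; rewrite /embedR map_mx0 mul0mx.
move=> /eqP; rewrite -submxE => /submxP[h hV].
have rpos : (0 < r)%N by rewrite (kernel_dimension Cinj Vsurj kerV).
have h0 : h != 0.
  apply/eqP => h0; move: hV; rewrite h0 mul0mx => /matrixP/(_ 0 (Ordinal rpos)).
  by rewrite !mxE => /eqP; rewrite oner_eq0.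
suff v0 : lebesgue_cV (conv_hull S) = 0%E by rewrite /normalized_volume v0 /= mulr0.
apply/eqP; rewrite eq_le lebesgue_cV_ge0 andbT -[leRHS](lebesgue_cV_hyperplane 1 h0).
apply: lebesgue_cV_mono => x.
have -> : S = [set embedR R (col i V) | i in [set i | predT i]].
  by congr (_ @` _); apply/seteqP.
move=> /conv_hullP[lam [_ _ lam1 ->]] /=.
rewrite mulmx_sumr summxE -lam1; apply: eq_bigr => i _.
rewrite -scalemxAr mxE /embedR map_col colE mulmxA -/(embedR R V) -hV -colE !mxE mulr1.
by [].
Qed.

Section Nondegenerate.
Hypothesis wN0 : w != 0.

(** The real right inverse of the homogenized points exists because a row
    vanishing on them would have to be orthogonal to [C], so that its constant
    part would kill [w]. *)
Lemma base_right_inverse : exists2 Gam : 'M[R]_(r + 1, 1 + k),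
  embedR R (homogenized Vb) *m Gam = 1%:M & forall i j, ~~ base i -> Gam i j = 0.
Proof.
have [lft lftP] := choice Vsurj.
pose G : 'M[int]_(r, k) := \matrix_(i, j) lft (delta_mx j 0) i 0.
have VG : V *m G = 1%:M.
  apply/matrixP => i j; have := congr1 (fun a : 'cV[int]_k => a i 0) (lftP (delta_mx j 0)).
  by rewrite !mxE andbT => <-; apply: eq_bigr => l _; rewrite !mxE.
have ones : embedR R (const_mx 1 : 'rV[int]_r) = const_mx 1.
  by apply/matrixP => i j; rewrite !mxE.
have : row_free (col_mx (const_mx 1 : 'rV[R]_r) (embedR R V)).
  apply: inj_row_free => x; rewrite -[x]hsubmxK mul_row_col => xV.
  have x1 : lsubmx x = 0.
    have := congr1 (mulmx^~ (embedR R C)) xV.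
    rewrite mulmxDl -!mulmxA -embedRM (mulVC kerV) {2}/embedR map_mx0 mulmx0 addr0 mul0mx.
    rewrite -ones -embedRM (_ : const_mx 1 *m C = - w); last by rewrite balancing_rowE mulNmx opprK.
    rewrite [lsubmx x]mx11_scalar mul_scalar_mx => /eqP; rewrite scaler_eq0 => /orP[/eqP ->|].
      exact: raddf0.
    move=> /eqP/matrixP h; case/negP: wN0; apply/eqP/matrixP => i j.
    have := h i j; rewrite [LHS]mxE [RHS]mxE => /eqP; rewrite intr_eq0 [(- w) _ _]mxE.
    by rewrite oppr_eq0 => /eqP ->; rewrite mxE.
  move: xV; rewrite x1 mul0mx add0r => /(congr1 (mulmx^~ (embedR R G))).
  by rewrite -mulmxA -embedRM VG /embedR map_mx1 mulmx1 mul0mx => ->; rewrite row_mx0.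
move=> /row_freeP[G' G'1]; exists (col_mx G' 0).
  by rewrite embed_homogenized mul_col_mx ones_row !mul_row_col !mulmx0 !addr0 -mul_col_mx.
by move=> i j /off_base ->; rewrite col_mxEd mxE.
Qed.

(** Normal forms modulo the completed lattice: those of its vectors that vanish
    on the last entry are the multiples of one vector [ell], and subtracting
    [ell] as long as possible leaves a vector not above its positive part. *)
Section Transversal.
Variables (g : nat) (z y0 : 'cV[int]_2).
Hypothesis g_gt0 : (0 < g)%N.
Hypothesis z_det : forall c : 'rV[int]_2, (c *m z) 0 0 *+ g = det2 w c.
Hypothesis wz : w *m z = 0.
Hypothesis wy0 : (w *m y0) 0 0 = g%:Z.
Hypothesis z_span : forall y : 'cV[int]_2, w *m y = 0 -> exists c : int, y = c *: z.

Let ell : 'cV[int]_r := C *m z.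
Let positive : seq nat := vec_seq (\col_i Num.max (ell i 0) 0 : 'cV[int]_r).
Let D := sumn positive.

Definition normal_forms (t : nat) : seq 'cV[int]_(r + 1) :=
  [seq col_mx (seq_vec r a) (j%:Z)%:M | j <- iota 0 g,
     a <- [seq a <- compositions r (t - j) | ~~ all2 leq positive a]].

Lemma size_positive : size positive = r. Proof. exact: size_vec_seq. Qed.

Lemma nth_positive (i : 'I_r) : (nth 0%N positive i)%:Z = Num.max (ell i 0) 0.
Proof.
have := vec_seqK (u := \col_i Num.max (ell i 0) 0); rewrite -/positive => e.
have /matrixP/(_ i 0) : seq_vec r positive = \col_i Num.max (ell i 0) 0.
  by apply: e => l; rewrite mxE le_max lexx orbT.
by rewrite !mxE.
Qed.

Lemma above_positive a : size a = r ->
  reflect (forall i : 'I_r, ell i 0 <= (nth 0%N a i)%:Z) (all2 leq positive a).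
Proof.
move=> sa; rewrite all2E size_positive sa eqxx/=.
apply: (iffP (all_nthP (0%N, 0%N))) => [h i|h i].
  have := h i; rewrite size_zip size_positive sa minnn ltn_ord => /(_ isT).
  rewrite nth_zip ?size_positive//= -lez_nat nth_positive; apply: le_trans.
  by rewrite le_max lexx.
rewrite size_zip size_positive sa minnn => ir.
rewrite nth_zip ?size_positive//= -lez_nat (nth_positive (Ordinal ir)) ge_max.
by rewrite (h (Ordinal ir)).
Qed.

Lemma ell_sum : \sum_i ell i 0 = 0.
Proof.
have := congr1 (fun a : 'M[int]_1 => a 0 0) wz; rewrite balancing_rowE -mulmxA mulNmx !mxE.
move=> /eqP; rewrite oppr_eq0 => /eqP e; rewrite -[RHS]e.
by apply: eq_bigr => i _; rewrite [const_mx _ _ _]mxE mul1r.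
Qed.

Lemma w_mul (y : 'cV[int]_2) :
  (w *m y) 0 0 = ((\row_i (if i == 0 then - y 1 0 else y 0 0)) *m z) 0 0 *+ g.
Proof. by rewrite z_det row2_mul det2E !mxE/=; ring. Qed.

Lemma ell_neq0 : ell != 0.
Proof.
apply/eqP; rewrite /ell -[RHS](mulmx0 _ C) => /Cinj z0.
by have := w_mul y0; rewrite wy0 z0 mulmx0 mxE mul0rn => -[g0]; move: g_gt0; rewrite g0.
Qed.

Lemma ell_has_pos : exists i, 0 < ell i 0.
Proof.
apply/not_existsP => h; case/negP: ell_neq0; apply/eqP/matrixP => i j; rewrite ord1 [RHS]mxE.
have h' l : 0 <= - ell l 0 by rewrite oppr_ge0 leNgt; apply/negP/h.
have /eqP : \sum_i - ell i 0 = 0 by rewrite sumrN ell_sum oppr0.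
by rewrite psumr_eq0// => /allP/(_ i (mem_index_enum _)); rewrite oppr_eq0 => /eqP.
Qed.

Lemma ell_in_L (c : int) : L (col_mx (c *: ell) (0 : 'cV[int]_1)).
Proof.
exists (c *: z) => //; rewrite -scalemxAr -[Cb]vsubmxK mul_col_mx -/w wz scale_col_mx scaler0.
by rewrite /completed_gale usub_completion.
Qed.

Lemma L_last_zero x : L x -> x (rshift r 0) 0 = 0 -> exists c : int, usubmx x = c *: ell.
Proof.
move=> [y _ <-]; have -> : (Cb *m y) (rshift r 0) 0 = (w *m y) 0 0.
  by rewrite -[Cb in LHS]vsubmxK mul_col_mx col_mxEd.
move=> wy; have [|c ->] := z_span (y := y).
  by apply/matrixP => i j; rewrite !ord1 wy mxE.
exists c; rewrite -mulmxA usub_completion /ell -scalemxAr; congr (_ *: _).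
Qed.

Lemma last_entryE (y : 'cV[int]_2) : (Cb *m y) (rshift r 0) 0 = (w *m y) 0 0.
Proof. by rewrite -[Cb in LHS]vsubmxK mul_col_mx col_mxEd. Qed.

Lemma L_last_dvd x : L x -> (g%:Z %| (x (rshift r 0) 0)%R)%Z.
Proof. by move=> [y _ <-]; rewrite last_entryE w_mul -mulr_natr natz dvdz_mull. Qed.

Lemma base_box x : exists2 l, L l & forall i, ~~ base i -> 0 <= (x - l) i 0 < g%:Z.
Proof.
exists (Cb *m ((x (rshift r 0%R) 0%R %/ g%:Z)%Z *: y0)); first by eexists.
move=> i /off_base ->; rewrite mx_subE -scalemxAr [X in _ - X]mxE last_entryE wy0.
rewrite {1 3}(divz_eq (x (rshift r 0) 0) g%:Z) addrAC subrr add0r.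
by rewrite modz_ge0 ?ltz_mod// eqz_nat gtn_eqF.
Qed.

(** Subtracting [ell] from a vector above [positive] keeps it nonnegative and
    lowers the entry [i0], where [ell] is positive, so the process stops. *)
Lemma reduce_above a : size a = r -> exists b (c : int),
  [/\ size b = r, sumn b = sumn a, ~~ all2 leq positive b & seq_vec r a - seq_vec r b = c *: ell].
Proof.
have [i0 pi0] := ell_has_pos.
have [n] := ubnPleq (nth 0%N a i0); elim: n a => [|n IH] a an sa.
  exists a, 0; split => //; last by rewrite subrr scale0r.
  apply/negP => /(above_positive sa)/(_ i0); lia.
have [/(above_positive sa) ab|ab] := boolP (all2 leq positive a); last first.
  by exists a, 0; split => //; rewrite subrr scale0r.
have a10 i : 0 <= (seq_vec r a - ell) i 0 by rewrite mx_subE [seq_vec _ _ _ _]mxE subr_ge0; exact: ab.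
have a1E := vec_seqK a10.
have [||b [c [sb ub bp bc]]] := IH (vec_seq (seq_vec r a - ell)).
- have := congr1 (fun u : 'cV[int]_r => u i0 0) a1E; rewrite [LHS]mxE mx_subE [seq_vec _ _ _ _]mxE.
  move=> e; rewrite -lez_nat e lerBlDr (le_trans (_ : _ <= n.+1%:Z)) ?lez_nat//.
  by move: pi0; move: (ell i0 0) => x; lia.
- exact: size_vec_seq.
exists b, (c + 1); split => //.
  rewrite ub; apply/eqP; rewrite -eqz_nat -!(sum_seq_vec (m := r)) ?size_vec_seq// a1E.
  under eq_bigr do rewrite mx_subE.
  by rewrite sumrB ell_sum subr0.
by rewrite scalerDl scale1r -bc a1E addrAC subrK.
Qed.

Lemma normal_formsP t u : reflect (exists j a, [/\ (j < g)%N, a \in compositions r (t - j),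
    ~~ all2 leq positive a & u = col_mx (seq_vec r a) (j%:Z)%:M]) (u \in normal_forms t).
Proof.
apply: (iffP allpairsPdep) => [[j [a []]]|[j [a [jg aC ap ->]]]].
  rewrite mem_iota add0n mem_filter => jg /andP[ap aC] ->.
  by exists j, a.
by exists j, a; split => //; rewrite ?mem_iota// mem_filter ap.
Qed.

(** The last entry of a lattice vector is a multiple of [g], so it determines the
    layer; within a layer two congruent vectors differ by a multiple of [ell], and
    the one with the larger coefficient is above [positive]. *)
Lemma normal_forms_transversal t : (g <= t)%N ->
  transversal L (bounded_monomials g base t) (normal_forms t).
Proof.
move=> gt.
have lastE (x : 'cV[int]_r) (j : nat) : col_mx x (j%:Z)%:M (rshift r 0) (0 : 'I_1) = j%:Z.
  by rewrite col_mxEd mxE.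
split.
- apply: allpairs_uniq_dep; rewrite ?iota_uniq//.
    by move=> j _; rewrite filter_uniq// uniq_compositions.
  move=> _ _ /allpairsPdep[j [a [_ + ->]]] /allpairsPdep[j' [a' [_ + ->]]] /=.
  rewrite !mem_filter !mem_compositions => /and3P[_ /eqP sa _] /and3P[_ /eqP sa' _].
  move=> /eq_col_mx[/(seq_vec_inj sa sa') ->] /matrixP/(_ 0 0); rewrite !mxE !mulr1n => -[->].
  by [].
- move=> u /normal_formsP[j [a [jg aC _ ->]]].
  move: aC; rewrite mem_compositions => /andP[/eqP sa /eqP ua]; split.
  + move=> i; case: (splitP i) => l il.
      have -> : i = lshift 1 l by apply: val_inj.
      by rewrite col_mxEu mxE.
    have -> : i = rshift r 0 by apply: val_inj; rewrite /= il ord1.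
    by rewrite lastE.
  + by move=> i /off_base ->; rewrite lastE ltz_nat.
  + rewrite big_split_ord/= big_ord1 lastE.
    under eq_bigr do rewrite col_mxEu.
    by rewrite sum_seq_vec// ua -PoszD subnK// (leq_trans (ltnW jg)).
- move=> u v /normal_formsP[j [a [jg aC ap ->]]] /normal_formsP[j' [a' [jg' aC' ap' ->]]] Luv.
  have jj : j = j'.
    have := L_last_dvd Luv; rewrite mx_subE !lastE dvdzE /= => /dvdnP[[|c] hc].
      by rewrite mul0n in hc; lia.
    have {hc} : (g <= `|j%:Z - j'%:Z|)%N by rewrite hc leq_pmull.
    by clear -jg jg'; lia.
  rewrite jj in aC Luv *; congr col_mx.
  have [|c hc] := L_last_zero Luv.
    by rewrite mx_subE !lastE subrr.
  rewrite opp_col_mx add_col_mx col_mxKu in hc.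
  move: aC aC'; rewrite !mem_compositions => /andP[/eqP sa _] /andP[/eqP sa' _].
  have hci (i : 'I_r) : (nth 0%N a i)%:Z - (nth 0%N a' i)%:Z = c * ell i 0.
    by have := congr1 (fun x : 'cV[int]_r => x i 0) hc; rewrite mx_subE [RHS]mxE ![seq_vec _ _ _ _]mxE.
  have [c0|c0|c0] := ltrgtP c 0; last by move: hc; rewrite c0 scale0r => /eqP; rewrite subr_eq0 => /eqP.
    case/negP: ap'; apply/(above_positive sa') => i; have := hci i; nia.
  by case/negP: ap; apply/(above_positive sa) => i; have := hci i; nia.
move=> u [u0 ug ut].
have [j jE] : exists j : nat, u (rshift r 0) 0 = j%:Z by exists `|u (rshift r 0%R) 0%R|%N; rewrite gez0_abs.
have jg : (j < g)%N.
  by rewrite -ltz_nat -jE; apply: ug; rewrite /base /= addn0 ltnn.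
have uu0 i : 0 <= (usubmx u) i 0 by rewrite mxE.
have uuE := vec_seqK uu0.
have [b [c [sb ub bp bc]]] := reduce_above (size_vec_seq (usubmx u)).
exists (col_mx (seq_vec r b) (j%:Z)%:M).
  apply/normal_formsP; exists j, b; split => //; rewrite mem_compositions sb eqxx/= ub.
  rewrite -eqz_nat -(sum_seq_vec (m := r)) ?size_vec_seq// uuE.
  rewrite -subzn ?(leq_trans (ltnW jg))// -ut big_split_ord/= big_ord1 jE addrK.
  by apply/eqP/eq_bigr => i _; rewrite mxE.
rewrite -[u]vsubmxK opp_col_mx add_col_mx -uuE bc.
have -> : dsubmx u - (j%:Z)%:M = 0.
  by apply/matrixP => i l; rewrite !ord1 !mxE jE eqxx mulr1n subrr.
exact: ell_in_L.
Qed.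

(** A layer consists of the compositions that do not dominate [positive],
    and those dominating it are a translate of the compositions of a number
    smaller by [D]. *)
Lemma normal_forms_size t : (g + D <= t)%N ->
  (g * D * (t - (g + D)) ^ k <= k`! * size (normal_forms t) <= g * D * (t + k) ^ k)%N.
Proof.
move=> gDt; have rk := kernel_dimension Cinj Vsurj kerV.
have sizeE : (k`! * size (normal_forms t) = \sum_(j < g)
    k`! * size [seq a <- compositions r (t - j) | ~~ all2 leq positive a])%N.
  rewrite size_allpairs_dep sumnE big_map.
  have -> : iota 0 g = index_iota 0 g by rewrite /index_iota subn0.
  rewrite big_mkord.
  by rewrite big_distrr.
have bound (j : 'I_g) : (D * (t - (g + D)) ^ k <=
    k`! * size [seq a <- compositions r (t - j) | ~~ all2 leq positive a] <= D * (t + k) ^ k)%N.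
  have Dtj : (D <= t - j)%N by move: (ltn_ord j); lia.
  have := count_above (p := positive) Dtj; rewrite size_positive -/D => cnt.
  have cs := count_predC (all2 leq positive) (compositions r (t - j)).
  rewrite cnt rk !size_compositions -rk in cs.
  have /andP[lo hi] := compositions_difference k Dtj.
  rewrite size_filter -[count _ _]/(count (predC (all2 leq positive)) _).
  rewrite -cs mulnDr in lo hi.
  have e1 : ((t - (g + D)) ^ k <= (t - j - D) ^ k)%N by apply: leq_pow2r; move: (ltn_ord j); lia.
  have e2 : ((t - j + k) ^ k <= (t + k) ^ k)%N by apply: leq_pow2r; lia.
  have e3 : (D * (t - (g + D)) ^ k <= D * (t - j - D) ^ k)%N by rewrite leq_mul2l e1 orbT.
  have e4 : (D * (t - j + k) ^ k <= D * (t + k) ^ k)%N by rewrite leq_mul2l e2 orbT.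
  by apply/andP; split; lia.
have sc (c : nat) : (g * D * c = \sum_(j < g) D * c)%N by rewrite sum_nat_const card_ord mulnA.
rewrite sizeE !sc; apply/andP; split; apply: leq_sum => j _; by case/andP: (bound j).
Qed.

Lemma weighted_degree :
  \sum_(j < r | 0 < det2 w (row j C)) det2 w (row j C) = (g * D)%N%:Z.
Proof.
have e (j : 'I_r) : det2 w (row j C) = ell j 0 *+ g.
  by rewrite -z_det -row_mul mxE.
rewrite PoszM /D sumnE (big_nth 0%N) big_mkord size_positive.
rewrite (big_morph Posz PoszD (erefl _)) mulr_sumr big_mkcond; apply: eq_bigr => j _.
rewrite nth_positive e pmulrn_lgt0// -mulr_natl natz.
rewrite /Num.max; case: ltrgtP => //= h; first by rewrite mulr0.
by first [rewrite -h mulr0 | rewrite h mulr0].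
Qed.

(** The determinant of [y0] and [z] is 1 and that of [s] and [z] is 0, so the
    coefficient of [s] along [z] is the determinant of [y0] and [s]. *)
Lemma real_orthogonal (s : 'cV[R]_2) : embedR R w *m s = 0 ->
  exists t : 'cV[R]_1, s = embedR R z *m t.
Proof.
have z0E : z 0 0 * g%:Z = - w 0 1.
  have := z_det (\row_i (if i == 0 then 1 else 0)).
  by rewrite row2_mul det2E -mulr_natr natz ![(\row__ _) _ _]mxE/=; lia.
have z1E : z 1 0 * g%:Z = w 0 0.
  have := z_det (\row_i (if i == 0 then 0 else 1)).
  by rewrite row2_mul det2E -mulr_natr natz ![(\row__ _) _ _]mxE/=; lia.
have gR : g%:R != 0 :> R by rewrite pnatr_eq0 -lt0n.
have zy : (z 1 0)%:~R * (y0 0 0)%:~R - (z 0 0)%:~R * (y0 1 0)%:~R = 1 :> R.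
  apply: (mulIf gR); have := congr1 (intmul (1 : R)) wy0.
  rewrite row2_mul -z1E (_ : w 0 1 = - (z 0 0 * g%:Z)); last by rewrite z0E opprK.
  by rewrite intrD !intrM intrN intrM -pmulrn mul1r => e; rewrite -[RHS]e; ring.
move=> /matrixP/(_ 0 0); rewrite mxE !big_ord_recl big_ord0 addr0.
have -> : lift 0 0 = 1 :> 'I_2 by apply: val_inj.
rewrite ![embedR _ _ _ _]mxE [RHS]mxE -z1E (_ : w 0 1 = - (z 0 0 * g%:Z)); last by rewrite z0E opprK.
rewrite !intrM intrN intrM -pmulrn => ws.
have {}ws : (z 1 0)%:~R * s 0 0 = (z 0 0)%:~R * s 1 0.
  by apply: (mulIf gR); apply/eqP; rewrite -subr_eq0; apply/eqP; rewrite -ws; ring.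
exists (const_mx ((y0 0 0)%:~R * s 1 0 - (y0 1 0)%:~R * s 0 0)).
have e (i : 'I_2) : s i 0 = (z i 0)%:~R * ((y0 0 0)%:~R * s 1 0 - (y0 1 0)%:~R * s 0 0).
  have [->|->] : i = 0 \/ i = 1.
      by case: i => [[|[|?]] ?] //; [left|right]; apply: val_inj.
    transitivity (((z 1 0)%:~R * (y0 0 0)%:~R - (z 0 0)%:~R * (y0 1 0)%:~R) * s 0 0); first by rewrite zy mul1r.
    transitivity ((y0 0 0)%:~R * ((z 1 0)%:~R * s 0 0) - (z 0 0)%:~R * (y0 1 0)%:~R * s 0 0).
      by ring.
    by rewrite ws; ring.
  transitivity (((z 1 0)%:~R * (y0 0 0)%:~R - (z 0 0)%:~R * (y0 1 0)%:~R) * s 1 0); first by rewrite zy mul1r.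
  transitivity ((z 1 0)%:~R * (y0 0 0)%:~R * s 1 0 - (y0 1 0)%:~R * ((z 0 0)%:~R * s 1 0)).
    by ring.
  by rewrite -ws; ring.
by apply/matrixP => i j; rewrite ord1 e !mxE big_ord1 !mxE.
Qed.

(** The size of the explicit transversal is [g D t ^ k / k`!] up to lower order
    terms, and the counting lemmas compare it with the volume. *)
Lemma nondegenerate_volume :
  (torsion_order L)%:R * normalized_volume S = (g * D)%:R :> R.
Proof.
have [T [rho [cls [rho_ker rho_inj clsP [TE _]]]]] := torsion_data Cinj kerV.
have [lift liftK] := choice (homogenized_lift Vsurj).
have T0 : (0 < T)%N by case: (T) (cls 0) => // -[].
have LB := @column_latticeB _ _ Cb.
have [Gam Gam1 Gam_supp] := base_right_inverse.
have [c1 low] := transversal_le_volume g (E := base) LB liftK clsP Gam1 Gam_supp.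
have [||||c2 upp] := volume_le_transversal (R := R) (g := g) (E := base) (BE := Cb *m z)
  cls LB (completed_ker kerV) liftK rho_ker rho_inj _ _ _ _ Gam1 Gam_supp.
- by move=> y; exists (z *m y); rewrite // mulmxA.
- move=> i j /off_base ->; rewrite -[Cb]vsubmxK mul_col_mx -/w wz col_mxEd.
  by rewrite mxE.
- move=> x /(real_kernel_completed kerV)[s ->] xlast.
  have [|t ->] := @real_orthogonal s; last by exists t; rewrite embedRM mulmxA.
  have := xlast (rshift r 0); rewrite /base /= addn0 ltnn => /(_ isT).
  rewrite -[Cb]vsubmxK {1}/embedR map_col_mx mul_col_mx col_mxEd => h.
  by apply/matrixP => i j; rewrite !ord1 [RHS]mxE -h.
- exact: base_box.
rewrite -base_points in low upp.
have tr t : (g <= t)%N -> transversal L (bounded_monomials g base t) (normal_forms t) :=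
  @normal_forms_transversal t.
have vfin : lebesgue_cV (conv_hull S) \is a fin_num.
  rewrite ge0_fin_numE; last exact: lebesgue_cV_ge0.
  apply: le_lt_trans (upp g.+1 _ _ (tr _ _)) _; rewrite ?ltry//.
  by rewrite addSn leqW// leq_addr.
pose v := fine (lebesgue_cV (conv_hull S)).
have vE : lebesgue_cV (conv_hull S) = v%:E by rewrite fineK.
rewrite vE in low upp.
have Tpos : 0 < T%:R :> R by rewrite ltr0n.
have tpos (t c : nat) : (0 < t)%N -> 0 < (t + c)%:R ^+ k :> R.
  by move=> t0; rewrite exprn_gt0// ltr0n addn_gt0 t0.
have size_le t : (g + D <= t)%N ->
    k`!%:R * (size (normal_forms t))%:R <= (g * D)%:R * (t + k)%:R ^+ k :> R.
  by move=> /normal_forms_size/andP[_]; rewrite -(ler_nat R) !natrM !natrX.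
have size_ge t : (g + D <= t)%N ->
    (g * D)%:R * (t - (g + D))%:R ^+ k <= k`!%:R * (size (normal_forms t))%:R :> R.
  by move=> /normal_forms_size/andP[+ _]; rewrite -(ler_nat R) !natrM !natrX.
have fpos : 0 < k`!%:R :> R by rewrite ltr0n fact_gt0.
suff -> : (g * D)%:R = k`!%:R * (T%:R * v) :> R.
  by rewrite /normalized_volume -/v -TE; ring.
apply/eqP; rewrite eq_le; apply/andP; split.
  apply: (@power_comparison _ _ _ (g + D + c1) k 1) => t t1.
  have := low (t + (g + D))%N (normal_forms (t + (g + D))).
  rewrite addn_gt0 t1 => /(_ isT) h.
  have /h : transversal L (bounded_monomials g base (t + (g + D))) (normal_forms (t + (g + D))).
    by apply: tr; lia.
  rewrite lee_fin ler_pdivrMr; last by rewrite mulr_gt0// -addnA tpos.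
  have := size_ge (t + (g + D))%N (leq_addl _ _); rewrite addnK -addnA => h1 h2.
  apply: le_trans h1 _; rewrite -mulrA ler_pM2l//.
  by rewrite [T%:R * v]mulrC -mulrA.
apply: (@power_comparison _ _ _ (c2 + k) k (g + D).+1) => t tgD.
have t0 : (0 < t)%N by apply: leq_trans tgD.
have /(upp _ _ t0) : transversal L (bounded_monomials g base (t + c2)) (normal_forms (t + c2)).
  by apply: tr; lia.
rewrite lee_fin ler_pdivlMr; last by rewrite mulr_gt0// -[t]addn0 tpos.
have gDt : (g + D <= t + c2)%N by lia.
have := size_le _ gDt; rewrite -addnA => h1 h2.
apply: le_trans h1; rewrite -mulrA ler_pM2l//.
by rewrite [T%:R * v]mulrC -mulrA.
Qed.

End Transversal.

End Nondegenerate.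

Theorem volume_of_points : (torsion_order L)%:R * normalized_volume S =
  (\sum_(j < r | 0 < det2 w (row j C)) det2 w (row j C))%:~R :> R.
Proof.
have [w0|wN0] := eqVneq w 0.
  rewrite flat_volume// mulr0 big1 // => j.
  by rewrite w0 det2E ![(0 : 'rV__) _ _]mxE !mul0r subrr ltxx.
have [g [z [y0 [g0 z_det wz wy0 z_span]]]] := primitive_orthogonal wN0.
rewrite (weighted_degree g0 z_det) (nondegenerate_volume wN0 g0 z_det wz wy0 z_span).
by rewrite pmulrn.
Qed.

End PolytopeVolume.

(** * From the face of the polytope to its Gale dual *)

Section RowSelection.
Variables (T : comNzRingType) (n : nat) (I : {set 'I_n}).

Definition mask_off (y : 'cV[T]_n) : 'cV[T]_n := \col_i (if i \in I then 0 else y i 0).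

Definition extend_by_zero (x : 'cV[T]_#|I|) : 'cV[T]_n :=
  \col_i \sum_j (if enum_val j == i then x j 0 else 0).

Lemma rowsub_extend x : rowsub enum_val (extend_by_zero x) = x.
Proof.
apply/matrixP => i j; rewrite ord1 !mxE (bigD1 i)//= eqxx big1 ?addr0// => l li.
by rewrite (inj_eq enum_val_inj) (negbTE li).
Qed.

Lemma mask_extend x : mask_off (extend_by_zero x) = 0.
Proof.
apply/matrixP => i j; rewrite ord1 !mxE; case: ifPn => // iI.
by rewrite big1// => l _; case: eqP => // li; rewrite -li enum_valP in iI.
Qed.

Lemma mulmx_split m (M : 'M[T]_(m, n)) y :
  M *m y = colsub enum_val M *m rowsub (enum_val : 'I_#|I| -> _) y + M *m mask_off y.
Proof.
apply/matrixP => a b; rewrite ord1 [LHS]mxE [RHS]mxE (bigID (mem I))/= [X in _ = X + _]mxE [X in _ = _ + X]mxE; congr (_ + _).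
  by rewrite big_enum_val; apply: eq_bigr => i _; rewrite !mxE.
rewrite [RHS](bigID (mem I))/= [X in _ = X + _]big1 ?add0r => [|i iI]; last by rewrite mxE iI mulr0.
by apply: eq_bigr => i /negbTE iI; rewrite !mxE iI.
Qed.

Lemma mulmx_mask m (M : 'M[T]_(m, n)) y :
  M *m mask_off y = \sum_(i | i \notin I) y i 0 *: col i M.
Proof.
apply/matrixP => a b; rewrite ord1 mxE summxE [RHS]big_mkcond/=; apply: eq_bigr => i _.
by rewrite !mxE; case: (i \in I); rewrite /= ?mulr0 ?mxE// mulrC.
Qed.

Lemma mask_offN y : mask_off (- y) = - mask_off y.
Proof. by apply/matrixP => i j; rewrite !mxE; case: ifP; rewrite ?oppr0. Qed.

End RowSelection.

Section FaceOfPolytope.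
Variables (R : realType) (d : nat) (A : 'M[int]_(d, d.+2)) (B : 'M[int]_(d.+2, 2)).
Variable beta : set 'cV[R]_d.
Hypothesis ones_rowspace :
  ((const_mx 1 : 'rV[rat]_d.+2) <= (map_mx intr A : 'M[rat]_(d, d.+2)))%MS.
Hypothesis galeB : gale_dual A B.
Hypothesis rows_neq0 : forall i, row i B != 0.
Hypothesis face_beta : is_proper_face (polytope R A) beta.
Hypothesis not_relevant :
  ~ exists l : set 'rV[R]_2, relevant_line B l /\
      forall i, i \in outside A beta -> l (embedR R (row i B)).

Let P := polytope R A.
Let I := outside A beta.
Let n := d.+2.
Let pt (i : 'I_n) : 'cV[R]_d := embedR R (col i A).
Let C := rows_in B I.
Let r := #|I|.
Let AI : 'M[int]_(d, r) := colsub enum_val A.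
Notation mask := (mask_off I).

Lemma polytopeP x : P x <-> exists lam : 'I_n -> R,
  [/\ forall i, 0 <= lam i, \sum_i lam i = 1 & x = \sum_i lam i *: pt i].
Proof.
have -> : P = conv_hull [set pt i | i in [set i | predT i]].
  by congr conv_hull; apply/seteqP; split => y [i _ <-]; exists i.
split=> [/conv_hullP[lam [l0 _ l1 xE]]|[lam [l0 l1 xE]]]; first by exists lam.
by apply/conv_hullP; exists lam; split.
Qed.

Lemma vertex_in i : P (pt i).
Proof.
apply/polytopeP; exists (fun j => (j == i)%:R); split.
- by move=> j; rewrite ler0n.
- by rewrite (bigD1 i)//= eqxx big1 ?addr0// => j /negbTE ->.
- rewrite (bigD1 i)//= eqxx scale1r big1 ?addr0// => j /negbTE ->.
  by rewrite scale0r.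
Qed.

Lemma in_outside i : (i \notin I) = `[< beta (pt i) >].
Proof.
rewrite /I /outside inE negbK; apply/idP/idP => [/set_mem|/asboolP].
  by move=> ?; apply/asboolP.
exact: mem_set.
Qed.

Lemma embed_mulE (y : 'cV[R]_n) : embedR R A *m y = \sum_i y i 0 *: pt i.
Proof.
apply/matrixP => a b; rewrite ord1 mxE summxE; apply: eq_bigr => i _.
by rewrite !mxE mulrC.
Qed.

Lemma ones_functional : exists e : 'rV[R]_d, forall i, (e *m pt i) 0 0 = 1.
Proof.
have /submxP[e eA] := ones_rowspace.
exists (map_mx ratr e) => i.
have -> : pt i = map_mx ratr (col i (map_mx intr A : 'M[rat]_(d, n))).
  by apply/matrixP => a b; rewrite !mxE ratr_int.
by rewrite -map_mxM colE mulmxA -eA -colE !mxE rmorph1.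
Qed.

Lemma functional_sum (h : 'rV[R]_d) (lam : 'I_n -> R) :
  (h *m (\sum_i lam i *: pt i)) 0 0 = \sum_i lam i * (h *m pt i) 0 0.
Proof.
rewrite mulmx_sumr summxE; apply: eq_bigr => i _.
by rewrite -scalemxAr mxE.
Qed.

(** The functional defining the face, made linear with the help of the
    all-one functional. *)
Lemma face_functional : exists h : 'rV[R]_d,
  [/\ forall i, i \notin I -> (h *m pt i) 0 0 = 0,
      forall i, i \in I -> 0 < (h *m pt i) 0 0 &
      forall x, P x -> beta x <-> (h *m x) 0 0 = 0].
Proof.
have [[_ [u [c [uc betaE]]]] _] := face_beta.
have [e e1] := ones_functional.
have hP x : P x -> ((c *: e - u) *m x) 0 0 = c - (u *m x) 0 0.
  move=> /polytopeP[lam [_ l1 ->]].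
  rewrite mulmxBl -scalemxAl mx_subE [X in X - _]mxE (functional_sum e).
  by rewrite (eq_bigr lam) => [|i _]; rewrite ?l1 ?mulr1// e1 mulr1.
have hbeta x : P x -> beta x <-> ((c *: e - u) *m x) 0 0 = 0.
  move=> Px; rewrite hP// betaE; split=> [[_ /= ->]|]; first by rewrite subrr.
  by move=> /eqP; rewrite subr_eq0 => /eqP ->; split.
exists (c *: e - u); split => // i iI; first by apply/hbeta; [exact: vertex_in | move: iI; rewrite in_outside => /asboolP].
rewrite lt_neqAle eq_sym hP; last exact: vertex_in.
rewrite subr_ge0 uc ?andbT; last exact: vertex_in.
apply: contraTN iI => /eqP h0; rewrite in_outside; apply/asboolP/hbeta; first exact: vertex_in.
by rewrite hP//; exact: vertex_in.
Qed.

(** The functional is nonnegative on all points and vanishes on the face, so a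
    convex combination lying in the face gives no weight to the points outside. *)
Lemma face_combination x : beta x -> exists y, x = embedR R A *m mask y.
Proof.
move=> bx; have [h [h0 hI hbeta]] := face_functional.
have Px : P x by have [[_ [u [c [_ bE]]]] _] := face_beta; move: bx; rewrite bE => -[].
have [lam [l0 l1 xE]] := (polytopeP x).1 Px.
have lamI i : i \in I -> lam i = 0.
  move=> iI; have := (hbeta _ Px).1 bx; rewrite xE functional_sum => /eqP.
  rewrite psumr_eq0 => [/allP/(_ i (mem_index_enum _))|j _].
    by rewrite /= mulf_eq0 (gt_eqF (hI i iI)) orbF => /eqP.
  rewrite mulr_ge0//; case: (boolP (j \in I)) => [/hI/ltW //|/h0 -> //].
exists (\col_i lam i); rewrite embed_mulE xE; apply: eq_bigr => i _.
by rewrite !mxE; case: ifP => [/lamI ->|].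
Qed.

Lemma span_faceP x : linear_span beta x <-> exists y, x = embedR R A *m mask y.
Proof.
split=> [[N [p [c [bp ->]]]]|[y ->]].
  have [Y YE] := choice (fun j => face_combination (bp j)).
  exists (\sum_j c j *: mask (Y j)).
  have -> : mask (\sum_j c j *: mask (Y j)) = \sum_j c j *: mask (Y j).
    apply/matrixP => i l; rewrite mxE; case: ifP => iI; last by rewrite ord1.
    by rewrite summxE big1// => j _; rewrite !mxE iI mulr0.
  rewrite mulmx_sumr; apply: eq_bigr => j _.
  by rewrite -scalemxAr -YE.
have [[[x0 bx0] _] _] := face_beta.
exists n, (fun i => if i \in I then x0 else pt i), (fun i => mask y i 0); split.
  by move=> i; case: ifPn => //; rewrite in_outside => /asboolP.
rewrite embed_mulE; apply: eq_bigr => i _.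
by rewrite !mxE; case: ifP => //; rewrite !scale0r.
Qed.

Lemma kerA (x : 'cV[int]_n) : A *m x = 0 <-> saturation B x.
Proof.
have [imB _] := galeB; split=> [Ax|[N N0]].
  by exists 1%N => //; rewrite imB.
rewrite imB /= -scaler_nat -scalemxAr => /matrixP h; apply/matrixP => i j.
have := h i j; rewrite [LHS]mxE [RHS]mxE => /eqP; rewrite mulf_eq0 natz eqz_nat gtn_eqF//=.
by move=> /eqP ->; rewrite mxE.
Qed.

Lemma latticeB (x : 'cV[int]_n) : A *m x = 0 -> exists z, x = B *m z.
Proof.
have [imB _] := galeB; move=> Ax.
by have : column_lattice B x by [rewrite imB]; move=> [z _ <-]; exists z.
Qed.

Lemma span_face_functional (h : 'rV[R]_d) x : (forall i, i \notin I -> (h *m pt i) 0 0 = 0) ->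
  linear_span beta x -> (h *m x) 0 0 = 0.
Proof.
move=> h0 /span_faceP[y ->]; rewrite embed_mulE functional_sum big1// => i _.
by rewrite mxE; case: ifPn => [_|/h0 ->]; rewrite ?mul0r ?mulr0.
Qed.

Lemma outside_nonempty : exists i, i \in I.
Proof.
apply/not_existsP => noI; have [_ []] := face_beta.
have [[_ [u [c [_ bE]]]] _] := face_beta.
apply/seteqP; split => x; first by rewrite bE => -[].
have [h [h0 _ hbeta]] := face_functional.
move=> Px; apply/(hbeta x Px); move: Px => /polytopeP[lam [_ _ ->]].
by rewrite functional_sum big1// => i _; rewrite h0 ?mulr0//; apply/negP/noI.
Qed.

(** The values of the face functional are a positive relation among the rows
    outside the face, so rows on a common line would point both ways. *)
Lemma outside_rows_injective : injective (fun z : 'cV[int]_2 => C *m z).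
Proof.
have inj0 (z : 'cV[int]_2) : C *m z = 0 -> z = 0; last first.
  by move=> a b /= ab; apply/eqP; rewrite -subr_eq0; apply/eqP/inj0; rewrite mulmxBr ab subrr.
move=> Cz; apply/eqP/negPn/negP => zN0; apply: not_relevant.
have bz i : i \in I -> (row i B *m z) 0 0 = 0.
  move=> iI; have := congr1 (fun y : 'cV[int]_r => y (enum_rank_in iI i) 0) Cz.
  rewrite [RHS]mxE => <-; rewrite !mxE; apply: eq_bigr => j _.
  by rewrite !mxE enum_rankK_in.
pose z0 : R := (z 0 0)%:~R; pose z1 : R := (z 1 0)%:~R.
pose N : R := z0 ^+ 2 + z1 ^+ 2.
have N0 : 0 < N.
  rewrite lt_neqAle addr_ge0 ?sqr_ge0// andbT eq_sym paddr_eq0 ?sqr_ge0//.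
  rewrite !sqrf_eq0 !intr_eq0; apply: contra zN0 => /andP[/eqP za /eqP zb].
  by apply/eqP/cV2P; rewrite mxE.
pose v : 'rV[R]_2 := \row_j (if j == 0 then - z1 else z0).
pose t i : R := ((B i 1)%:~R * z0 - (B i 0)%:~R * z1) / N.
have bt i : i \in I -> embedR R (row i B) = t i *: v.
  move=> iI; have := congr1 (intmul (1 : R)) (bz i iI).
  rewrite row2_mul ![row i B _ _]mxE intrD !intrM -/z0 -/z1 => e.
  have e0 : (B i 0)%:~R = t i * - z1.
    apply: (mulIf (lt0r_neq0 N0)); rewrite /t mulrAC mulrN divfK ?gt_eqF//.
    apply/eqP; rewrite -subr_eq0; apply/eqP.
    transitivity (z0 * ((B i 0)%:~R * z0 + (B i 1)%:~R * z1)); last by rewrite e mulr0.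
    by rewrite /N; ring.
  have e1 : (B i 1)%:~R = t i * z0.
    apply: (mulIf (lt0r_neq0 N0)); rewrite /t mulrAC divfK ?gt_eqF//.
    apply/eqP; rewrite -subr_eq0; apply/eqP.
    transitivity (z1 * ((B i 0)%:~R * z0 + (B i 1)%:~R * z1)); last by rewrite e mulr0.
    by rewrite /N; ring.
  apply/matrixP => a j; rewrite ord1 !mxE.
  have [->|->] : j = 0 \/ j = 1 by case: j => [[|[|?]] ?] //; [left|right]; apply: val_inj.
    by rewrite e0.
  by rewrite e1.
have vN0 : v != 0.
  apply/eqP => /matrixP v0; have := v0 0 0; have := v0 0 1; rewrite !mxE/= => a b.
  by move: N0; rewrite /N a (_ : z1 = 0) ?expr0n ?addr0 ?ltxx//; apply: oppr_inj; rewrite b oppr0.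
have tN0 i : i \in I -> t i != 0.
  move=> iI; apply: contra (rows_neq0 i) => /eqP ti; have := bt i iI.
  rewrite ti scale0r => /matrixP b0; apply/eqP/matrixP => a j.
  by have := b0 a j; rewrite [LHS]mxE [RHS]mxE => /eqP; rewrite intr_eq0 => /eqP ->; rewrite mxE.
have [h [h0 hI _]] := face_functional.
have hB : \sum_(i in I) (h *m pt i) 0 0 * t i = 0.
  have e : h *m (embedR R A *m embedR R B) = 0.
    by rewrite -embedRM (mulVC kerA) /embedR map_mx0 mulmx0.
  have e' : \sum_(i in I) (h *m pt i) 0 0 *: embedR R (row i B) = 0.
    transitivity (h *m (embedR R A *m embedR R B)); last by [].
    apply/matrixP => a j; rewrite ord1 mulmxA mxE summxE big_mkcond/=.
    apply: eq_bigr => i _.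
    have -> : (h *m embedR R A) 0 i = (h *m pt i) 0 0.
      by rewrite !mxE; apply: eq_bigr => l _; rewrite !mxE.
    case: ifPn => [_|/h0 ->]; last by rewrite mul0r.
    by rewrite !mxE.
  have : (\sum_(i in I) (h *m pt i) 0 0 * t i) *: v = 0.
    by rewrite scaler_suml -[RHS]e'; apply: eq_bigr => i iI; rewrite (bt i iI) scalerA.
  by move=> /eqP; rewrite scaler_eq0 (negbTE vN0) orbF => /eqP.
have signs (s : R) : s != 0 -> exists2 i, i \in I & 0 < s * t i.
  move=> s0; apply: contrapT => no.
  have le0 i : i \in I -> 0 <= - (s * t i).
    by move=> iI; rewrite oppr_ge0 leNgt; apply/negP => st; apply: no; exists i.
  have [i0 i0I] := outside_nonempty.
  have : \sum_(i in I) (h *m pt i) 0 0 * - (s * t i) == 0.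
    rewrite (eq_bigr (fun i => - s * ((h *m pt i) 0 0 * t i))) => [|i _]; last by ring.
    by rewrite -mulr_sumr hB mulr0.
  rewrite psumr_eq0 => [/allP/(_ i0 (mem_index_enum _))|i iI]; last first.
    by rewrite mulr_ge0 ?le0// ltW// hI.
  rewrite i0I/= mulf_eq0 gt_eqF ?hI//= oppr_eq0 mulf_eq0 (negbTE s0)/=.
  by rewrite (negbTE (tN0 i0 i0I)).
have [i1 i1I ti1] := signs 1 (oner_neq0 _).
have [|i2 i2I ti2] := signs (-1); first by rewrite oppr_eq0 oner_neq0.
exists [set s *: v | s in [set: R]]; split; last first.
  by move=> i iI; rewrite bt//; exists (t i).
split; first by exists v.
exists i1, i2; split => //.
- by rewrite bt//; exists (t i1).
- by rewrite bt//; exists (t i2).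
exists (t i2 / t i1); last by rewrite !bt// scalerA divfK ?tN0.
rewrite mul1r in ti1; rewrite mulN1r oppr_gt0 in ti2.
by rewrite pmulr_llt0 ?invr_gt0.
Qed.

Lemma Zspan_faceP x : Zspan A beta x <-> exists y, x = A *m mask y.
Proof.
split=> [[z ->]|[y ->]].
  by exists (\col_i z i); rewrite mulmx_mask; apply: eq_bigr => i _; rewrite mxE.
by exists (fun i => y i 0); rewrite mulmx_mask.
Qed.

Lemma outside_relation z : AI *m (C *m z) = A *m mask (- (B *m z)).
Proof.
have : A *m (B *m z) = 0 by rewrite mulmxA (mulVC kerA) mul0mx.
rewrite (mulmx_split I) -/AI.
have -> : rowsub enum_val (B *m z) = C *m z by rewrite -mul_rowsub_mx.
by move=> /eqP; rewrite addr_eq0 mask_offN mulmxN => /eqP.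
Qed.

(** A relation between the points outside the face and those on it is an element
    of the kernel of [A], hence of the lattice of [B]. *)
Lemma Zspan_face_lattice x : Zspan A beta (AI *m x) <-> column_lattice C x.
Proof.
split=> [/Zspan_faceP[y xy]|[z _ <-]]; last first.
  by apply/Zspan_faceP; exists (- (B *m z)); rewrite outside_relation.
have [|z zE] := @latticeB (extend_by_zero x - mask y).
  rewrite mulmxBr (mulmx_split I) -/AI rowsub_extend mask_extend mulmx0 addr0.
  by rewrite xy subrr.
exists z => //; rewrite /C /rows_in mul_rowsub_mx -zE raddfB/= rowsub_extend.
rewrite (_ : rowsub _ (mask y) = 0) ?subr0//.
by apply/matrixP => i j; rewrite !mxE enum_valP.
Qed.

(** The real span of the face meets the lattice in the saturation: a real
    relation lies in the real span of the Gale dual, and its integral part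
    outside the face forces rational coefficients. *)
Lemma span_face_saturation x : linear_span beta (embedR R (AI *m x)) <-> saturation C x.
Proof.
split=> [/span_faceP[y xy]|[N N0 /Zspan_face_lattice/Zspan_faceP[y xy]]]; last first.
  have xR : (N%:R : R) *: embedR R (AI *m x) = embedR R A *m mask (embedR R y).
    have -> : mask (embedR R y) = embedR R (mask y).
      by apply/matrixP => i j; rewrite !mxE; case: ifP.
    rewrite -scaler_nat -scalemxAr in xy; rewrite -embedRM -xy.
    by apply/matrixP => i j; rewrite !mxE intrM natz pmulrn.
  apply/span_faceP; exists (N%:R^-1 *: embedR R y).
  have -> : mask (N%:R^-1 *: embedR R y) = N%:R^-1 *: mask (embedR R y).
    by apply/matrixP => i j; rewrite !mxE; case: ifP; rewrite ?mulr0.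
  by rewrite -scalemxAr -xR scalerA mulVf ?scale1r// pnatr_eq0 -lt0n.
pose v : 'cV[R]_n := extend_by_zero (embedR R x) - mask y.
have [|s sE] := real_kernel kerA (R := R) (Y := v).
  rewrite mulmxBr (mulmx_split I) rowsub_extend mask_extend mulmx0 addr0 -xy embedRM.
  have -> : colsub enum_val (embedR R A) = embedR R AI by apply/matrixP => i j; rewrite !mxE.
  by rewrite subrr.
have xC : embedR R x = embedR R C *m s.
  have -> : embedR R C = rowsub enum_val (embedR R B) by apply/matrixP => i j; rewrite !mxE.
  rewrite mul_rowsub_mx -sE raddfB/= rowsub_extend (_ : rowsub _ (mask y) = 0) ?subr0//.
  by apply/matrixP => i j; rewrite !mxE enum_valP.
have ratrE a b (M : 'M[int]_(a, b)) : embedR R M = map_mx ratr (map_mx intr M : 'M[rat]_(a, b)).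
  by apply/matrixP => i j; rewrite !mxE ratr_int.
have : ((embedR R x)^T <= (embedR R C)^T)%MS by rewrite xC trmx_mul submxMl.
rewrite !ratrE !(map_trmx (@ratr R)) map_submx => /submxP[q qE].
have xq : map_mx intr x = map_mx intr C *m q^T :> 'cV[rat]_r.
  by rewrite -[LHS]trmxK qE trmx_mul trmxK.
have [N N0 [z Nz]] := clear_denominators q^T.
exists N => //; exists z => //; apply: intr_mx_inj.
rewrite map_mxM -Nz -scalemxAr -xq -[x *+ N]scaler_nat.
by apply/matrixP => i j; rewrite !mxE intrM natz pmulrn.
Qed.

Lemma outside_polytope i : i \notin outside A P.
Proof.
rewrite inE negbK; apply/mem_set; exact: vertex_in.
Qed.

Lemma Zspan_polytopeP x : Zspan A P x <-> exists y, x = A *m y.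
Proof.
have e (z : 'I_n -> int) : \sum_(i | i \notin outside A P) z i *: col i A = A *m \col_i z i.
  apply/matrixP => a b; rewrite ord1 mxE summxE; rewrite (eq_bigl xpredT) => [|i]; last first.
    exact: outside_polytope.
  by apply: eq_bigr => i _; rewrite !mxE mulrC.
split=> [[z ->]|[y ->]]; first by exists (\col_i z i); rewrite e.
exists (fun i => y i 0); rewrite e; congr (_ *m _).
by apply/matrixP => i j; rewrite ord1 mxE.
Qed.

Lemma Zspan_faceB x y : Zspan A beta x -> Zspan A beta y -> Zspan A beta (x - y).
Proof.
move=> /Zspan_faceP[a ->] /Zspan_faceP[b ->]; apply/Zspan_faceP; exists (a - b).
rewrite -mulmxBr; congr (_ *m _).
by apply/matrixP => i j; rewrite !mxE; case: ifP; rewrite ?subrr.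
Qed.

(** By the two preceding descriptions the quotient is that of the saturation of
    the lattice of [C] by the lattice itself. *)
Lemma face_index_minors : face_index A P beta =
  \big[gcdn/0%N]_(i < r) \big[gcdn/0%N]_(j < r) `|det2 (row i C) (row j C)|%N.
Proof.
have [D [rho [rho_sat cover inj DE]]] := saturation_reps outside_rows_injective.
rewrite -DE; apply: (group_index_reps (rho := fun j => AI *m rho j)).
- exact: Zspan_faceB.
- by apply/Zspan_faceP; exists 0; rewrite (_ : mask 0 = 0) ?mulmx0//; apply/matrixP => i j; rewrite !mxE; case: ifP.
- move=> j; split; last exact/span_face_saturation.
  apply/Zspan_polytopeP; exists (extend_by_zero (rho j)).
  by rewrite (mulmx_split I) rowsub_extend mask_extend mulmx0 addr0.
- move=> v /= [/Zspan_polytopeP[y ->]]; rewrite (mulmx_split I) -/AI.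
  set x := rowsub _ y => spv.
  have /span_face_saturation/cover[j Lj] : linear_span beta (embedR R (AI *m x)).
    move: spv => /span_faceP[t tE]; apply/span_faceP; exists (t - embedR R y).
    have -> : mask (t - embedR R y) = mask t - embedR R (mask y).
      by apply/matrixP => i l; rewrite !mxE; case: ifP; rewrite ?subrr.
    rewrite mulmxBr -tE -embedRM /embedR raddfD/= addrK//.
  exists j; rewrite addrAC -mulmxBr.
  have /Zspan_faceP[t tE] := (Zspan_face_lattice _).2 Lj.
  apply/Zspan_faceP; exists (t + y); rewrite tE -mulmxDr; congr (_ *m _).
  by apply/matrixP => i l; rewrite !mxE; case: ifP; rewrite ?addr0.
- by move=> i j; rewrite -mulmxBr => /Zspan_face_lattice/inj.
Qed.

Section Coordinates.
Variables (k : nat) (f : 'cV[int]_d -> 'cV[int]_k).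
Hypothesis coords_f : quotient_coordinates A P beta f.

Definition outside_coordinates : 'M[int]_(k, r) := \matrix_(i, j) f (col (enum_val j) A) i 0.
Notation V := outside_coordinates.

Lemma col_coordinates j : col j V = f (col (enum_val j) A).
Proof. by apply/matrixP => i l; rewrite ord1 !mxE. Qed.

Lemma coordinates_mul y : f (A *m y) = (\matrix_(i, j) f (col j A) i 0) *m y.
Proof.
have [fD _ _] := coords_f.
have gD a b : f (A *m (a + b)) = f (A *m a) + f (A *m b).
  by rewrite mulmxDr fD//; apply/Zspan_polytopeP; eexists.
have g0 : f (A *m 0) = 0.
  by apply: (addrI (f (A *m 0))); rewrite -gD !addr0.
have gN a : f (A *m - a) = - f (A *m a).
  by apply/eqP; rewrite -addr_eq0 -gD addNr g0.
have gMn a m : f (A *m (a *+ m)) = f (A *m a) *+ m.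
  by elim: m => [|m IH]; rewrite ?mulr0n ?g0// !mulrS gD IH.
have gZ (c : int) a : f (A *m (c *: a)) = c *: f (A *m a).
  case: c => m; first by rewrite -natz !scaler_nat gMn.
  by rewrite NegzE !scaleNr gN -natz !scaler_nat gMn.
rewrite [in LHS](matrix_sum_delta y) (big_morph (fun a => f (A *m a)) gD g0).
apply/matrixP => i j; rewrite ord1 summxE mxE; apply: eq_bigr => l _.
by rewrite big_ord1 gZ -colE !mxE mulrC.
Qed.

Lemma face_coordinates j : j \notin I -> f (col j A) = 0.
Proof.
move=> jI; have [_ _ f0] := coords_f; apply/f0.
  by apply/Zspan_polytopeP; exists (delta_mx j 0); rewrite -colE.
exists 1%N, (fun=> pt j), (fun=> 1); split; last by rewrite big_ord1 scale1r.
by move=> _; move: jI; rewrite in_outside => /asboolP.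
Qed.

Lemma outside_coordinatesE y : f (A *m y) = V *m rowsub enum_val y.
Proof.
rewrite coordinates_mul (mulmx_split I) mulmx_mask big1 ?addr0 => [|i iI].
  by congr (_ *m _); apply/matrixP => i j; rewrite !mxE.
rewrite (_ : col i _ = 0) ?scaler0//.
by have := face_coordinates iI => /matrixP e; apply/matrixP => a b; rewrite !mxE e mxE.
Qed.

Lemma outside_coordinates_surj (a : 'cV[int]_k) : exists x, V *m x = a.
Proof.
have [_ fT _] := coords_f.
have : [set: 'cV[int]_k] a by [].
rewrite -fT => -[v /Zspan_polytopeP[y ->] <-].
by exists (rowsub enum_val y); rewrite outside_coordinatesE.
Qed.

Lemma outside_coordinates_ker x : V *m x = 0 <-> saturation C x.
Proof.
have [_ _ f0] := coords_f.
have xE : AI *m x = A *m extend_by_zero x.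
  by rewrite (mulmx_split I) rowsub_extend mask_extend mulmx0 addr0.
rewrite -span_face_saturation -f0; last by apply/Zspan_polytopeP; exists (extend_by_zero x).
by rewrite xE outside_coordinatesE rowsub_extend.
Qed.

Lemma outside_coordinates_neq0 j : embedR R (col j V) != 0.
Proof.
apply/eqP => v0; have fj : f (col (enum_val j) A) = 0.
  rewrite -col_coordinates; apply/matrixP => a b; rewrite [RHS]mxE.
  by have /matrixP/(_ a b) := v0; rewrite [LHS]mxE [RHS]mxE => /eqP; rewrite intr_eq0 => /eqP.
have [_ _ f0] := coords_f.
have sp : linear_span beta (pt (enum_val j)).
  by apply/f0 => //; apply/Zspan_polytopeP; exists (delta_mx (enum_val j) 0); rewrite -colE.
have [h [h0 hI _]] := face_functional.
by have := hI _ (enum_valP j); rewrite (span_face_functional h0 sp) ltxx.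
Qed.

Lemma quotient_configurationE : quotient_configuration A P f =
  [set embedR R (col i (with_origin V)) | i in setT].
Proof.
have colL (i : 'I_r) : col (lshift 1 i) (with_origin V) = col i V.
  by apply/matrixP => a b; rewrite !mxE (unsplitK (inl i)) mxE.
have colR : col (rshift r 0) (with_origin V) = 0.
  by apply/matrixP => a b; rewrite !mxE (unsplitK (inr 0)) mxE.
have [[[x0 bx0] _] _] := face_beta.
have [j0 j0I] : exists j, j \notin I.
  apply/not_existsP => noJ.
  have allI j : j \in I by apply/negPn/negP/noJ.
  have [y yE] := face_combination bx0.
  have [e e1] := ones_functional.
  have [u [c [_ bE]]] := face_beta.1.2.
  have Px : P x0 by move: bx0; rewrite bE => -[].
  have [lam [_ l1 xE]] := (polytopeP x0).1 Px.
  have := functional_sum e lam; rewrite -xE (eq_bigr lam) => [|i _]; last by rewrite e1 mulr1.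
  rewrite l1 yE (_ : mask y = 0) ?mulmx0 ?mxE => [/eqP|]; first by rewrite eq_sym oner_eq0.
  by apply/matrixP => i l; rewrite !mxE allI.
apply/seteqP; split => v.
  move=> [i _ <-]; case: (boolP (i \in I)) => iI.
    exists (lshift 1 (enum_rank_in iI i)) => //.
    by rewrite colL col_coordinates enum_rankK_in.
  by exists (rshift r 0) => //; rewrite colR face_coordinates.
move=> [i _ <-]; case: (splitP i) => l il.
  have -> : i = lshift 1 l by apply: val_inj.
  exists (enum_val l); last by rewrite colL col_coordinates.
  exact: outside_polytope.
have -> : i = rshift r 0 by apply: val_inj; rewrite /= il ord1.
exists j0; last by rewrite colR face_coordinates.
exact: outside_polytope.
Qed.

Lemma quotient_configurationD0 : quotient_configuration A P f `\ 0 =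
  [set embedR R (col i V) | i in setT].
Proof.
rewrite quotient_configurationE; apply/seteqP; split => v.
  move=> [[i _ <-] /eqP vN0]; case: (splitP i) => l il.
    have iE : i = lshift 1 l by apply: val_inj.
    exists l => //; rewrite iE; congr (embedR R _).
    by apply/matrixP => a b; rewrite !mxE (unsplitK (inl l)) mxE.
  case/negP: vN0; apply/eqP.
  have -> : i = rshift r 0 by apply: val_inj; rewrite /= il ord1.
  by apply/matrixP => a b; rewrite !mxE (unsplitK (inr 0)) mxE.
move=> [i _ <-]; split; last exact/eqP/outside_coordinates_neq0.
exists (lshift 1 i) => //; congr (embedR R _).
by apply/matrixP => a b; rewrite !mxE (unsplitK (inl i)) mxE.
Qed.

End Coordinates.

(** Coordinates on the quotient: an integer matrix vanishing exactly on the
    span of the face, put in Smith normal form on the lattice of the points,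
    whose nonzero elementary divisors are divided out. *)
Lemma coordinates_exist : exists k (f : 'cV[int]_d -> 'cV[int]_k),
  quotient_coordinates A P beta f.
Proof.
pose AQ := map_mx intr A : 'M[rat]_(d, n).
pose AJ : 'M[rat]_(d, n) := \matrix_(i, j) (if j \in I then 0 else AQ i j).
pose K0 : 'M[rat]_d := (cokermx AJ^T)^T.
have spanK (x : 'cV[int]_d) : linear_span beta (embedR R x) <-> K0 *m map_mx intr x = 0.
  have -> : K0 *m map_mx intr x = 0 <-> ((map_mx intr x : 'cV[rat]_d)^T <= AJ^T)%MS.
    rewrite submxE /K0; split=> [e|/eqP e].
      by rewrite -[X in X == 0]trmxK trmx_mul trmxK e trmx0.
    by rewrite -[LHS]trmxK trmx_mul trmxK e trmx0.
  have ratrE a b (M : 'M[int]_(a, b)) : embedR R M = map_mx ratr (map_mx intr M : 'M[rat]_(a, b)).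
    by apply/matrixP => i j; rewrite !mxE ratr_int.
  have AJE (y : 'cV[R]_n) : map_mx ratr AJ *m y = embedR R A *m mask y.
    apply/matrixP => i j; rewrite ord1 !mxE; apply: eq_bigr => l _; rewrite !mxE.
    by case: ifP => _; rewrite ?rmorph0 ?mul0r ?mulr0 ?ratr_int.
  rewrite -(map_submx (@ratr R)) -!map_trmx -ratrE.
  split=> [/span_faceP[y ->]|/submxP[y yE]].
    by rewrite -AJE trmx_mul submxMl.
  by apply/span_faceP; exists y^T; rewrite -AJE -[LHS]trmxK yE trmx_mul trmxK.
have [N N0 [K' K'E]] := clear_denominators (mxvec K0)^T.
pose K : 'M[int]_d := vec_mx K'^T.
have KE : map_mx intr K = N%:R *: K0 :> 'M[rat]_d.
  by rewrite /K map_vec_mx -map_trmx -K'E linearZ/= trmxK linearZ/= mxvecK.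
have {}spanK (x : 'cV[int]_d) : linear_span beta (embedR R x) <-> K *m x = 0.
  rewrite spanK; have e : map_mx intr (K *m x) = N%:R *: (K0 *m map_mx intr x) :> 'cV[rat]_d.
    by rewrite map_mxM KE scalemxAl.
  split=> [Kx|Kx]; first by apply: intr_mx_inj; rewrite e Kx scaler0 map_mx0.
  have /eqP : N%:R *: (K0 *m map_mx intr x) = 0 :> 'cV[rat]_d by rewrite -e Kx map_mx0.
  by rewrite scaler_eq0 pnatr_eq0 gtn_eqF//= => /eqP.
have [U Uu [W Wu [dv _ ME]]] := int_Smith_normal_form (K *m A).
set D0 := \matrix_(i, j) _ in ME.
pose I0 : {set 'I_d} := finset (fun i : 'I_d => (dv`_i != 0) && (i < n)%N).
pose ord (j : 'I_#|I0|) : 'I_n := inord (enum_val j).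
have ordE j : ord j = enum_val j :> nat.
  by rewrite inordK//; have := enum_valP j; rewrite inE => /andP[].
have dv_ord j : dv`_(ord j) != 0.
  by rewrite ordE; have := enum_valP j; rewrite inE => /andP[].
have ord_inj : injective ord.
  by move=> i j ij; apply/enum_val_inj/val_inj; rewrite /= -!ordE ij.
have D0_ord (t : 'cV[int]_n) j : (D0 *m t) (enum_val j) 0 = dv`_(ord j) * t (ord j) 0.
  rewrite mxE (bigD1 (ord j))//= big1 ?addr0 => [|l lj].
    by rewrite mxE ordE eqxx mulr1n.
  rewrite mxE -(ordE j) (negbTE (_ : val (ord j) != val l)) ?mulr0n ?mul0r//.
  by rewrite val_eqE eq_sym.
have D0_ker (t : 'cV[int]_n) : (forall j, t (ord j) 0 = 0) -> D0 *m t = 0.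
  move=> t0; apply/matrixP => i l; rewrite ord1 [RHS]mxE.
  case: (boolP (i \in I0)) => iI0.
    by rewrite -(enum_rankK_in iI0 iI0) D0_ord t0 mulr0.
  rewrite mxE big1// => j _; rewrite mxE; case: eqP => [ij|]; rewrite ?mulr0n ?mul0r//.
  move: iI0; rewrite inE ij ltn_ord andbT negbK => /eqP ->.
  by rewrite mul0r.
pose f (x : 'cV[int]_d) : 'cV[int]_#|I0| :=
  \col_j ((invmx U *m (K *m x)) (enum_val j) 0%R %/ dv`_(ord j))%Z.
have fE y : f (A *m y) = rowsub ord (W *m y).
  apply/matrixP => j l; rewrite ord1 [LHS]mxE mulmxA ME -!mulmxA mulKmx// D0_ord.
  by rewrite mulKz// [RHS]mxE.
exists #|I0|, f; split.
- move=> x y /Zspan_polytopeP[a ->] /Zspan_polytopeP[b ->].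
  by rewrite -mulmxDr !fE mulmxDr raddfD.
- apply/seteqP; split => // a _.
  pose t : 'cV[int]_n := \col_l \sum_j (if ord j == l then a j 0 else 0).
  exists (A *m (invmx W *m t)); first by apply/Zspan_polytopeP; eexists.
  rewrite fE mulKVmx//; apply/matrixP => j l; rewrite ord1 !mxE.
  rewrite (bigD1 j)//= eqxx big1 ?addr0// => i ij.
  by rewrite (inj_eq ord_inj) (negbTE ij).
move=> x /Zspan_polytopeP[y ->]; rewrite spanK fE mulmxA ME -!mulmxA.
split=> [/matrixP fy|Dy].
  rewrite D0_ker ?mulmx0// => j.
  by have := fy j 0; rewrite [LHS]mxE [RHS]mxE.
have {}Dy : D0 *m (W *m y) = 0 by rewrite -(mulKmx Uu (D0 *m _)) Dy mulmx0.
apply/matrixP => j l; rewrite ord1 [LHS]mxE [RHS]mxE.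
have := D0_ord (W *m y) j; rewrite Dy mxE => /esym/eqP.
by rewrite mulf_eq0 (negbTE (dv_ord j)) => /eqP.
Qed.

End FaceOfPolytope.

(** * The theorem *)

Lemma completed_gale_balanced n (B : 'M[int]_(n, 2)) (I : {set 'I_n}) :
  completed_gale (rows_in B I) = balanced_rows B I.
Proof.
rewrite /completed_gale /completion_mx mul_col_mx mul1mx; congr col_mx.
rewrite mulNmx; congr (- _); apply/matrixP => i j; rewrite !ord1 mxE summxE.
rewrite [RHS]big_enum_val; apply: eq_bigr => l _.
by rewrite !mxE mul1r.
Qed.

Local Close Scope classical_set_scope.
Theorem theorem3p4 (R : realType) (d : nat)
    (A : 'M[int]_(d, d.+2)) (B : 'M[int]_(d.+2, 2)) (beta : set 'cV[R]_d)
    (rankA : \rank (map_mx intr A : 'M[rat]_(d, d.+2)) = d)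
    (ones_rowspace :
       ((const_mx 1 : 'rV[rat]_d.+2) <=
        (map_mx intr A : 'M[rat]_(d, d.+2)))%MS)
    (galeB : gale_dual A B)
    (rows_neq0 : forall i, row i B != 0)
    (face_beta : is_proper_face (polytope R A) beta)
    (not_relevant :
       ~ exists l : set 'rV[R]_2, relevant_line B l /\
           forall i, i \in outside A beta -> l (embedR R (row i B))) :
  let I := outside A beta in
  let w := balancing_row B I in
  let L := column_lattice (balanced_rows B I) in
  subdiagram_volume A (polytope R A) beta =
    ratr (ideal_degree (lattice_ideal (complex R) L)) / (torsion_order L)%:R
    - (\sum_(j in I | 0 < det2 w (row j B)) det2 w (row j B))%:~R
      / (torsion_order L)%:R
  /\ face_index A (polytope R A) beta = torsion_order L
  /\ torsion_order L =
       \big[gcdn/0%N]_(i in I) \big[gcdn/0%N]_(j in I)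
          `|det2 (row i B) (row j B)|%N.
Proof.
move=> I w L; set C := rows_in B I.
have LE : L = column_lattice (completed_gale C) by rewrite completed_gale_balanced.
have wE : dsubmx (completed_gale C) = w by rewrite completed_gale_balanced col_mxKd.
have Cinj : injective (fun z : 'cV[int]_2 => C *m z).
  exact: (outside_rows_injective ones_rowspace galeB rows_neq0 face_beta not_relevant).
have [k0 [f0 coords0]] := coordinates_exist ones_rowspace face_beta.
have tors : torsion_order L =
    \big[gcdn/0%N]_(i < #|I|) \big[gcdn/0%N]_(j < #|I|) `|det2 (row i C) (row j C)|%N.
  have [D [_ [_ [_ _ _ [DE <-]]]]] := torsion_data Cinj
    (outside_coordinates_ker ones_rowspace galeB face_beta coords0).
  by rewrite LE.
have torsE : torsion_order L =
    \big[gcdn/0%N]_(i in I) \big[gcdn/0%N]_(j in I) `|det2 (row i B) (row j B)|%N.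
  rewrite tors [RHS]big_enum_val; apply: eq_bigr => i _.
  rewrite [RHS]big_enum_val; apply: eq_bigr => j _.
  by rewrite !row_rowsub.
have idx : face_index A (polytope R A) beta = torsion_order L.
  rewrite tors; exact: (face_index_minors ones_rowspace galeB rows_neq0 face_beta not_relevant).
split; last by split.
rewrite /subdiagram_volume; set vols := (X in xget 0 X).
(* The volumes are computed in arbitrary coordinates, so the ones chosen by xget
   need not be identified: it is enough that some exist. *)
have /= [k [f [coords ->]]] : vols (xget 0 vols).
  apply: (@xgetPex _ 0 vols); eexists; exists k0, f0; split; [exact: coords0 | reflexivity].
have surj := outside_coordinates_surj coords.
have ker := outside_coordinates_ker ones_rowspace galeB face_beta coords.
rewrite (quotient_configurationD0 ones_rowspace face_beta coords).
rewrite (quotient_configurationE ones_rowspace face_beta coords).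
have T0 : (torsion_order L)%:R != 0 :> R.
  have [D [_ [cls [_ _ _ [DE _]]]]] := torsion_data Cinj ker.
  rewrite LE -DE pnatr_eq0.
  by case: (D) (cls 0) => // -[].
have := volume_with_origin R Cinj surj ker (complex R).
have := volume_of_points R Cinj surj ker.
rewrite -LE wE => v2 v1.
have sumE : \sum_(j in I | 0 < det2 w (row j B)) det2 w (row j B) =
    \sum_(j < #|I| | 0 < det2 w (row j C)) det2 w (row j C).
  rewrite big_enum_val_cond; apply: eq_big => [j|j _]; by rewrite row_rowsub.
by rewrite sumE -v1 -v2 ![(torsion_order L)%:R * _]mulrC !mulfK.
Qed.
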